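(* Let $p,q>0$, $\Omega=\{(t,x):0<t<q,\ 0<x<p\}$, and let $\alpha,\beta,\gamma,\delta,a,b\in\mathbb{R}$ with $\alpha>0$, $0<\beta<1$, $\gamma>0$, $a<0$, $b<0$, $\delta<0$. Let $\varphi\in C[0,q]\cap C^1(0,q)$, $\psi\in C[0,p]\cap C^1(0,p)$, $M\in C[0,q]$ with $M\not\equiv 0$, and suppose $\varphi(0)-\int_0^q M(t)\varphi(t)\,dt=\psi(0)$. Let $f(t,x)=t^{-\varepsilon_1}x^{-\varepsilon_2}\widetilde f_1(t,x)$ for $(t,x)\in\Omega$, where $\widetilde f_1\in C(\overline\Omega)$, $0\le\varepsilon_1<\beta$ and $0\le\varepsilon_2<1$. Put $$A=1-\int_0^q M(t)\Big(1+a\,\Gamma(\gamma)\,t^{\beta}\,\mathcal{E}(t)\Big)dt,$$ $$g(0)=\varphi(0)-\varphi(0)\int_0^q M(t)\,dt-a\,\Gamma(\gamma)\,\varphi(0)\int_0^q M(t)\,t^{\beta}\,\mathcal{E}(t)\,dt,$$ where $$\mathcal{E}(t)=E_2\left(\left.\begin{aligned}&\gamma,1,\gamma;0,1;\\&\beta,\alpha,\beta+1;\gamma,\gamma;1,1;\end{aligned}\right|\begin{matrix}a t^{\beta}\\ \delta t^{\alpha}\end{matrix}\right)=\sum_{m=0}^\infty\sum_{k=0}^\infty\frac{\Gamma(\gamma m+k+\gamma)}{\Gamma(\gamma)\,\Gamma(\beta m+\alpha k+\beta+1)}\,\frac{(a t^\beta)^m}{\Gamma(\gamma m+\gamma)}\,\frac{(\delta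 t^\alpha)^k}{\Gamma(k+1)}.$$ Assume $A\neq 0$ and $\varphi(0)=G(0)$, where $G(0)=g(0)/A$. Then there exists a unique regular solution $u$ of the equation $$\frac{\partial}{\partial x}\,{}^{PC}D_{0t}^{\alpha,\beta,\gamma,\delta}u(t,x)-a\frac{\partial}{\partial x}u(t,x)-b\,{}^{PC}D_{0t}^{\alpha,\beta,\gamma,\delta}u(t,x)=f(t,x)\quad\text{in }\Omega$$ satisfying the boundary condition $$u(t,0)=\varphi(t),\quad 0\le t\le q,$$ and the nonlocal condition $$u(0,x)-\int_0^q M(t)\,u(t,x)\,dt=\psi(x),\quad 0\le x\le p.$$
   Context: All functions are real-valued. Generalized (Prabhakar) Mittag-Leffler function: $$E_{\alpha,\beta}^{\gamma}(z)=\sum_{m=0}^\infty\frac{(\gamma)_m}{\Gamma(\alpha m+\beta)}\frac{z^m}{m!},$$ where $(\gamma)_m$ is the Pochhammer symbol (rising factorial). Prabhakar fractional integral: $${}^{P}I_{0t}^{\alpha,\beta,\gamma,\delta}y(t)=\int_0^t (t-\xi)^{\beta-1}E_{\alpha,\beta}^{\gamma}\big[\delta(t-\xi)^\alpha\big]y(\xi)\,d\xi,\quad t>0.$$ Caputo-Prabhakar operator, for $m-1<\beta<m$: $${}^{PC}D_{0t}^{\alpha,\beta,\gamma,\delta}y(t)={}^{P}I_{0t}^{\alpha,m-\beta,-\gamma,\delta}\frac{d^m}{dt^m}y(t).$$ Thus for $0<\beta<1$ it is $${}^{PC}D_{0t}^{\alpha,\beta,\gamma,\delta}y(t)=\int_0^t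 (t-\xi)^{-\beta}E_{\alpha,1-\beta}^{-\gamma}\big[\delta(t-\xi)^\alpha\big]y'(\xi)\,d\xi.$$ When applied to $u(t,x)$, the operator acts in the variable $t$ for fixed $x$. Bivariate Mittag-Leffler type function: $$E_2\left(\left.\begin{aligned}&\alpha_1,\beta_1,\gamma_1;\alpha_2,\gamma_2;\\&\alpha_3,\beta_2,\delta_1;\alpha_4,\delta_2;\beta_3,\delta_3;\end{aligned}\right|\begin{matrix}x\\ y\end{matrix}\right)=\sum_{m=0}^\infty\sum_{k=0}^\infty\frac{\Gamma(\alpha_1m+\beta_1k+\gamma_1)\Gamma(\alpha_2m+\gamma_2)}{\Gamma(\gamma_1)\Gamma(\gamma_2)\Gamma(\alpha_3m+\beta_2k+\delta_1)}\frac{x^m}{\Gamma(\alpha_4m+\delta_2)}\frac{y^k}{\Gamma(\beta_3k+\delta_3)},$$ which converges for all real $x,y$ if $\alpha_3+\alpha_4-\alpha_1-\alpha_2>0$ and $\beta_2+\beta_3-\beta_1>0$. A regular solution is a function $u$ satisfying the equation in $\Omega$ and the stated conditions, such that $u\in C(\overline\Omega)$, $u_x\in C(\Omega)$ and ${}^{PC}D_{0t}^{\alpha,\beta,\gamma,\delta}u\in C(\Omega)$.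
   Formalization: The Caputo-Prabhakar derivative of u is taken in the generalized sense (closure of the classical operator with y'), not with a pointwise t-derivative: for f merely continuous in t, u may be nowhere differentiable in t, so existence fails literally. *)

(* Defs.v *)
From HB Require Import structures.
From mathcomp Require Import all_boot all_order all_algebra.
From mathcomp Require Import all_classical all_reals all_analysis.

Set Implicit Arguments.
Unset Strict Implicit.
Unset Printing Implicit Defensive.

Import Order.TTheory GRing.Theory Num.Theory.
Import numFieldNormedType.Exports.

Local Open Scope classical_set_scope.
Local Open Scope ring_scope.

Section special_functions.
Context {R : realType}.
Notation mu := (@lebesgue_measure R).

(* Euler's integral: this is the Gamma function only for [0 < x].  Every
   argument of [Gamma] occurring in the theorem is positive. *)
Definition Gamma (x : R) : R :=
  \int[mu]_(s in `]0, +oo[) (s `^ (x - 1) * expR (- s)).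

Definition pochhammer (c : R) (m : nat) : R := \prod_(i < m) (c + i%:R).

(* Prabhakar's three-parameter function E_{alpha,beta}^gamma(z). *)
Definition prabhakarE (alpha beta gamma z : R) : R :=
  limn (series (fun m : nat =>
    pochhammer gamma m / Gamma (alpha * m%:R + beta) * (z ^+ m / (m`!)%:R))).

(* The parameters are read row by row:
   (al1, be1, ga1; al2, ga2; al3, be2, de1; al4, de2; be3, de3 | x, y);
   the double sum is iterated, as it is absolutely convergent when
   al3 + al4 - al1 - al2 > 0 and be2 + be3 - be1 > 0. *)
Definition E2 (al1 be1 ga1 al2 ga2 al3 be2 de1 al4 de2 be3 de3 x y : R) : R :=
  limn (series (fun m : nat => limn (series (fun k : nat =>
    (Gamma (al1 * m%:R + be1 * k%:R + ga1) * Gamma (al2 * m%:R + ga2))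
      / (Gamma ga1 * Gamma ga2 * Gamma (al3 * m%:R + be2 * k%:R + de1))
    * (x ^+ m / Gamma (al4 * m%:R + de2))
    * (y ^+ k / Gamma (be3 * k%:R + de3)))))).

End special_functions.

Section prabhakar_operators.
Context {R : realType}.
Notation mu := (@lebesgue_measure R).

Definition prabhakarI (alpha beta gamma delta : R) (y : R -> R) (t : R) : R :=
  \int[mu]_(xi in `]0, t[)
    ((t - xi) `^ (beta - 1)
     * prabhakarE alpha beta gamma (delta * (t - xi) `^ alpha) * y xi).

(* Meant for [m%:R - 1 < beta < m%:R]. *)
Definition caputo_prabhakar (m : nat) (alpha beta gamma delta : R)
    (y : R -> R) : R -> R :=
  prabhakarI alpha (m%:R - beta) (- gamma) delta (derive1n m y).

(* C[0,r] `&` C^1(0,r) *)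
Definition C0_C1 (r : R) (y : R -> R) : Prop :=
  [/\ {within `[0, r], continuous y},
      forall t, 0 < t < r -> derivable y t 1 &
      {within `]0, r[, continuous (derive1 y)}].

(* [caputo_prabhakar 1 alpha beta gamma delta y t] is an absolutely convergent
   integral of the classical derivative for all such [y] and [0 < t < q]. *)
Definition classical_domain (q : R) (y : R -> R) : Prop :=
  C0_C1 q y /\ mu.-integrable `]0, q[ (EFin \o derive1 y).

(* [v] is the Caputo-Prabhakar derivative (0 < beta < 1) of [y] on ]0, q[, the
   derivative y' under the integral sign being understood in the strong
   generalized sense: (y, v) lies in the closure of the graph of the operator
   y |-> int_0^t (t-xi)^(-beta) E_{alpha,1-beta}^{-gamma}[delta (t-xi)^alpha]
   y'(xi) dxi on [classical_domain q], for uniform convergence on [0, q] of the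
   functions and locally uniform convergence on ]0, q[ of their images.

   A regular solution is required to have neither a continuous nor a pointwise
   t-derivative, only a continuous Caputo-Prabhakar derivative, and y' cannot
   be taken pointwise here: solving for u involves a Prabhakar integral of
   order beta < 1 of a source that is merely continuous in t, which may be
   nowhere differentiable. *)
Definition is_caputo_prabhakar (q alpha beta gamma delta : R)
    (y v : R -> R) : Prop :=
  forall c d e : R, 0 < c -> d < q -> 0 < e ->
  exists z : R -> R,
    [/\ classical_domain q z,
        forall t, 0 <= t <= q -> `|z t - y t| <= e &
        forall t, c <= t <= d ->
          `|caputo_prabhakar 1 alpha beta gamma delta z t - v t| <= e].

(* The operator extends its classical version. *)
Lemma is_caputo_prabhakar_classical (q alpha beta gamma delta : R)
    (y : R -> R) : classical_domain q y ->
  is_caputo_prabhakar q alpha beta gamma delta y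
    (caputo_prabhakar 1 alpha beta gamma delta y).
Proof.
by move=> ydom c d e _ _ e0; exists y; split=> // t _;
  rewrite subrr normr0 ltW.
Qed.

End prabhakar_operators.

Section problem.
Context {R : realType}.
Notation mu := (@lebesgue_measure R).

(* Points of the plane are pairs (t, x). *)
Definition Omega (p q : R) : set (R * R) :=
  [set z | 0 < z.1 < q /\ 0 < z.2 < p].

Definition partial_x (u : R * R -> R) (z : R * R) : R :=
  derive1 (fun x => u (z.1, x)) z.2.

Definition x_derivable (u : R * R -> R) (z : R * R) : Prop :=
  derivable (fun x => u (z.1, x)) z.2 1.

(* [v] is the Caputo-Prabhakar t-derivative of [u]. *)
Definition regular_solution
    (p q alpha beta gamma delta a b : R) (f : R * R -> R)
    (phi psi M : R -> R) (u : R * R -> R) : Prop :=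
  exists v : R * R -> R,
    [/\ [/\ {within closure (Omega p q), continuous u},
            forall x, 0 < x < p -> is_caputo_prabhakar q alpha beta gamma delta
              (fun t => u (t, x)) (fun t => v (t, x)) &
            {within Omega p q, continuous v}],
        (forall z, Omega p q z -> x_derivable u z) /\
          {within Omega p q, continuous (partial_x u)},
        forall z, Omega p q z -> x_derivable v z /\
          partial_x v z - a * partial_x u z - b * v z = f z,
        forall t, 0 <= t <= q -> u (t, 0) = phi t &
        forall x, 0 <= x <= p ->
          u (0, x) - \int[mu]_(t in `[0, q]) (M t * u (t, x)) = psi x].

End problem.

(* Main.v *)
Require Import Defs.
From HB Require Import structures.
From mathcomp Require Import all_boot all_order all_algebra.
From mathcomp Require Import all_classical all_reals all_analysis.
From mathcomp Require Import measurable_realfun ring lra.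
Set Implicit Arguments.
Unset Strict Implicit.
Unset Printing Implicit Defensive.
Import Order.TTheory GRing.Theory Num.Theory.
Import numFieldNormedType.Exports.
Local Open Scope classical_set_scope.
Local Open Scope ring_scope.

(** Let [v] be the Caputo-Prabhakar derivative of [u] in [t]. The equation says that
    [v - a * u] solves [y_x = b * y + (a * b * u + f)], a linear equation in [x]
    whose solution operator is the explicit [exp_primitive]; what remains is to
    invert the derivative in [t].

    The classical operator is the convolution of the derivative with the kernel
    [k = caputo_kernel], and [k] is inverse for convolution to the Prabhakar kernel
    [K] of order [be]: [k * K = 1] ([kernel_inverse]). This is one case of the
    semigroup law [prabhakar_convolution], which follows from the Beta integral and
    the Chu-Vandermonde identity. For a [y] that is only continuous, to have the
    continuous [v] as generalized derivative means exactly that [k * (y - y 0)]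
    ([caputo_integral]) is a primitive of [v]: [caputo_increment] in one direction,
    [caputo_of_increment], by averages of [y] over short intervals, in the other.
    Convolution with [K] then turns the problem into the Volterra equation

    [u - u0 = e^(bx) (phi - phi 0) + K (a u - a e^(bx) phi + a b J + t^(-e1) XF)],

    where [u0] is the value of [u] at [t = 0], and [J] and [XF] are the exponential
    primitives in [x] of [u] and of the source without its factor [t^(-e1)].

    The resolvent [S = 1 + a K S] is the sum of the iterates of the constant [1],
    and these are Prabhakar kernels again; so [S t = 1 + a Gamma(ga) t`^be E(t)]
    ([resolvent_function]), and the determinant [A] of the statement is
    [1 - \int M S]. Adding [S] times a function of [x] changes [u (0, x)] and
    respects the Volterra equation, and since [A] is nonzero the nonlocal condition
    can be reached in this way ([nonlocal_lift]).

    For existence the unknown is not [u] but a density [rho] of which one summand of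
    [u] is an exponential primitive in [x]: this makes [u] differentiable in [x] by
    construction. The density solves a linear fixed-point equation
    ([density_equation]); its operator contracts a sup norm weighted by
    [expR (l t + m x)] ([clamped_step_contraction]), because weakly singular kernels
    have small norm for heavy weights ([volterra_weighted_le]).

    For uniqueness, the difference [d] of two solutions has [v - a d] differentiable
    only in [x], while [v] is only a density in [t]. Integrating in both variables
    yields a continuous function whose mixed second differences vanish and which is
    zero on the axes, hence zero ([mixed_potential_zero]). Going back gives the
    homogeneous Volterra equation ([difference_equation]); then [d - d (0, x) S] is
    a fixed point of the same contraction ([reduced_equation]), so it vanishes, and
    with it [d]. *)

(** * Affine changes of variable *)

Section affine_change_of_variable.
Context {R : realType}.
Notation mu := (@lebesgue_measure R).
Notation image_measure :=
  measure_function_pushforward__canonical__measure_function_Measure.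

(** For positive [c] the pulled-back measure, multiplied by [c], gives half-open
    intervals their length, and this characterizes the Lebesgue measure; a
    reflection reduces the negative case to this one. *)
Lemma lebesgue_measure_affine (c d : R) (A : set R) : c != 0 -> measurable A ->
  (`|c|%:E * mu ((fun x : R => (c * x + d)%R) @^-1` A))%E = mu A.
Proof.
move=> c0 mA.
pose phi : measurableTypeR R -> measurableTypeR R := fun x => c * x + d.
have mphi : measurable_fun setT phi.
  by apply: measurable_funD => //; exact: measurable_funM.
have posaff (e : R) : 0 < e -> forall B, measurable B ->
    (e%:E * mu ((fun x : R => (e * x + d)%R) @^-1` B))%E = mu B.
  move=> e0 B mB.
  pose phi' : measurableTypeR R -> measurableTypeR R := fun x => e * x + d.
  have mphi' : measurable_fun setT phi'.
    by apply: measurable_funD => //; exact: measurable_funM.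
  pose m := mscale (NngNum (ltW e0)) (image_measure mu mphi').
  suff: forall X, measurable X -> mu X = m X by move=> /(_ B mB) ->.
  apply: lebesgue_measure_unique => _ [[a b]] _ <-.
  change (mu `]a, b]%classic = (e%:E * mu (phi' @^-1` `]a, b]%classic))%E).
  rewrite (_ : phi' @^-1` _ = `](a - d) / e, (b - d) / e]%classic); last first.
    apply/seteqP; split => x /=; rewrite !in_itv/= /phi'.
      by rewrite ltr_pdivrMr// ler_pdivlMr// ltrBlDr lerBrDr [x * e]mulrC.
    by rewrite ltr_pdivrMr// ler_pdivlMr// ltrBlDr lerBrDr [x * e]mulrC.
  rewrite !lebesgue_measure_itv/= !lte_fin ltr_pM2r ?invr_gt0// ltrD2r.
  case: ifPn => _; last by rewrite mule0.
  rewrite -!EFinB -EFinM -mulrBl opprB addrA subrK mulrC divfK ?gt_eqF//.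
have [cpos|cneg|] := ltgtP 0 c; last by move/esym/eqP; rewrite (negbTE c0).
  by rewrite gtr0_norm// posaff.
rewrite ltr0_norm//.
have mphiA : measurable (phi @^-1` A) by rewrite -[_ @^-1` _]setTI; exact: mphi.
rewrite -[X in (_ * X)%E](lebesgue_measureN mphiA).
rewrite -[RHS](posaff (- c) _ A)//; last by rewrite oppr_gt0.
congr (_ * mu _)%E; apply/seteqP; split => x /=; by rewrite /phi mulrN mulNr.
Qed.

Lemma ge0_integral_affine (c d : R) (D : set R) (f : R -> \bar R) : c != 0 ->
  measurable D -> measurable_fun D f -> (forall x, D x -> 0 <= f x)%E ->
  (\int[mu]_(x in D) f x = `|c|%:E *
   \int[mu]_(x in (fun x : R => (c * x + d)%R) @^-1` D) f (c * x + d)%R)%E.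
Proof.
move=> c0 mD mf f0.
pose phi : measurableTypeR R -> measurableTypeR R := fun x => c * x + d.
have mphi : measurable_fun setT phi.
  by apply: measurable_funD => //; exact: measurable_funM.
pose m := mscale (NngNum (normr_ge0 c)) (image_measure mu mphi).
rewrite (eq_measure_integral m); last first.
  by move=> A mA _; rewrite /= -(lebesgue_measure_affine d c0 mA).
rewrite ge0_integral_mscale//; congr (_ * _)%E.
rewrite ge0_integral_pushforward//.
by move=> y /set_mem; exact: f0.
Qed.

Lemma Rintegral_affine (c d : R) (D : set R) (f : R -> R) : c != 0 ->
  measurable D -> mu.-integrable D (EFin \o f) ->
  let D' := (fun x : R => (c * x + d)%R) @^-1` D in
  [/\ measurable D', mu.-integrable D' (EFin \o (fun x => f (c * x + d))) &
      \int[mu]_(x in D) f x = `|c| * \int[mu]_(x in D') f (c * x + d)].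
Proof.
move=> c0 mD intf D'.
have mphi : measurable_fun setT (fun x : R => c * x + d).
  by apply: measurable_funD => //; exact: measurable_funM.
have mD' : measurable D' by rewrite -[D']setTI; exact: mphi.
have mf := measurable_int mu intf.
have int' : mu.-integrable D' (EFin \o (fun x => f (c * x + d))).
  apply/integrableP; split.
    rewrite [EFin \o _](_ : _ = (EFin \o f) \o (fun x : R => c * x + d))//.
    apply: measurable_comp mf _ => //; last exact: measurable_funS mphi.
    by move=> _ [x D'x <-].
  case/integrableP: intf => _; rewrite (@ge0_integral_affine c d)//; last first.
    by apply: measurableT_comp.
  rewrite -/D' => h; rewrite ltNge leye_eq; apply/negP => /eqP E.
  by move: h; rewrite E gt0_muley ?ltxx// lte_fin normr_gt0.
split => //.
rewrite /Rintegral -[X in X * _]/(fine `|c|%:E) -fineM//; last first.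
  exact: integrable_fin_num int'.
congr fine; rewrite integralE [in RHS]integralE.
rewrite (@ge0_integral_affine c d)//; last exact: measurable_funepos.
rewrite [X in (_ - X)%E](@ge0_integral_affine c d)//; last exact: measurable_funeneg.
rewrite -/D' [RHS]muleBr//; last first.
  exact: (integrable_add_def _ int').
congr (_ * _ - _ * _)%E; apply: eq_integral => x _.
  by rewrite funeposE [in RHS]funeposE.
by rewrite funenegE [in RHS]funenegE.
Qed.

End affine_change_of_variable.

(** * Integration on bounded intervals *)

Notation L1 D f := ((@lebesgue_measure _).-integrable D (EFin \o f)) (only parsing).

Section integration.
Context {R : realType}.
Notation mu := (@lebesgue_measure R).
Implicit Types (D : set R) (f g h w : R -> R).

Lemma powR_add (x r s : R) : 0 < x -> x `^ (r + s) = x `^ r * x `^ s.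
Proof. by move=> x0; apply: powRD; rewrite (gt_eqF x0) implybT. Qed.

Lemma le_L1 D f g : measurable D -> measurable_fun D f -> L1 D g ->
  (forall x, D x -> `|f x| <= g x) -> L1 D f.
Proof.
move=> mD mf intg fg; apply: le_integrable intg => //.
  exact/measurable_EFinP.
by move=> x Dx /=; rewrite lee_fin (le_trans (fg _ Dx))// ler_norm.
Qed.

Lemma L1D D f g : measurable D -> L1 D f -> L1 D g -> L1 D (fun x => f x + g x).
Proof. by move=> mD intf intg; exact: (integrableD _ intf intg). Qed.

Lemma L1B D f g : measurable D -> L1 D f -> L1 D g -> L1 D (fun x => f x - g x).
Proof. by move=> mD intf intg; exact: (integrableB _ intf intg). Qed.

Lemma L1Zl D f (c : R) : measurable D -> L1 D f -> L1 D (fun x => c * f x).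
Proof. by move=> mD intf; exact: (integrableZl _ _ intf). Qed.

Lemma L1_mulr_bounded D w h (C : R) : measurable D -> L1 D w ->
  measurable_fun D h -> (forall x, D x -> `|h x| <= C) ->
  L1 D (fun x => w x * h x).
Proof.
move=> mD intw mh hC.
have mw : measurable_fun D w by apply/measurable_EFinP; exact: (measurable_int mu intw).
apply: (@le_L1 _ _ (fun x => C * `|w x|)) => //.
- exact: measurable_funM.
- by apply: L1Zl => //; exact: integrable_norm.
- by move=> x Dx; rewrite normrM mulrC ler_wpM2r// hC.
Qed.

Lemma normr_Rintegral_le D f g : measurable D -> measurable_fun D f ->
  L1 D g -> (forall x, D x -> `|f x| <= g x) ->
  `|\int[mu]_(x in D) f x| <= \int[mu]_(x in D) g x.
Proof.
move=> mD mf intg fg; have intf := le_L1 mD mf intg fg.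
apply: le_trans; first exact: le_normr_Rintegral.
apply: le_Rintegral => //; exact: integrable_norm.
Qed.

Lemma L1_continuous_itv f (i : interval R) (a b : R) : continuous f ->
  [set` i] `<=` `[a, b] -> L1 [set` i] f.
Proof.
move=> cf iab.
have : L1 `[a, b] f.
  apply: continuous_compact_integrable; first exact: segment_compact.
  exact: continuous_subspaceT.
by apply: integrableS.
Qed.

Lemma L1_continuous_oo f (a b : R) : continuous f -> L1 `]a, b[ f.
Proof. by move=> cf; apply: (@L1_continuous_itv _ _ a b) => //; exact: subset_itv_oo_cc. Qed.

Lemma Rintegral_sum_ord D (F : nat -> R -> R) n : measurable D ->
  (forall i, L1 D (F i)) ->
  L1 D (fun s => \sum_(i < n) F i s) /\
  \int[mu]_(s in D) (\sum_(i < n) F i s) = \sum_(i < n) \int[mu]_(s in D) F i s.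
Proof.
move=> mD LF; elim: n => [|n [ih1 ih2]].
  rewrite (_ : (fun s => \sum_(i < 0) F i s) = cst 0); last first.
    by apply/funext => s; rewrite big_ord0.
  by rewrite big_ord0 Rintegral_cst// mul0r; split => //; exact: integrable0.
rewrite (_ : (fun s => \sum_(i < n.+1) F i s) = (fun s => \sum_(i < n) F i s + F n s)).
  by split; [exact: L1D|rewrite RintegralD// ih2 big_ord_recr].
by apply/funext => s; rewrite big_ord_recr.
Qed.

Lemma L1_reflect t f : L1 `]0, t[ f -> L1 `]0, t[ (fun s => f (t - s)).
Proof.
move=> intf; have [] := @Rintegral_affine R (-1) t _ _ _ _ intf => //.
rewrite (_ : _ @^-1` _ = `]0, t[%classic); last first.
  by apply/seteqP; split => s /=; rewrite !in_itv/= => /andP[? ?]; apply/andP; split; lra.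
move=> _ + _; congr (_.-integrable _ _); apply/funext => s /=; congr (_%:E).
by rewrite mulN1r addrC.
Qed.

Lemma Rintegral_reflect t f : L1 `]0, t[ f ->
  \int[mu]_(s in `]0, t[) f s = \int[mu]_(s in `]0, t[) f (t - s).
Proof.
move=> intf; have [] := @Rintegral_affine R (-1) t _ _ _ _ intf => //.
rewrite (_ : _ @^-1` _ = `]0, t[%classic); last first.
  by apply/seteqP; split => s /=; rewrite !in_itv/= => /andP[? ?]; apply/andP; split; lra.
move=> _ _ ->; rewrite normrN1 mul1r; apply: eq_Rintegral => s _; congr f.
by rewrite mulN1r addrC.
Qed.

Lemma Rintegral_scale t f : 0 < t -> L1 `]0, t[ f ->
  L1 `]0, 1[ (fun s => f (t * s)) /\
  \int[mu]_(s in `]0, t[) f s = t * \int[mu]_(s in `]0, 1[) f (t * s).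
Proof.
move=> t0 intf; have [] := @Rintegral_affine R t 0 _ _ _ _ intf => //.
  by rewrite gt_eqF.
rewrite (_ : _ @^-1` _ = `]0, 1[%classic); last first.
  by apply/seteqP; split => s /=; rewrite !in_itv/= addr0 => /andP[? ?];
    apply/andP; split; nra.
have E : (fun s => f (t * s + 0)) = (fun s => f (t * s)).
  by apply/funext => s; rewrite addr0.
by move=> _; rewrite gtr0_norm// E => i1 ->; split => //; rewrite E.
Qed.

Lemma Rintegral_translate (a b d : R) f : L1 `]a, b[ f ->
  L1 `](a - d), (b - d)[ (fun s => f (s + d)) /\
  \int[mu]_(s in `]a, b[) f s = \int[mu]_(s in `](a - d), (b - d)[) f (s + d).
Proof.
move=> intf; have [] := @Rintegral_affine R 1 d _ _ _ _ intf => //.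
rewrite (_ : _ @^-1` _ = `](a - d), (b - d)[%classic); last first.
  by apply/seteqP; split => s /=; rewrite !in_itv/= mul1r => /andP[? ?]; apply/andP; split; lra.
have E : (fun s => f (1 * s + d)) = (fun s => f (s + d)).
  by apply/funext => s; rewrite mul1r.
by move=> _; rewrite normr1 mul1r E => i1 ->; split => //; rewrite E.
Qed.

Lemma Rintegral_itvoo_split (a b c : R) f : a <= b <= c -> L1 `]a, c[ f ->
  \int[mu]_(x in `]a, c[) f x =
  \int[mu]_(x in `]a, b[) f x + \int[mu]_(x in `]b, c[) f x.
Proof.
move=> /andP[ab bc] intf.
have intab : L1 `]a, b[ f.
  by apply: integrableS intf => //; apply: subset_itvl; rewrite bnd_simp.
have := @Rintegral_itvB R f (BRight a) (BLeft c) b intf.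
rewrite !bnd_simp => /(_ ab).
move: bc; rewrite le_eqVlt => /predU1P[<- _|bc /(_ bc) <-].
  by rewrite set_itvoo0 Rintegral_set0 addr0.
by rewrite -Rintegral_itv_bndo_bndc// addrC subrK.
Qed.

(** The fundamental theorem of calculus applies on [`[T / (i + 2), T]]; monotone
    convergence in [i] then reaches the singular endpoint [0]. *)
Lemma Rintegral_nonneg_power (b T : R) : 0 < b -> 0 <= T ->
  L1 `]0, T[ (fun s => s `^ (b - 1)) /\
  \int[mu]_(s in `]0, T[) s `^ (b - 1) = T `^ b / b.
Proof.
move=> b0; rewrite le_eqVlt => /predU1P[<-|T0].
  rewrite set_itvoo0 Rintegral_set0 powR0 ?gt_eqF// mul0r; split => //.
  exact: integrable_set0.
have mp : measurable_fun setT (fun s : R => s `^ (b - 1)) by exact: measurable_powR.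
have main : (\int[mu]_(s in `]0%R, T[) (s `^ (b - 1))%:E = (T `^ b / b)%:E)%E.
  pose F := fun i : nat => `[T / i.+2%:R, T]%classic.
  have lt1 (i : nat) : T / i.+2%:R < T.
    by rewrite ltr_pdivrMr// ltr_pMr// ltr1n.
  have pos1 (i : nat) : 0 < T / i.+2%:R by rewrite divr_gt0.
  have UF : \bigcup_i F i = `]0, T]%classic.
    apply/seteqP; split => [x [i _]|x] /=; rewrite !in_itv/=.
      by rewrite /F /= in_itv/= => /andP[h ->]; rewrite (lt_le_trans _ h).
    move=> /andP[x0 xT]; exists (Num.trunc (T / x)) => //; rewrite /F/= in_itv/= xT andbT.
    rewrite ler_pdivrMr// mulrC -ler_pdivrMr//.
    have := truncnS_gt (T / x); move=> /ltW/le_trans; apply.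
    by rewrite ler_nat.
  transitivity (\int[mu]_(s in `]0%R, T]) (s `^ (b - 1))%:E)%E.
    rewrite integral_itv_bndo_bndc//.
    by apply/measurable_EFinP; exact: measurable_funTS.
  (* Monotone convergence along the intervals [F i]. *)
  rewrite -UF.
  have /cvg_lim <- // : (\int[mu]_(s in F i) (s `^ (b - 1))%:E @[i --> \oo] -->
      \int[mu]_(s in \bigcup_i F i) (s `^ (b - 1))%:E)%E.
  apply: ge0_nondecreasing_set_cvg_integral.
  - move=> m n mn; apply/subsetPset; apply: subset_itvr; rewrite bnd_simp.
    by rewrite ler_pM2l// lef_pV2 ?posrE// ler_nat !ltnS.
  - by move=> i; exact: measurable_itv.
  - by move=> i; apply/measurable_EFinP; exact: measurable_funTS.
  - by move=> i x _; rewrite lee_fin powR_ge0.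
  have FE (i : nat) : (\int[mu]_(s in F i) (s `^ (b - 1))%:E =
      (T `^ b / b - (T / i.+2%:R) `^ b / b)%:E)%E.
    have cp c : 0 < c -> {for c, continuous (fun s : R => s `^ b / b)}.
      move=> c0; apply: differentiable_continuous; apply/derivable1_diffP.
      by apply: derivableM => //; apply: derivable_powR; rewrite in_itv/= c0.
    rewrite (@continuous_FTC2 _ _ (fun s => s `^ b / b))//.
    - apply: continuous_in_subspaceT => x; rewrite inE/= in_itv/= => /andP[xl _].
      apply: differentiable_continuous; apply/derivable1_diffP.
      by apply: derivable_powR; rewrite in_itv/= andbT (lt_le_trans _ xl).
    - split.
      + move=> x; rewrite in_itv/= => /andP[xl _]; apply: derivableM => //.
        by apply: derivable_powR; rewrite in_itv/= andbT (lt_trans _ xl).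
      + by apply: cvg_at_right_filter; apply: cp.
      + by apply: cvg_at_left_filter; apply: cp.
    - move=> x; rewrite in_itv/= => /andP[xl _].
      have x0 : 0 < x by rewrite (lt_trans _ xl).
      rewrite derive1E deriveMr//; last by apply: derivable_powR; rewrite in_itv/= x0.
      have [_ ->] := is_derive1_powR b x0.
      by rewrite mulrA mulVf ?gt_eqF// mul1r.
  under eq_fun do rewrite FE.
  apply/cvg_lim => //; apply: cvg_EFin; first exact: nearW.
  rewrite -[X in _ --> X]subr0; apply: cvgB; first exact: cvg_cst.
  rewrite -(mul0r b^-1); apply: cvgM; last exact: cvg_cst.
  have /cvg_at_rightP := powR_cvg0 b0; apply; split => [n|]; first exact: pos1.
  rewrite -(mulr0 T); apply: cvgM; first exact: cvg_cst.
  have := @cvg_harmonic R; rewrite -cvg_shiftS; exact.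
split.
- apply/integrableP; split.
    by apply/measurable_EFinP; exact: measurable_funTS.
  under eq_integral do rewrite /= ger0_norm ?powR_ge0//.
  by rewrite main ltry.
- by rewrite /Rintegral main.
Qed.

End integration.

(** * The Gamma function and the Beta integral *)

Section gamma_beta.
Context {R : realType}.
Notation mu := (@lebesgue_measure R).

Definition gamma_kernel (x s : R) : R := s `^ (x - 1) * expR (- s).

Lemma gamma_kernel_ge0 x s : 0 <= gamma_kernel x s.
Proof. by rewrite mulr_ge0 ?powR_ge0 ?expR_ge0. Qed.

Lemma measurable_gamma_kernel x : measurable_fun setT (gamma_kernel x).
Proof.
apply: measurable_funM; first exact: measurable_powR.
apply: continuous_measurable_fun => s; apply: continuous_comp; first exact: opp_continuous.
exact: continuous_expR.
Qed.

Lemma measurable_EFin_gamma_kernel x D : measurable_fun D (fun s => (gamma_kernel x s)%:E).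
Proof. by apply/measurable_EFinP; apply: measurable_funTS; exact: measurable_gamma_kernel. Qed.

Lemma L1_expRN (r : R) : 0 < r -> L1 `]0, +oo[ (fun s => expR (- (r * s))).
Proof.
move=> r0; have intp := integrable_exponential_pdf r0.
have : L1 `]0, +oo[ (fun s => r^-1 * exponential_pdf r s).
  apply: L1Zl => //.
  by move: intp; apply: integrableS.
apply: eq_integrable => // s; rewrite inE/= in_itv/= andbT => s0.
rewrite exponential_pdfE ?ltW// mulrA mulVf ?gt_eqF// mul1r.
by rewrite mulNr.
Qed.

(** Below [2] the power is integrable and the exponential is at most [1]; above, a
    power of [s] is absorbed by [expR (s / 2)]. *)
Lemma gamma_integrable (x : R) : 0 < x -> L1 `]0, +oo[ (gamma_kernel x).
Proof.
(* The bound [s ^+ n.+1 <= C * expR (s / 2)] is one term of the exponential series. *)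
move=> x0; pose n := Num.trunc x; pose C : R := 2 ^+ n.+1 * n.+1`!%:R.
pose g s := ((fun s => s `^ (x - 1)) \_ (`]0, 2[%classic)) s + C * expR (- (2^-1 * s)).
have intg : L1 `]0, +oo[ g.
  apply: L1D => //.
    have : L1 `]0, 2[ (fun s => s `^ (x - 1)) by apply: (Rintegral_nonneg_power x0 _).1.
    move/integrable_mkcond => /(_ _); rewrite restrict_EFin => h.
    by move: (h (measurable_itv _)); apply: integrableS.
  by apply: L1Zl => //; apply: L1_expRN; rewrite invr_gt0.
apply: le_L1 intg _ => //; first by apply: measurable_funTS; exact: measurable_gamma_kernel.
move=> s /=; rewrite in_itv/= andbT => s0.
rewrite ger0_norm ?gamma_kernel_ge0// /g patchE; case: ifPn => [|].
  rewrite inE/= in_itv/= s0/= => s2.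
  apply: (@le_trans _ _ (s `^ (x - 1))); last first.
    by rewrite lerDl !mulr_ge0 ?expR_ge0// ?exprn_ge0.
  by rewrite /gamma_kernel ler_piMr ?powR_ge0// expR_le1 oppr_le0 ltW.
rewrite notin_setE/= in_itv/= s0/= => /negP; rewrite -leNgt => s2.
rewrite add0r.
have -> : C * expR (- (2^-1 * s)) = C * expR (2^-1 * s) * expR (- s).
  by rewrite -mulrA -expRD; congr (_ * expR _); lra.
rewrite ler_wpM2r ?expR_ge0//.
apply: (@le_trans _ _ (s ^+ n.+1)).
  rewrite -(powR_mulrn _ (ltW s0)); apply: ler_powR; first by lra.
  by have := truncnS_gt x; rewrite -/n; lra.
have hs : 0 <= 2^-1 * s by lra.
have h := expR_ge1Dxn n hs.
have {h}: (2^-1 * s) ^+ n.+1 / n.+1`!%:R <= expR (2^-1 * s) by rewrite (le_trans _ h)// lerDr.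
rewrite ler_pdivrMr ?ltr0n ?fact_gt0// exprMn exprVn mulrC ler_pdivrMr ?exprn_gt0//.
by move=> /le_trans; apply; rewrite /C; lra.
Qed.

Lemma EFin_Gamma (x : R) : 0 < x ->
  (Gamma x)%:E = (\int[mu]_(s in `]0%R, +oo[) (gamma_kernel x s)%:E)%E.
Proof.
by move=> x0; rewrite /Gamma /Rintegral fineK//; apply: integrable_fin_num => //;
  exact: gamma_integrable.
Qed.

(** Only the part of Euler's integral over [`]T, T + 1[] is kept. As [T] is
    arbitrary, this makes Gamma grow faster than every geometric sequence, which is
    all that the convergence of the Mittag-Leffler series requires. *)
Lemma Gamma_lower (x T : R) : 0 < x -> 0 < T ->
  T `^ x * (expR (- (T + 1)) / (T + 1)) <= Gamma x.
Proof.
move=> x0 T0; rewrite -lee_fin EFin_Gamma//.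
apply: (@le_trans _ _ (\int[mu]_(s in `]T, (T + 1)%R[) (gamma_kernel x s)%:E)%E); last first.
  apply: ge0_subset_integral => //.
  - exact: measurable_EFin_gamma_kernel.
  - by move=> s _; rewrite lee_fin gamma_kernel_ge0.
  - by move=> s /=; rewrite !in_itv/= andbT => /andP[? _]; rewrite (lt_trans T0).
apply: (@le_trans _ _ (\int[mu]_(s in `]T, (T + 1)%R[)
    (T `^ x * (expR (- (T + 1)) / (T + 1)))%:E)%E).
  rewrite integral_cst//= lebesgue_measure_itv/= lte_fin ltrDl ltr01 -EFinD.
  by rewrite addrAC subrr add0r mule1.
apply: ge0_le_integral => //.
- by move=> s _; rewrite lee_fin mulr_ge0 ?powR_ge0// divr_ge0 ?expR_ge0//; lra.
- exact: measurable_EFin_gamma_kernel.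
- move=> s /=; rewrite in_itv/= => /andP[Ts sT]; rewrite lee_fin /gamma_kernel.
  have s0 : 0 < s by rewrite (lt_trans T0).
  rewrite powRB; last by rewrite (gt_eqF s0) implybT.
  rewrite (powRr1 (ltW s0)) [expR (- (T + 1)) / _]mulrC mulrA.
  apply: ler_pM.
  + by rewrite mulr_ge0 ?powR_ge0// invr_ge0; lra.
  + exact: expR_ge0.
  + apply: ler_pM; rewrite ?powR_ge0 ?invr_ge0//; first by lra.
      by apply: ge0_ler_powR; rewrite ?nnegrE ?ltW.
    by rewrite lef_pV2 ?posrE; lra.
  + by rewrite ler_expR; lra.
Qed.

Lemma Gamma_gt0 (x : R) : 0 < x -> 0 < Gamma x.
Proof.
move=> x0; apply: lt_le_trans (Gamma_lower x0 ltr01).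
by rewrite mulr_gt0 ?powR_gt0// divr_gt0 ?expR_gt0.
Qed.

Lemma Gamma1 : Gamma 1 = 1 :> R.
Proof.
have h := @integral_exponential_pdf R 1 ltr01.
apply: EFin_inj; rewrite EFin_Gamma// -[RHS]h.
rewrite /exponential_pdf -[RHS]/(\int[mu]_x (((fun x : R => 1 * expR (- 1 * x)) \_ `[0%R, +oo[) x)%:E)%E.
transitivity (\int[mu]_(s in `[0%R, +oo[) (gamma_kernel 1 s)%:E)%E.
  by rewrite integral_itv_obnd_cbnd//; exact: measurable_EFin_gamma_kernel.
rewrite integral_mkcond; apply: eq_integral => s _.
rewrite restrict_EFin/= !patchE; case: ifPn => //.
by rewrite /gamma_kernel subrr powRr0 !mul1r mulN1r.
Qed.

(** Extended-real valued, so that Tonelli's theorem can be used before finiteness is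
    known. *)
Definition beta_eintegral (a b t : R) : \bar R :=
  (\int[mu]_(s in `]0%R, t[) ((t - s) `^ (a - 1) * s `^ (b - 1))%:E)%E.

Lemma measurable_beta_kernel (a b t : R) : measurable_fun setT (fun s : R => (t - s) `^ (a - 1) * s `^ (b - 1)).
Proof.
apply: measurable_funM; last exact: measurable_powR.
apply: (measurableT_comp (measurable_powR _)).
by apply: measurable_funB => //; exact: measurable_id.
Qed.

(** Extended by zero to the whole line: the triangle [0 < s < w] in the product of
    two Gamma integrals is then encoded by the integrand. *)
Definition gamma_kernel_ext (a : R) : R -> \bar R := EFin \o ((gamma_kernel a) \_ (`]0, +oo[%classic)).

Lemma gamma_kernel_ext_ge0 a s : (0 <= gamma_kernel_ext a s)%E.
Proof. by rewrite lee_fin patchE; case: ifPn => // _; exact: gamma_kernel_ge0. Qed.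

Lemma measurable_gamma_kernel_ext a : measurable_fun setT (gamma_kernel_ext a).
Proof.
apply/measurable_EFinP/measurable_restrict => //; apply: measurable_funTS.
exact: measurable_gamma_kernel.
Qed.

Lemma measurable_EFin_beta_kernel (a b t : R) D :
  measurable_fun D (fun s : R => ((t - s) `^ (a - 1) * s `^ (b - 1))%:E).
Proof. by apply/measurable_EFinP; apply: measurable_funTS; exact: measurable_beta_kernel. Qed.

Lemma gamma_kernel_extE a s : gamma_kernel_ext a s = if 0 < s then (gamma_kernel a s)%:E else 0%E.
Proof. by rewrite /gamma_kernel_ext/= patchE mem_setE in_itv/= andbT; case: ifPn. Qed.

Lemma EFin_Gamma_ext a : 0 < a -> (Gamma a)%:E = (\int[mu]_s gamma_kernel_ext a s)%E.
Proof.
move=> a0; rewrite EFin_Gamma// integral_mkcond; apply: eq_integral => s _.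
by rewrite /gamma_kernel_ext restrict_EFin.
Qed.

Lemma beta_eintegral_scale (a b t : R) : 0 < t ->
  beta_eintegral a b t = ((t `^ (a + b - 1))%:E * beta_eintegral a b 1)%E.
Proof.
move=> t0; rewrite /beta_eintegral (@ge0_integral_affine _ t 0); last 4 first.
- by rewrite gt_eqF.
- exact: measurable_itv.
- exact: measurable_EFin_beta_kernel.
- by move=> s _; rewrite lee_fin mulr_ge0 ?powR_ge0.
rewrite (_ : _ @^-1` _ = `]0, 1[%classic); last first.
  by apply/seteqP; split => s /=; rewrite !in_itv/= addr0 => /andP[? ?];
    apply/andP; split; nra.
rewrite (gtr0_norm t0).
transitivity (t%:E * (\int[mu]_(s in `]0%R, 1%R[) ((t `^ (a + b - 2))%:E *
    ((1 - s) `^ (a - 1) * s `^ (b - 1))%:E)))%E.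
  congr (_ * _)%E; apply: eq_integral => s; rewrite inE/= in_itv/= => /andP[s0 s1].
  rewrite addr0 -EFinM; congr (_%:E).
  have -> : t - t * s = t * (1 - s) by rewrite mulrBr mulr1.
  have s10 : 0 <= 1 - s by rewrite subr_ge0 ltW.
  rewrite (powRM _ (ltW t0) s10) (powRM _ (ltW t0) (ltW s0)).
  have -> : a + b - 2 = (a - 1) + (b - 1) by lra.
  have -> : t `^ ((a - 1) + (b - 1)) = t `^ (a - 1) * t `^ (b - 1).
    exact: powR_add.
  by rewrite mulrACA.
rewrite ge0_integralZl_EFin; last 4 first.
- exact: measurable_itv.
- by move=> s _; rewrite lee_fin mulr_ge0 ?powR_ge0.
- exact: measurable_EFin_beta_kernel.
- exact: powR_ge0.
rewrite muleA -EFinM; congr (_%:E * _)%E.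
rewrite -{1}(powRr1 (ltW t0)) -powR_add//.
by congr (_ `^ _); lra.
Qed.

(** By Tonelli: in the product of the two integrals put [w] for the sum of the
    variables and integrate over the other one first. *)
Lemma Gamma_mulE (a b : R) : 0 < a -> 0 < b ->
  (Gamma a * Gamma b)%:E = (beta_eintegral a b 1 * (Gamma (a + b))%:E)%E.
Proof.
move=> a0 b0; rewrite EFinM.
rewrite [X in (_ * X)%E = _](EFin_Gamma_ext b0).
rewrite -ge0_integralZl; last 4 first.
- exact: measurableT.
- exact: measurable_gamma_kernel_ext.
- by move=> s _; exact: gamma_kernel_ext_ge0.
- by rewrite lee_fin ltW// Gamma_gt0.
(* First variable [s], second variable [w], the sum of both integration variables. *)
pose f (z : measurableTypeR R * measurableTypeR R) : \bar R := (gamma_kernel_ext a (z.2 - z.1)%R * gamma_kernel_ext b z.1)%E.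
have mf : measurable_fun setT f.
  apply: emeasurable_funM.
    apply: (measurableT_comp (measurable_gamma_kernel_ext a)).
    by apply: measurable_funB; [exact: measurable_snd|exact: measurable_fst].
  by apply: (measurableT_comp (measurable_gamma_kernel_ext b)); exact: measurable_fst.
transitivity (\int[mu]_s \int[mu]_w f (s, w))%E.
  apply: eq_integral => s _; rewrite /f/=.
  rewrite ge0_integralZr; last 4 first.
  - exact: measurableT.
  - apply: (measurableT_comp (measurable_gamma_kernel_ext a)).
    by apply: measurable_funB => //; exact: measurable_id.
  - by move=> w _; exact: gamma_kernel_ext_ge0.
  - exact: gamma_kernel_ext_ge0.
  congr (_ * _)%E; rewrite (EFin_Gamma_ext a0).
  rewrite (@ge0_integral_affine _ 1 (- s)); last 4 first.
  - exact: oner_neq0.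
  - exact: measurableT.
  - exact: measurable_gamma_kernel_ext.
  - by move=> w _; exact: gamma_kernel_ext_ge0.
  rewrite normr1 mul1e preimage_setT.
  by apply: eq_integral => w _; rewrite mul1r.
rewrite fubini_tonelli; last 2 first.
- exact: mf.
- by move=> z; rewrite /f mule_ge0// gamma_kernel_ext_ge0.
transitivity (\int[mu]_(w in `]0%R, +oo[) (beta_eintegral a b 1 * (gamma_kernel (a + b) w)%:E))%E.
  rewrite [RHS]integral_mkcond; apply: eq_integral => w _; rewrite /f/= patchE.
  case: ifPn => [|].
    rewrite inE/= in_itv/= andbT => w0.
    transitivity (\int[mu]_(s in `]0%R, w[)
       ((expR (- w))%:E * ((w - s) `^ (a - 1) * s `^ (b - 1))%:E))%E.
      rewrite [RHS]integral_mkcond; apply: eq_integral => s _.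
      rewrite !gamma_kernel_extE patchE mem_setE in_itv/= subr_gt0 andbC.
      case: ifPn => sw; last by rewrite mul0e.
      case: ifPn => s0; last by rewrite mule0.
      rewrite /= -!EFinM; congr (_%:E); rewrite /gamma_kernel mulrACA -expRD mulrC.
      by congr (expR _ * _); lra.
    rewrite ge0_integralZl_EFin; last 4 first.
    - exact: measurable_itv.
    - by move=> s _; rewrite lee_fin mulr_ge0 ?powR_ge0.
    - exact: measurable_EFin_beta_kernel.
    - exact: expR_ge0.
    rewrite -/(beta_eintegral a b w) (beta_eintegral_scale a b w0) muleA -EFinM muleC.
    by rewrite /gamma_kernel [expR _ * _]mulrC.
  rewrite notin_setE/= in_itv/= andbT => /negP; rewrite -leNgt => w0.
  rewrite integral0_eq// => s _; rewrite !gamma_kernel_extE subr_gt0.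
  case: ifPn => sw; last by rewrite mul0e.
  case: ifPn => s0; last by rewrite mule0.
  by have := lt_trans s0 sw; rewrite ltNge w0.
rewrite ge0_integralZl; last 4 first.
- exact: measurable_itv.
- exact: measurable_EFin_gamma_kernel.
- by move=> s _; rewrite lee_fin gamma_kernel_ge0.
- by apply: integral_ge0 => s _; rewrite lee_fin mulr_ge0 ?powR_ge0.
by rewrite EFin_Gamma// addr_gt0.
Qed.

Lemma Beta_integral (a b t : R) : 0 < a -> 0 < b -> 0 <= t ->
  L1 `]0, t[ (fun s => (t - s) `^ (a - 1) * s `^ (b - 1)) /\
  \int[mu]_(s in `]0, t[) ((t - s) `^ (a - 1) * s `^ (b - 1)) =
    if 0 < t then t `^ (a + b - 1) * (Gamma a * Gamma b / Gamma (a + b)) else 0.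
Proof.
move=> a0 b0; rewrite le_eqVlt => /predU1P[<-|t0].
  by rewrite set_itvoo0 Rintegral_set0 ltxx; split => //; exact: integrable_set0.
rewrite t0.
have G0 : 0 < Gamma (a + b) by rewrite Gamma_gt0// addr_gt0.
have B0 : (0 <= beta_eintegral a b 1)%E.
  by apply: integral_ge0 => s _; rewrite lee_fin mulr_ge0 ?powR_ge0.
have B1 : beta_eintegral a b 1 = (Gamma a * Gamma b / Gamma (a + b))%:E.
  have := Gamma_mulE a0 b0; move: B0; case: (beta_eintegral a b 1) => [r _|_|].
    by rewrite -EFinM => -[e]; rewrite e mulfK; [|rewrite gt_eqF].
    by rewrite gt0_mulye ?lte_fin.
  by [].
have BE : beta_eintegral a b t = (t `^ (a + b - 1) * (Gamma a * Gamma b / Gamma (a + b)))%:E.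
  by rewrite beta_eintegral_scale// B1 -EFinM.
split; last by rewrite /Rintegral -/(beta_eintegral a b t) BE.
apply/integrableP; split; first exact: measurable_EFin_beta_kernel.
under eq_integral do rewrite /= ger0_norm ?mulr_ge0 ?powR_ge0//.
by rewrite -/(beta_eintegral a b t) BE ltry.
Qed.

(** The Beta integral with first parameter [1] is a power integral. *)
Lemma GammaD1 (x : R) : 0 < x -> Gamma (x + 1) = x * Gamma x.
Proof.
move=> x0; have [_] := Beta_integral ltr01 x0 ler01.
rewrite ltr01 powR1 mul1r Gamma1 mul1r => E.
have [_] := Rintegral_nonneg_power x0 ler01; rewrite powR1 => E2.
have : x^-1 = Gamma x / Gamma (1 + x).
  rewrite -E -[LHS]mul1r -E2; apply: eq_Rintegral => s _.
  by rewrite subrr powRr0 mul1r.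
have G0 : Gamma (1 + x) != 0 by rewrite gt_eqF// Gamma_gt0// addr_gt0.
move=> /(congr1 (fun y => x * y * Gamma (1 + x))).
rewrite (divff (lt0r_neq0 x0)) mul1r => E3.
rewrite addrC E3 -mulrA; congr (_ * _); exact: divfK.
Qed.

End gamma_beta.

(** * Entire power series, rising binomial coefficients and double sums *)

Section entire_series.
Context {R : realType}.
Implicit Types (a : R^nat) (z : R).

(** The coefficient sequences of entire functions, in the form in which all
    estimates of power series below use them. *)
Definition superexponential_decay a := forall rho : R, 0 < rho ->
  exists2 C : R, 0 <= C & forall m, `|a m| <= C * rho ^+ m.

Lemma decay_half a (Z : R) : superexponential_decay a -> 0 <= Z ->
  exists2 C : R, 0 <= C & forall m z, `|z| <= Z -> `|a m * z ^+ m| <= C * 2^-1 ^+ m.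
Proof.
move=> da Z0; have Z1 : 0 < Z + 1 by lra.
have [|C C0 aC] := da (2^-1 / (Z + 1)); first by rewrite divr_gt0.
exists C => // m z zZ; rewrite normrM normrX.
apply: (@le_trans _ _ (C * (2^-1 / (Z + 1)) ^+ m * (Z + 1) ^+ m)).
  apply: ler_pM => //.
  by apply: lerXn2r; rewrite ?nnegrE//; lra.
by rewrite -mulrA -exprMn divfK// gt_eqF.
Qed.

Lemma cvg_series_half (C : R) : cvgn (series (fun m => C * 2^-1 ^+ m)).
Proof.
have := @is_cvg_geometric_series R C 2^-1; rewrite ger0_norm; last by rewrite invr_ge0.
by move=> /(_ _); apply; rewrite invf_lt1// ltr1n.
Qed.

Lemma le0_of_half_powers (x M : R) : (forall n, x <= M * 2^-1 ^+ n) -> x <= 0.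
Proof.
move=> xM; have cM : (fun n => M * 2^-1 ^+ n) @ \oo --> (0 : R).
  rewrite -(mulr0 M); apply: cvgM; first exact: cvg_cst.
  by apply: cvg_expr; rewrite ger0_norm ?invr_ge0// invf_lt1// ltr1n.
rewrite -(cvg_lim _ cM)//; apply: limr_ge; first by apply/cvg_ex; exists 0.
exact: nearW.
Qed.

Lemma decay_cvg a z : superexponential_decay a -> cvgn (pseries a z).
Proof.
move=> da; have [C C0 aC] := decay_half da (normr_ge0 z).
apply: normed_cvg; apply: (@series_le_cvg _ _ (fun m => C * 2^-1 ^+ m)) => //.
- by move=> m /=; exact: normr_ge0.
- by move=> m; rewrite mulr_ge0// exprn_ge0// invr_ge0.
- by move=> m; exact: aC.
- exact: cvg_series_half.
Qed.

(** The ratio [2^-1] is a uniform rate on every bounded set; partial sums thus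
    approximate two factors, and their product, at one common rate. *)
Lemma decay_tail a (Z : R) : superexponential_decay a -> 0 <= Z ->
  exists2 C : R, 0 <= C & forall n z, `|z| <= Z ->
    `|limn (pseries a z) - pseries a z n| <= C * 2^-1 ^+ n.
Proof.
move=> da Z0; have [C C0 aC] := decay_half da Z0.
exists (2 * C); first by rewrite mulr_ge0.
move=> n z zZ; have cz := @decay_cvg a z da.
have bnd k : `|pseries a z (n + k)%N - pseries a z n| <= 2 * C * 2^-1 ^+ n.
  rewrite /pseries /series/= (@big_cat_nat _ _ _ n 0 (n + k)) ?leq_addr//=.
  rewrite addrAC subrr add0r.
  have -> : 2 * C * 2^-1 ^+ n = 2 * C * (2^-1 ^+ n - 2^-1 ^+ (n + k)) + 2 * C * 2^-1 ^+ (n + k).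
    by ring.
  apply: (@le_trans _ _ (2 * C * (2^-1 ^+ n - 2^-1 ^+ (n + k)))); last first.
    by rewrite lerDl mulr_ge0 ?exprn_ge0 ?invr_ge0// mulr_ge0.
  elim: k => [|k ih]; first by rewrite addn0 big_geq// normr0 subrr mulr0.
  rewrite addnS big_nat_recr/= ?leq_addr//.
  apply: le_trans (ler_normD _ _) _.
  apply: le_trans (lerD ih (aC (n + k)%N z zZ)) _.
  by rewrite exprS; lra.
have shc : (fun k => pseries a z (n + k)%N) @ \oo --> limn (pseries a z).
  have -> : (fun k => pseries a z (n + k)%N) = (fun k => pseries a z (k + n)%N).
    by apply/funext => k; rewrite addnC.
  by rewrite (cvg_shiftn n (pseries a z)); exact: cz.
have : (fun k => `|pseries a z (n + k)%N - pseries a z n|) @ \oo -->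
    `|limn (pseries a z) - pseries a z n|.
  apply: cvg_norm; apply: cvgB; last exact: cvg_cst.
  exact: shc.
move/(cvg_lim _) => <-//; apply: limr_le.
  apply/cvg_ex; exists (`|limn (pseries a z) - pseries a z n|).
  apply: cvg_norm; apply: cvgB; last exact: cvg_cst.
  exact: shc.
by apply: nearW => k; exact: bnd.
Qed.

Lemma decay_bounded a (Z : R) : superexponential_decay a -> 0 <= Z ->
  exists2 C : R, 0 <= C & forall z, `|z| <= Z -> `|limn (pseries a z)| <= C.
Proof.
move=> da Z0; have [C C0 aC] := decay_tail da Z0; exists C => // z zZ.
by have := aC 0%N z zZ; rewrite /pseries /series/= big_geq// subr0 expr0 mulr1.
Qed.

Lemma decay_diffs a : superexponential_decay a ->
  superexponential_decay (pseries_diffs a).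
Proof.
move=> da rho rho0; have [|C C0 aC] := da (rho / 2); first by rewrite divr_gt0.
exists (C * rho); first by rewrite mulr_ge0// ltW.
move=> m; rewrite /pseries_diffs normrM ger0_norm//.
apply: (@le_trans _ _ (2 ^+ m.+1 * (C * (rho / 2) ^+ m.+1))).
  apply: ler_pM => //; rewrite -natrX ler_nat; exact/ltnW/ltn_expl.
by rewrite mulrCA -exprMn mulrC [2 * _]mulrC divfK// exprS; lra.
Qed.

Lemma decay_is_derive a z : superexponential_decay a ->
  is_derive z 1 (fun x => limn (pseries a x)) (limn (pseries (pseries_diffs a) z)).
Proof.
move=> da; apply: (@pseries_snd_diffs _ _ (`|z| + 1)).
- exact: decay_cvg.
- exact/decay_cvg/decay_diffs.
- exact/decay_cvg/decay_diffs/decay_diffs.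
- by rewrite [ltRHS]ger0_norm ?addr_ge0// ltrDl.
Qed.

Lemma decay_continuous a : superexponential_decay a ->
  continuous (fun x => limn (pseries a x)).
Proof.
move=> da z; apply: differentiable_continuous; apply/derivable1_diffP.
by have [] := decay_is_derive z da.
Qed.

End entire_series.

Section pochhammer.
Context {R : realType}.

(** The coefficients of [(1 - x) ^ (- c)], as [pochhammer] is the rising factorial. *)
Definition rising_binomial (c : R) (m : nat) : R := pochhammer c m / m`!%:R.

Lemma pochhammerS (c : R) m : pochhammer c m.+1 = pochhammer c m * (c + m%:R).
Proof. by rewrite /pochhammer big_ord_recr. Qed.

Lemma pochhammer0 (c : R) : pochhammer c 0 = 1.
Proof. by rewrite /pochhammer big_ord0. Qed.

Lemma rising_binomial0 (c : R) : rising_binomial c 0 = 1.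
Proof. by rewrite /rising_binomial pochhammer0 fact0 divr1. Qed.

Lemma rising_binomialS (c : R) m :
  m.+1%:R * rising_binomial c m.+1 = (c + m%:R) * rising_binomial c m.
Proof.
rewrite /rising_binomial pochhammerS factS natrM.
have m0 : (m.+1%:R : R) != 0 by rewrite pnatr_eq0.
have f0 : (m`!%:R : R) != 0 by rewrite pnatr_eq0 -lt0n fact_gt0.
by rewrite invfM mulrCA (mulVKf m0); ring.
Qed.

Lemma rising_binomial_zero m : rising_binomial 0 m.+1 = 0.
Proof.
elim: m => [|m ih]; rewrite /rising_binomial pochhammerS.
  by rewrite addr0 mulr0 mul0r.
have f0 : ((m.+1)`!%:R : R) != 0 by rewrite pnatr_eq0 -lt0n fact_gt0.
move: ih; rewrite /rising_binomial => /eqP.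
rewrite mulf_eq0 invr_eq0 (negbTE f0) orbF => /eqP ->.
by rewrite !mul0r.
Qed.

Lemma rising_binomial_le (c : R) m : `|rising_binomial c m| <= (1 + `|c|) ^+ m.
Proof.
elim: m => [|m ih]; first by rewrite rising_binomial0 expr0 normr1.
have m0 : 0 < (m.+1%:R : R) by rewrite ltr0n.
rewrite -(ler_pM2l m0) -[X in X * _](@ger0_norm _ m.+1%:R)// -normrM rising_binomialS normrM.
rewrite exprSr mulrCA mulrC; apply: ler_pM => //.
apply: le_trans (ler_normD _ _) _.
rewrite [`|m%:R|]ger0_norm// -natr1.
have := normr_ge0 c; have : 0 <= (m%:R : R) by []; nra.
Qed.

(** The Chu-Vandermonde identity, coefficientwise
    [(1 - x)^-c (1 - x)^-d = (1 - x)^-(c + d)]; by induction on [n] through the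
    recurrence [rising_binomialS]. *)
Lemma rising_binomialD (c d : R) n :
  \sum_(i < n.+1) rising_binomial c i * rising_binomial d (n - i) =
  rising_binomial (c + d) n.
Proof.
elim: n => [|n ih].
  by rewrite big_ord_recr big_ord0/= add0r !rising_binomial0 mulr1.
have n0 : (n.+1%:R : R) != 0 by rewrite pnatr_eq0.
apply: (mulfI n0); rewrite rising_binomialS -ih mulr_sumr.
transitivity (\sum_(i < n.+2) (i%:R * rising_binomial c i * rising_binomial d (n.+1 - i)
   + rising_binomial c i * ((n.+1 - i)%:R * rising_binomial d (n.+1 - i)))).
  apply: eq_bigr => i _; rewrite -{1}(subnK (_ : i <= n.+1)%N); last by rewrite -ltnS.
  by rewrite natrD; ring.
rewrite big_split/= big_ord_recl/= !mul0r add0r.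
rewrite [X in _ + X]big_ord_recr/= subnn mul0r mulr0 addr0 -big_split mulr_sumr/=.
apply: eq_bigr => i _; rewrite /bump/= add1n subSS rising_binomialS.
rewrite subSn ?rising_binomialS; last by rewrite -ltnS.
rewrite -[X in _ = (_ + X%:R) * _](subnKC (_ : i <= n)%N) ?natrD; last by rewrite -ltnS.
by ring.
Qed.

End pochhammer.

Section double_sums.
Context {R : realType}.

Lemma sum_triangle (F : nat -> nat -> R) n :
  \sum_(i < n) \sum_(j < n - i) F i j = \sum_(N < n) \sum_(i < N.+1) F i (N - i)%N.
Proof.
elim: n => [|n ih]; first by rewrite !big_ord0.
rewrite [RHS]big_ord_recr/= -ih.
transitivity (\sum_(i < n.+1) (\sum_(j < n - i) F i j + F i (n - i)%N)).
  apply: eq_bigr => i _; rewrite subSn; last by rewrite -ltnS.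
  by rewrite big_ord_recr.
by rewrite big_split/= big_ord_recr/= subnn big_ord0 addr0.
Qed.

(** The terms in the square but outside the triangle [i + j < n] have size at most
    [C * 8^-1 ^+ n], and there are at most [n ^ 2 <= 4 ^ n] of them. *)
Lemma sum_square_triangle (F : nat -> nat -> R) (C : R) n : 0 <= C ->
  (forall i j, `|F i j| <= C * 8^-1 ^+ (i + j)) ->
  `|\sum_(i < n) \sum_(j < n) F i j -
    \sum_(N < n) \sum_(i < N.+1) F i (N - i)%N| <= C * 2^-1 ^+ n.
Proof.
move=> C0 FC; rewrite -sum_triangle -sumrB.
have h8 : 0 <= (8^-1 : R) <= 1 by rewrite invr_ge0 ler0n invf_le1// ler1n.
have inner (i : 'I_n) : `|\sum_(j < n) F i j - \sum_(j < n - i) F i j| <= n%:R * (C * 8^-1 ^+ n).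
  rewrite -!(big_mkord xpredT (F i)) (@big_cat_nat _ _ _ (n - i)%N 0 n)/= ?leq_subr//.
  rewrite addrAC subrr add0r; apply: le_trans (ler_norm_sum _ _ _) _.
  apply: (@le_trans _ _ (\sum_(n - i <= j < n) (C * 8^-1 ^+ n))).
    rewrite big_nat_cond [leRHS]big_nat_cond; apply: ler_sum => j /andP[/andP[nij jn] _].
    apply: le_trans (FC _ _) _; rewrite ler_wpM2l//.
    apply: ler_wiXn2l; [by case/andP: h8|by case/andP: h8|].
    by rewrite -leq_subLR.
  rewrite sumr_const_nat -[leLHS]mulr_natl ler_wpM2r ?ler_nat ?leq_subr//.
  by rewrite mulr_ge0// exprn_ge0//; case/andP: h8.
apply: le_trans (ler_norm_sum _ _ _) _.
apply: (@le_trans _ _ (\sum_(i < n) (n%:R * (C * 8^-1 ^+ n)))); first exact: ler_sum.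
rewrite sumr_const card_ord -mulr_natl mulrA.
have -> : (8^-1 : R) = 2^-1 * (2^-1 * 2^-1) by lra.
rewrite !exprMn.
have hn : n%:R * 2^-1 ^+ n <= 1 :> R.
  rewrite exprVn ler_pdivrMr ?exprn_gt0// mul1r -natrX ler_nat.
  exact/ltnW/ltn_expl.
have hp : 0 <= (2^-1 : R) ^+ n by rewrite exprn_ge0// invr_ge0.
have hn0 : 0 <= n%:R * (2^-1 : R) ^+ n by rewrite mulr_ge0.
rewrite [leLHS](_ : _ = (n%:R * 2^-1 ^+ n) * (n%:R * 2^-1 ^+ n) * (C * 2^-1 ^+ n)); last by ring.
rewrite -[leRHS]mul1r ler_wpM2r ?mulr_ge0//.
by rewrite -[leRHS]mul1r ler_pM.
Qed.

End double_sums.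

(** * The Prabhakar function and its semigroup law *)

Section prabhakar_function.
Context {R : realType}.
Notation mu := (@lebesgue_measure R).
Implicit Types (al b c d z t : R).

Definition prabhakar_coef al b c (m : nat) : R :=
  rising_binomial c m / Gamma (al * m%:R + b).

Lemma prabhakarE_pseries al b c z :
  prabhakarE al b c z = limn (pseries (prabhakar_coef al b c) z).
Proof.
rewrite /prabhakarE /pseries; congr (limn (series _)); apply/funext => m.
by rewrite /= /prabhakar_coef /rising_binomial -!mulrA; congr (_ * _); rewrite mulrA mulrC.
Qed.

(** By [Gamma_lower], as [T] may be chosen so that [T `^ al] is any prescribed
    ratio. *)
Lemma inv_Gamma_decay al b : 0 < al -> 0 < b ->
  superexponential_decay (fun m => (Gamma (al * m%:R + b))^-1).
Proof.
move=> al0 b0 rho rho0.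
(* Then [T `^ (al * m)] is [rho ^- m]. *)
pose T := rho `^ (- al^-1); have T0 : 0 < T by rewrite powR_gt0.
pose e := expR (- (T + 1)) / (T + 1).
have e0 : 0 < e by rewrite divr_gt0 ?expR_gt0//; lra.
have Tb0 : 0 < T `^ b by rewrite powR_gt0.
exists (T `^ b * e)^-1; first by rewrite invr_ge0 mulr_ge0// ltW.
move=> m; have x0 : 0 < al * m%:R + b by rewrite ltr_wpDl// mulr_ge0// ltW.
rewrite ger0_norm; last by rewrite invr_ge0 ltW// Gamma_gt0.
have E : T `^ (al * m%:R) = rho ^- m.
  by rewrite /T -powRrM mulNr mulKf ?gt_eqF// powR_invn// ltW.
have := Gamma_lower x0 T0; rewrite powR_add//.
rewrite -/e E => h.
rewrite -[X in _ <= _ * X]invrK -invfM lef_pV2 ?posrE ?Gamma_gt0//.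
  by rewrite mulrC mulrA.
by apply: divr_gt0; [exact: mulr_gt0|exact: exprn_gt0].
Qed.

Lemma prabhakar_coef_decay al b c : 0 < al -> 0 < b ->
  superexponential_decay (prabhakar_coef al b c).
Proof.
move=> al0 b0 rho rho0; have c1 : 0 < 1 + `|c| by rewrite ltr_wpDr.
have [|C C0 GC] := inv_Gamma_decay al0 b0 (rho := rho / (1 + `|c|)).
  by rewrite divr_gt0.
exists C => // m; rewrite /prabhakar_coef normrM.
apply: le_trans (ler_pM _ _ (rising_binomial_le c m) (GC m)) _ => //.
by rewrite mulrCA -exprMn [(1 + _) * _]mulrC (divfK (lt0r_neq0 c1)).
Qed.

Lemma continuous_prabhakarE al b c : 0 < al -> 0 < b ->
  continuous (prabhakarE al b c).
Proof.
move=> al0 b0; rewrite (_ : prabhakarE al b c = fun z => limn (pseries (prabhakar_coef al b c) z)).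
  exact: decay_continuous (prabhakar_coef_decay c al0 b0).
by apply/funext => z; rewrite prabhakarE_pseries.
Qed.

(** Since [rising_binomial 0] vanishes from index [1] on, only the constant term
    remains. *)
Lemma prabhakarE_zero al z : prabhakarE al 1 0 z = 1.
Proof.
rewrite prabhakarE_pseries; apply/cvg_lim => //.
rewrite -(cvg_shiftn 1%N) /=.
rewrite (_ : (fun _ => _) = cst 1); first exact: cvg_cst.
apply/funext => n; rewrite addn1 /pseries /series/= big_nat_recl//= big1 ?addr0.
  by rewrite /prabhakar_coef rising_binomial0 mulr0 add0r Gamma1 invr1 expr0 !mulr1.
by move=> i _; rewrite /prabhakar_coef rising_binomial_zero !mul0r.
Qed.

Definition prabhakar_kernel al b c d (s : R) : R :=
  s `^ (b - 1) * prabhakarE al b c (d * s `^ al).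

Lemma measurable_prabhakarE_powR al b c d : 0 < al -> 0 < b ->
  measurable_fun setT (fun s => prabhakarE al b c (d * s `^ al)).
Proof.
move=> al0 b0; apply: (measurableT_comp (f := prabhakarE al b c)).
  by apply: continuous_measurable_fun; exact: continuous_prabhakarE.
by apply: measurable_funM => //; exact: measurable_powR.
Qed.

Lemma measurable_prabhakar_kernel al b c d : 0 < al -> 0 < b ->
  measurable_fun setT (prabhakar_kernel al b c d).
Proof.
move=> al0 b0; apply: measurable_funM; first exact: measurable_powR.
exact: measurable_prabhakarE_powR.
Qed.

Lemma powR_argument_le al d s t : 0 < al -> 0 <= s <= t ->
  `|d * s `^ al| <= `|d| * t `^ al.
Proof.
move=> al0 /andP[s0 st]; rewrite normrM ler_wpM2l// ger0_norm ?powR_ge0//.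
by apply: ge0_ler_powR; rewrite ?nnegrE// ?(ltW al0)// (le_trans s0).
Qed.

Lemma prabhakar_kernel_le al b c d t : 0 < al -> 0 < b ->
  exists2 C : R, 0 <= C & forall s, 0 <= s <= t ->
    `|prabhakar_kernel al b c d s| <= C * s `^ (b - 1).
Proof.
move=> al0 b0.
have [|C C0 PC] := @decay_bounded _ _ (`|d| * t `^ al) (prabhakar_coef_decay c al0 b0).
  by rewrite mulr_ge0 ?powR_ge0.
exists C => // s st; rewrite normrM mulrC [`|s `^ _|]ger0_norm ?powR_ge0//.
rewrite ler_wpM2r ?powR_ge0// prabhakarE_pseries; apply: PC.
exact: powR_argument_le.
Qed.

Lemma L1_prabhakar_kernel al b c d t : 0 < al -> 0 < b -> 0 <= t ->
  L1 `]0, t[ (prabhakar_kernel al b c d).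
Proof.
move=> al0 b0 t0; have [C C0 kC] := prabhakar_kernel_le c d t al0 b0.
apply: (@le_L1 _ _ _ (fun s => C * s `^ (b - 1))) => //.
- by apply: measurable_funTS; exact: measurable_prabhakar_kernel.
- by apply: L1Zl => //; have [] := Rintegral_nonneg_power b0 t0.
- by move=> s /=; rewrite in_itv/= => /andP[/ltW s0 /ltW st]; apply: kC; rewrite s0.
Qed.

Definition convolution (k g : R -> R) t : R :=
  \int[mu]_(s in `]0, t[) (k (t - s) * g s).

Lemma beta_coefficient_algebra (x y z p p' D T1 T2 : R) :
  x != 0 -> y != 0 -> z != 0 ->
  p / x * (p' / y) * D * (T1 * T2 * (x * y / z)) = T2 * (p * p' * (D * T1 / z)).
Proof. by move=> x0 y0 z0; field; rewrite x0 y0 z0. Qed.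

Lemma product_diff_le (x1 x2 y1 y2 h C1 C2 C3 C4 : R) : 0 <= h <= 1 -> 0 <= C4 ->
  `|x1| <= C1 -> `|x2| <= C2 -> `|x1 - y1| <= C3 * h -> `|x2 - y2| <= C4 * h ->
  `|x1 * x2 - y1 * y2| <= (C1 * C4 + C3 * (C2 + C4)) * h.
Proof.
move=> /andP[h0 h1] C40 b1 b2 b3 b4.
have C30h : 0 <= C3 * h by exact: le_trans b3.
have C40h : 0 <= C4 * h by exact: le_trans b4.
have -> : x1 * x2 - y1 * y2 = x1 * (x2 - y2) + (x1 - y1) * y2 by ring.
have b5 : `|y2| <= C2 + C4 * h.
  have -> : y2 = x2 - (x2 - y2) by ring.
  by apply: le_trans (ler_normB _ _) _; apply: lerD.
apply: le_trans (ler_normD _ _) _; rewrite !normrM.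
apply: (@le_trans _ _ (C1 * (C4 * h) + C3 * h * (C2 + C4 * h))).
  by apply: lerD; rewrite ler_pM.
have : C3 * h * (C4 * h) <= C3 * h * C4.
  by apply: ler_wpM2l => //; rewrite ler_piMr.
by lra.
Qed.

Lemma partial_convolution_estimate (If L Pn Sq W h T K CG C5 : R) : 0 <= T ->
  `|If - T * Sq| <= K * h * W -> `|Sq - Pn| <= CG * h -> `|L - Pn| <= C5 * h ->
  `|If - T * L| <= (K * W + T * (CG + C5)) * h.
Proof.
move=> T0 h1 h2 h3.
have -> : If - T * L = (If - T * Sq) + T * ((Sq - Pn) - (L - Pn)) by ring.
apply: le_trans (ler_normD _ _) _; rewrite mulrDl; apply: lerD.
  by apply: le_trans h1 _; rewrite mulrAC.
rewrite normrM (ger0_norm T0) -mulrA ler_wpM2l// mulrDl.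
by apply: le_trans (ler_normB _ _) _; exact: lerD.
Qed.

(** Truncated series: the product is a finite sum of Beta integrals. *)
Lemma prabhakar_partial_convolution al b c d b' c' t n :
  0 < al -> 0 < b -> 0 < b' -> 0 < t ->
  let w s := (t - s) `^ (b - 1) * s `^ (b' - 1) in
  let f s := w s *
    (pseries (prabhakar_coef al b c) (d * (t - s) `^ al) n *
     pseries (prabhakar_coef al b' c') (d * s `^ al) n) in
  L1 `]0, t[ f /\
  \int[mu]_(s in `]0, t[) f s = t `^ (b + b' - 1) *
    \sum_(i < n) \sum_(j < n) (rising_binomial c i * rising_binomial c' j *
      ((d * t `^ al) ^+ (i + j) / Gamma (al * (i + j)%:R + (b + b')))).
Proof.
move=> al0 b0 b'0 t0 w f.
pose g (i j : nat) s := prabhakar_coef al b c i * prabhakar_coef al b' c' j * d ^+ (i + j) *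
  ((t - s) `^ (al * i%:R + b - 1) * s `^ (al * j%:R + b' - 1)).
have bi0 (e : R) (i : nat) : 0 < e -> 0 < al * i%:R + e.
  by move=> e0; rewrite ltr_wpDl// mulr_ge0// ltW.
have fE s : 0 < s < t -> f s = \sum_(i < n) \sum_(j < n) g i j s.
  move=> /andP[s0 st]; have ts0 : 0 < t - s by rewrite subr_gt0.
  rewrite /f /pseries /series/= !big_mkord mulr_suml mulr_sumr; apply: eq_bigr => i _.
  rewrite mulr_sumr mulr_sumr; apply: eq_bigr => j _.
  rewrite /g /w !exprMn exprD -!(powR_mulrn _ (powR_ge0 _ _)) -!powRrM.
  rewrite -[al * i%:R + b - 1]addrA -[al * j%:R + b' - 1]addrA.
  have -> : (t - s) `^ (al * i%:R + (b - 1)) = (t - s) `^ (al * i%:R) * (t - s) `^ (b - 1).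
    exact: powR_add.
  have -> : s `^ (al * j%:R + (b' - 1)) = s `^ (al * j%:R) * s `^ (b' - 1).
    exact: powR_add.
  move: (_ `^ _) (_ `^ _) (_ `^ _) (_ `^ _) (prabhakar_coef _ _ _ _) (prabhakar_coef _ _ _ _) => A1 A2 A3 A4 A5 A6.
  by ring.
have gint i j : L1 `]0, t[ (g i j) /\ \int[mu]_(s in `]0, t[) g i j s =
   t `^ (b + b' - 1) * (rising_binomial c i * rising_binomial c' j *
      ((d * t `^ al) ^+ (i + j) / Gamma (al * (i + j)%:R + (b + b')))).
  have [I1 I2] := Beta_integral (bi0 _ i b0) (bi0 _ j b'0) (ltW t0).
  split; first exact: L1Zl.
  rewrite RintegralZl// I2 t0.
  have -> : al * i%:R + b + (al * j%:R + b') = al * (i + j)%:R + (b + b').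
    by rewrite natrD; ring.
  have -> : al * (i + j)%:R + (b + b') - 1 = al * (i + j)%:R + (b + b' - 1) by ring.
  rewrite (powR_add (al * (i + j)%:R) (b + b' - 1) t0).
  rewrite exprMn -(powR_mulrn _ (powR_ge0 _ _)) -powRrM /prabhakar_coef.
  have G1 := lt0r_neq0 (Gamma_gt0 (bi0 _ i b0)).
  have G2 := lt0r_neq0 (Gamma_gt0 (bi0 _ j b'0)).
  have G3 := lt0r_neq0 (Gamma_gt0 (bi0 _ (i + j)%N (addr_gt0 b0 b'0))).
  by rewrite (beta_coefficient_algebra _ _ _ _ _ G1 G2 G3).
have inner i := Rintegral_sum_ord n (measurable_itv `]0, t[) (fun j => (gint i j).1).
have outer := Rintegral_sum_ord n (measurable_itv `]0, t[) (fun i => (inner i).1).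
have [oL oI] := outer; split.
  apply: eq_integrable oL => //; move=> s; rewrite inE/= in_itv/= => st.
  by rewrite -fE.
transitivity (\int[mu]_(s in `]0, t[) (\sum_(i < n) \sum_(j < n) g i j s)).
  by apply: eq_Rintegral => s; rewrite inE/= in_itv/= => st; rewrite fE.
rewrite oI mulr_sumr; apply: eq_bigr => i _.
have [_ ->] := inner i; rewrite mulr_sumr; apply: eq_bigr => j _.
by have [_ ->] := gint i j.
Qed.

(** On generating functions this is [(1 - x)^-c (1 - x)^-c' = (1 - x)^-(c + c')].
    The partial sums of the two sides range over a square and a triangle of index
    pairs, and [sum_square_triangle] bounds the difference. *)
Lemma prabhakar_convolution al b c d b' c' t :
  0 < al -> 0 < b -> 0 < b' -> 0 < t ->
  L1 `]0, t[ (fun s => prabhakar_kernel al b c d (t - s) * prabhakar_kernel al b' c' d s) /\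
  convolution (prabhakar_kernel al b c d) (prabhakar_kernel al b' c' d) t =
    prabhakar_kernel al (b + b') (c + c') d t.
Proof.
move=> al0 b0 b'0 t0.
pose P := prabhakar_coef al b c; pose P' := prabhakar_coef al b' c'.
have dP : superexponential_decay P by exact: prabhakar_coef_decay.
have dP' : superexponential_decay P' by exact: prabhakar_coef_decay.
pose Z := `|d| * t `^ al; have Z0 : 0 <= Z by rewrite mulr_ge0 ?powR_ge0.
pose w s := (t - s) `^ (b - 1) * s `^ (b' - 1).
have w0 s : 0 <= w s by rewrite mulr_ge0 ?powR_ge0.
have [wL wI] := Beta_integral b0 b'0 (ltW t0).
pose fn n s := w s * (pseries P (d * (t - s) `^ al) n * pseries P' (d * s `^ al) n).
pose f s := w s * (prabhakarE al b c (d * (t - s) `^ al) * prabhakarE al b' c' (d * s `^ al)).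
have mw : measurable_fun setT w.
  exact: measurable_beta_kernel.
have mf : measurable_fun setT f.
  apply: measurable_funM => //; apply: measurable_funM; last exact: measurable_prabhakarE_powR.
  apply: (measurableT_comp (f := fun s => prabhakarE al b c (d * s `^ al))).
    exact: measurable_prabhakarE_powR.
  by apply: measurable_funB => //; exact: measurable_id.
have [C1 C10 B1] := decay_bounded dP Z0.
have [C2 C20 B2] := decay_bounded dP' Z0.
have [C3 C30 B3] := decay_tail dP Z0.
have [C4 C40 B4] := decay_tail dP' Z0.
have zs s : 0 < s < t -> `|d * s `^ al| <= Z.
  by move=> /andP[s0 st]; apply: powR_argument_le => //; rewrite (ltW s0) ltW.
have zts s : 0 < s < t -> `|d * (t - s) `^ al| <= Z.
  by move=> /andP[s0 st]; apply: powR_argument_le => //; apply/andP; split; lra.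
have fL : L1 `]0, t[ f.
  apply: (@L1_mulr_bounded _ _ w _ (C1 * C2)) => //.
    apply: measurable_funTS; apply: measurable_funM; last exact: measurable_prabhakarE_powR.
    apply: (measurableT_comp (f := fun s => prabhakarE al b c (d * s `^ al))).
      exact: measurable_prabhakarE_powR.
    by apply: measurable_funB => //; exact: measurable_id.
  move=> s /=; rewrite in_itv/= => st; rewrite normrM !prabhakarE_pseries.
  by apply: ler_pM => //; [apply: B1; exact: zts|apply: B2; exact: zs].
have fnL n : L1 `]0, t[ (fn n) by have [] := prabhakar_partial_convolution c d c' n al0 b0 b'0 t0.
pose K := C1 * C4 + C3 * (C2 + C4).
have half1 n : (2^-1 : R) ^+ n <= 1 by apply: exprn_ile1; [rewrite invr_ge0|rewrite invf_le1// ler1n].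
have half0 n : 0 <= (2^-1 : R) ^+ n by rewrite exprn_ge0// invr_ge0.
have fnf n : `|\int[mu]_(s in `]0, t[) f s - \int[mu]_(s in `]0, t[) fn n s| <=
    K * 2^-1 ^+ n * \int[mu]_(s in `]0, t[) w s.
  rewrite -RintegralB// -RintegralZl//; apply: normr_Rintegral_le => //.
  - have := L1B (measurable_itv _) fL (fnL n).
    by move/(measurable_int mu)/measurable_EFinP.
  - exact: L1Zl.
  - move=> s /=; rewrite in_itv/= => st; rewrite /f /fn -mulrBr normrM (ger0_norm (w0 s)).
    rewrite mulrC ler_wpM2r// !prabhakarE_pseries.
    apply: product_diff_le => //; first by rewrite half0 half1.
    + exact: B1 (zts _ st).
    + exact: B2 (zs _ st).
    + exact: B3 (zts _ st).
    + exact: B4 (zs _ st).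
split.
  apply: eq_integrable fL => // s; rewrite inE/= in_itv/= => st.
  by rewrite /= /f /w /prabhakar_kernel; congr (_%:E); rewrite mulrACA.
have convf : convolution (prabhakar_kernel al b c d) (prabhakar_kernel al b' c' d) t =
    \int[mu]_(s in `]0, t[) f s.
  by apply: eq_Rintegral => s _; rewrite /f /w /prabhakar_kernel mulrACA.
rewrite convf.
pose z := d * t `^ al; have zZ : `|z| <= Z by rewrite /z /Z normrM (ger0_norm (powR_ge0 _ _)).
pose q := rising_binomial c; pose q' := rising_binomial c'.
pose G N := (Gamma (al * N%:R + (b + b')))^-1.
have dG : superexponential_decay G by apply: inv_Gamma_decay => //; rewrite addr_gt0.
pose F i j := q i * q' j * (z ^+ (i + j) * G (i + j)%N).
(* All geometric factors of the double-sum terms are collected in [D]; [8^-1] is the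
   ratio required by [sum_square_triangle]. *)
pose D := (1 + `|c|) * (1 + `|c'|) * (Z + 1).
have c1 : 1 <= 1 + `|c| by rewrite lerDl.
have c'1 : 1 <= 1 + `|c'| by rewrite lerDl.
have D0 : 0 < D.
  apply: mulr_gt0; last exact: ltr_wpDl Z0 ltr01.
  by apply: mulr_gt0; [exact: lt_le_trans ltr01 c1|exact: lt_le_trans ltr01 c'1].
have [|CG CG0 BG] := dG (8^-1 / D); first by rewrite divr_gt0.
have FC i j : `|F i j| <= CG * 8^-1 ^+ (i + j).
  rewrite /F (normrM (q i * q' j)) (normrM (q i)) (normrM (z ^+ _)).
  have a1 : `|q i| <= (1 + `|c|) ^+ (i + j).
    by apply: le_trans (rising_binomial_le c i) _; rewrite ler_weXn2l// leq_addr.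
  have a2 : `|q' j| <= (1 + `|c'|) ^+ (i + j).
    by apply: le_trans (rising_binomial_le c' j) _; rewrite ler_weXn2l// leq_addl.
  have a3 : `|z ^+ (i + j)| <= (Z + 1) ^+ (i + j).
    rewrite normrX; apply: lerXn2r; rewrite ?nnegrE ?addr_ge0//.
    by rewrite (le_trans zZ)// lerDl.
  apply: (@le_trans _ _ ((1 + `|c|) ^+ (i + j) * (1 + `|c'|) ^+ (i + j) *
    ((Z + 1) ^+ (i + j) * (CG * (8^-1 / D) ^+ (i + j))))).
    by apply: ler_pM; rewrite ?mulr_ge0//; apply: ler_pM.
  rewrite mulrA -!exprMn mulrCA -exprMn -/D [D * _]mulrC divfK//.
  exact: lt0r_neq0.
have sq n : \int[mu]_(s in `]0, t[) fn n s =
    t `^ (b + b' - 1) * \sum_(i < n) \sum_(j < n) F i j.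
  by have [_ ->] := prabhakar_partial_convolution c d c' n al0 b0 b'0 t0.
have tri n : \sum_(N < n) \sum_(i < N.+1) F i (N - i)%N =
    pseries (prabhakar_coef al (b + b') (c + c')) z n.
  rewrite /pseries /series/= big_mkord; apply: eq_bigr => N _.
  rewrite /prabhakar_coef -rising_binomialD !mulr_suml; apply: eq_bigr => i _.
  have iN : (i <= N)%N by rewrite -ltnS.
  by rewrite /F (subnKC iN) [z ^+ N * _]mulrC mulrA.
have dPP : superexponential_decay (prabhakar_coef al (b + b') (c + c')).
  by apply: prabhakar_coef_decay => //; rewrite addr_gt0.
have [C5 C50 B5] := decay_tail dPP Z0.
have W0 : 0 <= \int[mu]_(s in `]0, t[) w s by exact: Rintegral_ge0.
pose M := K * \int[mu]_(s in `]0, t[) w s + t `^ (b + b' - 1) * (CG + C5).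
have K0 : 0 <= K by rewrite addr_ge0 ?mulr_ge0// addr_ge0.
have M0 : 0 <= M.
  by rewrite /M addr_ge0 ?mulr_ge0 ?powR_ge0// addr_ge0.
have main n : `|\int[mu]_(s in `]0, t[) f s - prabhakar_kernel al (b + b') (c + c') d t|
    <= M * 2^-1 ^+ n.
  rewrite /prabhakar_kernel prabhakarE_pseries -/z.
  have h1 := fnf n; rewrite sq in h1.
  have h2 := sum_square_triangle n CG0 FC; rewrite tri in h2.
  have h3 := B5 n z zZ.
  exact: (partial_convolution_estimate (powR_ge0 _ _) h1 h2 h3).
apply/eqP; rewrite -subr_eq0 -normr_le0.
exact: le0_of_half_powers main.
Qed.

End prabhakar_function.

(** * Associativity of convolution *)

Section fubini_reals.
Context {R : realType}.
Notation mu := (@lebesgue_measure R).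
Notation RR := (measurableTypeR R * measurableTypeR R)%type.

Lemma measurable_Rintegral_param (Phi : RR -> R) : measurable_fun setT Phi ->
  measurable_fun setT (fun x : measurableTypeR R => \int[mu]_y Phi (x, y)).
Proof.
move=> mPhi; have mE : measurable_fun setT (EFin \o Phi) by exact/measurable_EFinP.
apply: (measurableT_comp (f := fine)) => //.
rewrite (_ : (fun x => _) = (fun x => \int[mu]_y ((EFin \o Phi)^\+ (x, y)) -
   \int[mu]_y ((EFin \o Phi)^\- (x, y)))%E); last first.
  apply/funext => x; rewrite integralE; congr (_ - _)%E; apply: eq_integral => y _.
    by rewrite funeposE [in RHS]funeposE.
  by rewrite funenegE [in RHS]funenegE.
apply: emeasurable_funB.
  apply: (@measurable_fun_fubini_tonelli_F _ _ _ _ R mu (EFin \o Phi)^\+%E).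
    exact: measurable_funepos.
  by move=> z; exact: funepos_ge0.
apply: (@measurable_fun_fubini_tonelli_F _ _ _ _ R mu (EFin \o Phi)^\-%E).
  exact: measurable_funeneg.
by move=> z; exact: funeneg_ge0.
Qed.

Lemma ae_integrable_eq (f g : measurableTypeR R -> \bar R) : ae_eq mu setT f g ->
  measurable_fun setT g -> mu.-integrable setT f -> mu.-integrable setT g.
Proof.
move=> fg mg intf; have mf := measurable_int mu intf.
apply/integrableP; split => //; case/integrableP: intf => _.
rewrite (@ge0_ae_eq_integral _ _ _ mu setT (fun x => `|f x|)%E (fun x => `|g x|)%E)//.
- exact: measurableT_comp.
- exact: measurableT_comp.
- by move: fg; apply: filterS => x /= h _; rewrite h.
Qed.

Lemma measurable_swap_pair (Phi : RR -> R) : measurable_fun setT Phi ->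
  measurable_fun setT (fun z : RR => Phi (z.2, z.1)).
Proof. by move=> mPhi; apply: (measurableT_comp mPhi); exact: measurable_swap. Qed.

(** Iterated real-valued integrals are built from [fine], which agrees with the
    extended-real integral on almost every section; that is all that the outer
    integrals see. *)
Lemma Rintegral_Fubini (Phi : RR -> R) : measurable_fun setT Phi ->
  (\int[mu]_y \int[mu]_x `|Phi (x, y)|%:E < +oo)%E ->
  [/\ {ae mu, forall x, mu.-integrable setT (EFin \o (fun y => Phi (x, y)))},
      mu.-integrable setT (EFin \o (fun x => \int[mu]_y Phi (x, y))),
      mu.-integrable setT (EFin \o (fun y => \int[mu]_x Phi (x, y))) &
      \int[mu]_x (\int[mu]_y Phi (x, y)) = \int[mu]_y (\int[mu]_x Phi (x, y))].
Proof.
move=> mPhi fin; have mE : measurable_fun setT (EFin \o Phi) by exact/measurable_EFinP.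
have imf : (mu \x mu)%E.-integrable setT (EFin \o Phi) by apply/integrable21ltyP.
have m1 : measurable_fun setT (EFin \o (fun x => \int[mu]_y Phi (x, y))).
  by apply/measurable_EFinP; exact: measurable_Rintegral_param.
have m2 : measurable_fun setT (EFin \o (fun y => \int[mu]_x Phi (x, y))).
  apply/measurable_EFinP.
  exact: (measurable_Rintegral_param (measurable_swap_pair mPhi)).
have e1 : ae_eq mu setT (fun x => \int[mu]_y (EFin \o Phi) (x, y))%E
    (EFin \o (fun x => \int[mu]_y Phi (x, y))).
  move: (ae_integrable1 imf); apply: filterS => x ix _.
  by rewrite /= /Rintegral fineK//; exact: integrable_fin_num.
have e2 : ae_eq mu setT (fun y => \int[mu]_x (EFin \o Phi) (x, y))%E
    (EFin \o (fun y => \int[mu]_x Phi (x, y))).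
  move: (ae_integrable2 imf); apply: filterS => y iy _.
  by rewrite /= /Rintegral fineK//; exact: integrable_fin_num.
have i1 := integrable_fubini_F imf.
have imf' : (mu \x mu)%E.-integrable setT (EFin \o (fun z : RR => Phi (z.2, z.1))).
  apply/integrable12ltyP => //.
  by apply/measurable_EFinP; exact: measurable_swap_pair.
have i2 := integrable_fubini_F imf'.
have L1x : mu.-integrable setT (EFin \o (fun x => \int[mu]_y Phi (x, y))).
  exact: ae_integrable_eq e1 m1 i1.
have L1y : mu.-integrable setT (EFin \o (fun y => \int[mu]_x Phi (x, y))).
  exact: ae_integrable_eq e2 m2 i2.
split; [exact: ae_integrable1 imf|exact: L1x|exact: L1y|].
rewrite /Rintegral; congr fine.
transitivity (\int[mu]_x \int[mu]_y (EFin \o Phi) (x, y))%E.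
  by apply/esym/ae_eq_integral => //; exact: measurable_int i1.
rewrite (Fubini imf).
by apply/ae_eq_integral => //; exact: measurable_int i2.
Qed.

End fubini_reals.

Section convolution_algebra.
Context {R : realType}.
Notation mu := (@lebesgue_measure R).
Notation RR := (measurableTypeR R * measurableTypeR R)%type.
Implicit Types (k l g h : R -> R) (t : R).

Lemma convolution_comm k g t : L1 `]0, t[ (fun s => k (t - s) * g s) ->
  convolution k g t = convolution g k t.
Proof.
move=> kgL; rewrite /convolution (Rintegral_reflect kgL); apply: eq_Rintegral => s _.
by rewrite subKr mulrC.
Qed.

Lemma convolution_le0 k g t : t <= 0 -> convolution k g t = 0.
Proof. by move=> t0; rewrite /convolution set_itv_ge ?Rintegral_set0// bnd_simp -leNgt. Qed.

Lemma restrict_posE (f : R -> R) (s : R) : (f \_ (`]0, +oo[%classic)) s = if 0 < s then f s else 0.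
Proof. by rewrite patchE mem_setE in_itv/= andbT. Qed.

(** Restricting both factors to positive arguments makes the moving interval [`]0,
    t[] part of the integrand. *)
Lemma measurable_convolution l g : measurable_fun setT l -> measurable_fun setT g ->
  measurable_fun setT (convolution l g).
Proof.
move=> ml mg; pose P (f : R -> R) := f \_ (`]0, +oo[%classic).
have mP f : measurable_fun setT f -> measurable_fun setT (P f).
  by move=> mf; apply/measurable_restrict => //; exact: measurable_funTS.
pose Psi (z : RR) : R := P l (z.1 - z.2) * P g z.2.
have mPsi : measurable_fun setT Psi.
  apply: measurable_funM.
    apply: (measurableT_comp (mP _ ml)).
    by apply: measurable_funB; [exact: measurable_fst|exact: measurable_snd].
  by apply: (measurableT_comp (mP _ mg)); exact: measurable_snd.
rewrite (_ : convolution l g = fun s => \int[mu]_r Psi (s, r)).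
  exact: measurable_Rintegral_param.
apply/funext => s; rewrite /convolution [LHS]Rintegral_mkcond; apply: eq_Rintegral => r _.
rewrite patchE mem_setE in_itv/= /Psi /P !restrict_posE subr_gt0.
by case: (0 < r); case: (r < s); rewrite ?(mulr0, mul0r).
Qed.

(** Fubini on the triangle [0 < r < s < t]. The bound on [|k| * |l|] together with
    the integrability of [g] gives absolute convergence. *)
Lemma convolution_assoc k l g t (C : R) : 0 < t ->
  measurable_fun setT k -> measurable_fun setT l -> measurable_fun setT g ->
  L1 `]0, t[ g ->
  (forall tau, 0 < tau <= t ->
    (\int[mu]_(s in `]0%R, tau[) `|k (tau - s) * l s|%:E <= C%:E)%E) ->
  [/\ L1 `]0, t[ (fun s => k (t - s) * convolution l g s),
      L1 `]0, t[ (fun r => convolution k l (t - r) * g r) &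
      convolution k (convolution l g) t = convolution (convolution k l) g t].
Proof.
move=> t0 mk ml mg gL klC.
pose P (f : R -> R) := f \_ (`]0, +oo[%classic).
have PE f s : P f s = if 0 < s then f s else 0 by exact: restrict_posE.
have mP f : measurable_fun setT f -> measurable_fun setT (P f).
  by move=> mf; apply/measurable_restrict => //; exact: measurable_funTS.
pose Phi (z : RR) : R := P k (t - z.1) * P l (z.1 - z.2) * P g z.2.
have mPhi : measurable_fun setT Phi.
  apply: measurable_funM; last first.
    by apply: (measurableT_comp (mP _ mg)); exact: measurable_snd.
  apply: measurable_funM.
    apply: (measurableT_comp (mP _ mk)); apply: measurable_funB; first exact: measurable_cst.
    exact: measurable_fst.
  apply: (measurableT_comp (mP _ ml)); apply: measurable_funB; [exact: measurable_fst|exact: measurable_snd].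
have PhiE s r : Phi (s, r) = if (0 < r) && (r < s) && (s < t) then k (t - s) * l (s - r) * g r else 0.
  rewrite /Phi/= !PE !subr_gt0.
  case: (0 < r); case: (r < s); case: (s < t); rewrite ?(mulr0, mul0r)//.
have mkl (r : R) : measurable_fun setT (fun s : R => k (t - s) * l (s - r)).
  apply: measurable_funM.
    by apply: (measurableT_comp mk); apply: measurable_funB => //; exact: measurable_id.
  by apply: (measurableT_comp ml); apply: measurable_funB => //; exact: measurable_id.
have sec (r : R) : 0 < r < t -> (\int[mu]_(s in `]r, t[) `|k (t - s) * l (s - r)|%:E <= C%:E)%E.
  move=> /andP[r0 rt].
  have -> : (\int[mu]_(s in `]r, t[) `|k (t - s) * l (s - r)|%:E)%E =
      (\int[mu]_(s in `]0%R, (t - r)%R[) `|k (t - r - s) * l s|%:E)%E.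
    rewrite (@ge0_integral_affine _ 1 r); last 4 first.
    - exact: oner_neq0.
    - exact: measurable_itv.
    - apply/measurable_EFinP; apply: measurableT_comp => //.
      by apply: measurable_funTS; exact: mkl.
    - by move=> s _; rewrite lee_fin.
    rewrite normr1 mul1e (_ : _ @^-1` _ = `]0, (t - r)%R[%classic); last first.
      by apply/seteqP; split => s /=; rewrite !in_itv/= mul1r => /andP[? ?]; apply/andP; split; lra.
    apply: eq_integral => s _; rewrite mul1r addrK; congr (`|k _ * _|%:E); ring.
  by apply: klC; apply/andP; split; lra.
have absPhi (r : R) : (\int[mu]_s `|Phi (s, r)|%:E =
    if (0 < r < t)%R then `|g r|%:E * \int[mu]_(s in `]r, t[) `|k (t - s) * l (s - r)|%:E else 0)%E.
  case: ifPn => rt.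
    rewrite -ge0_integralZl; last 4 first.
    - exact: measurable_itv.
    - apply/measurable_EFinP; apply: measurableT_comp => //.
      by apply: measurable_funTS; exact: mkl.
    - by move=> s _; rewrite lee_fin.
    - by rewrite lee_fin.
    rewrite [RHS]integral_mkcond; apply: eq_integral => s _.
    rewrite PhiE patchE mem_setE in_itv/=; case/andP: rt => -> _ /=.
    by case: ifPn => // _; rewrite ?normr0// -EFinM normrM mulrC.
  rewrite integral0_eq// => s _; rewrite PhiE ifF ?normr0//.
  apply/negP => /andP[/andP[r0 rs] st]; move/negP: rt; apply.
  by rewrite r0 (lt_trans rs).
have fin : (\int[mu]_r \int[mu]_s `|Phi (s, r)|%:E < +oo)%E.
  apply: (@le_lt_trans _ _ (\int[mu]_(r in `]0%R, t[) (C%:E * `|g r|%:E))%E).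
    rewrite [leRHS]integral_mkcond; apply: ge0_le_integral => //.
    - by move=> r _; apply: integral_ge0 => s _; rewrite lee_fin.
    - apply: (@measurable_fun_fubini_tonelli_G _ _ _ _ R mu (fun z : RR => `|Phi z|%:E)) => //.
        by apply/measurable_EFinP; exact: measurableT_comp.
    - apply/(measurable_restrictT _ _).1 => //.
      apply: measurable_funeM; apply/measurable_EFinP; apply: measurableT_comp => //.
      exact: measurable_funTS.
    - move=> r _; rewrite absPhi patchE mem_setE in_itv/=; case: ifPn => [rt|_]; last by [].
      by rewrite muleC lee_wpmul2r ?lee_fin//; exact: sec.
  rewrite ge0_integralZl; last 4 first.
  - exact: measurable_itv.
  - apply/measurable_EFinP; apply: measurableT_comp => //; exact: measurable_funTS.
  - by move=> s _; rewrite lee_fin.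
  - have := klC t; rewrite t0 lexx => /(_ isT); apply: le_trans.
    by apply: integral_ge0 => s _; rewrite lee_fin.
  rewrite lte_mul_pinfty//.
    have := klC t; rewrite t0 lexx => /(_ isT); apply: le_trans.
    by apply: integral_ge0 => s _; rewrite lee_fin.
  by case/integrableP: gL.
have [ae1 I1 I2 I12] := Rintegral_Fubini mPhi fin.
have inner1 : ae_eq mu setT (EFin \o (fun s => \int[mu]_r Phi (s, r)))
    (EFin \o ((fun s => k (t - s) * convolution l g s) \_ (`]0, t[%classic))).
  move: ae1 PhiE; clear -t; move=> ae1 PhiE.
  move: ae1; apply: filterS => s hs _; rewrite /=; congr (_%:E).
  rewrite patchE mem_setE in_itv/=; case: ifPn => [/andP[s0 st]|st]; last first.
    rewrite /Rintegral integral0_eq// => r _; rewrite PhiE ifF//.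
    apply/negP => /andP[/andP[r0 rs] st']; move/negP: st; apply.
    by rewrite st' (lt_trans r0).
  have PhiE' (r : R) : Phi (s, r) = ((fun r => k (t - s) * (l (s - r) * g r)) \_ (`]0, s[%classic)) r.
    by rewrite PhiE patchE mem_setE in_itv/= st andbT; case: ifPn => // _; rewrite mulrA.
  transitivity (\int[mu]_(r in `]0, s[) (k (t - s) * (l (s - r) * g r))).
    by rewrite [RHS]Rintegral_mkcond; apply: eq_Rintegral => r _.
  have [k0|k0] := eqVneq (k (t - s)) 0.
    rewrite k0 mul0r /Rintegral integral0_eq// => r _.
    by rewrite mul0r.
  rewrite RintegralZl//.
  have : L1 `]0, s[ (fun r => (k (t - s))^-1 * Phi (s, r)).
    by apply: L1Zl => //; move: hs; apply: integrableS.
  apply: eq_integrable => // r; rewrite inE/= => sr.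
  have srs : 0 < r < s by move: sr; rewrite in_itv.
  by rewrite /= PhiE' patchE mem_setE in_itv/= srs (mulKf k0).
have inner2 (r : R) : \int[mu]_s Phi (s, r) =
    ((fun r => convolution k l (t - r) * g r) \_ (`]0, t[%classic)) r.
  rewrite patchE mem_setE in_itv/=; case: ifPn => [/andP[r0 rt]|rt]; last first.
    rewrite /Rintegral integral0_eq// => s _; rewrite PhiE ifF//.
    apply/negP => /andP[/andP[r0 rs] st]; move/negP: rt; apply.
    by rewrite r0 (lt_trans rs).
  transitivity (\int[mu]_(s in `]r, t[) (k (t - s) * l (s - r) * g r)).
    rewrite [RHS]Rintegral_mkcond; apply: eq_Rintegral => s _.
    by rewrite PhiE patchE mem_setE in_itv/= r0.
  have klL : L1 `]r, t[ (fun s => k (t - s) * l (s - r)).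
    apply/integrableP; split.
      by apply/measurable_EFinP; apply: measurable_funTS; exact: mkl.
    apply: le_lt_trans (ltry C); apply: sec; exact/andP.
  rewrite RintegralZr//; congr (_ * _).
  have [_ ->] := Rintegral_translate r klL.
  rewrite subrr /convolution; apply: eq_Rintegral => s _.
  by rewrite addrK opprD addrA addrAC.
have mkc : measurable_fun setT ((fun s => k (t - s) * convolution l g s) \_ (`]0, t[%classic)).
  apply/measurable_restrict => //; apply: measurable_funTS; apply: measurable_funM.
    by apply: (measurableT_comp mk); apply: measurable_funB => //; exact: measurable_id.
  exact: measurable_convolution.
split.
- apply/integrable_mkcond => //; rewrite restrict_EFin.
  apply: ae_integrable_eq inner1 _ I1; exact/measurable_EFinP.
- apply/integrable_mkcond => //; rewrite restrict_EFin.
  by move: I2; apply: eq_integrable => // r _; rewrite /= inner2.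
- rewrite {1}/convolution [LHS]Rintegral_mkcond {2}/convolution [RHS]Rintegral_mkcond.
  transitivity (\int[mu]_s (\int[mu]_r Phi (s, r))).
    rewrite /Rintegral; congr fine; apply/esym/ae_eq_integral => //.
    + exact: measurable_int I1.
    + exact/measurable_EFinP.
  by rewrite I12; apply: eq_Rintegral => r _; rewrite inner2.
Qed.

End convolution_algebra.

(** * Continuity of weakly singular integrals *)

Section continuity_tools.
Context {R : realType}.
Notation mu := (@lebesgue_measure R).

Lemma continuous_pair (T U V : topologicalType) (f : T -> U) (g : T -> V) :
  continuous f -> continuous g -> continuous (fun x => (f x, g x)).
Proof. by move=> cf cg x; exact: (cvg_pair (cf x) (cg x)). Qed.

Lemma continuous_cst_fun (T U : topologicalType) (u : U) : continuous (fun _ : T => u).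
Proof. by move=> x; exact: cvg_cst. Qed.

Lemma continuous_id_fun (T : topologicalType) : continuous (fun x : T => x).
Proof. by move=> x; exact: cvg_id. Qed.

Lemma continuous_compose (T U V : topologicalType) (f : T -> U) (g : U -> V) :
  continuous f -> continuous g -> continuous (fun x => g (f x)).
Proof. by move=> cf cg x; apply: continuous_comp; [exact: cf|exact: cg]. Qed.

Lemma continuous_add (T : topologicalType) (f g : T -> R) :
  continuous f -> continuous g -> continuous (fun x => f x + g x).
Proof. by move=> cf cg x; apply: cvgD; [exact: cf|exact: cg]. Qed.

Lemma continuous_sub (T : topologicalType) (f g : T -> R) :
  continuous f -> continuous g -> continuous (fun x => f x - g x).
Proof. by move=> cf cg x; apply: cvgB; [exact: cf|exact: cg]. Qed.

Lemma continuous_mul (T : topologicalType) (f g : T -> R) :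
  continuous f -> continuous g -> continuous (fun x => f x * g x).
Proof. by move=> cf cg x; apply: cvgM; [exact: cf|exact: cg]. Qed.

Lemma continuous_fst_fun (T U : topologicalType) : continuous (fun z : T * U => z.1).
Proof. by move=> [x y]; exact: cvg_fst. Qed.

Lemma continuous_snd_fun (T U : topologicalType) : continuous (fun z : T * U => z.2).
Proof. by move=> [x y]; exact: cvg_snd. Qed.

Lemma continuous_maxr (T : topologicalType) (f g : T -> R) :
  continuous f -> continuous g -> continuous (fun x => Num.max (f x) (g x)).
Proof. by move=> cf cg x; apply: continuous_max; [exact: cf|exact: cg]. Qed.

Lemma continuous_minr (T : topologicalType) (f g : T -> R) :
  continuous f -> continuous g -> continuous (fun x => Num.min (f x) (g x)).
Proof. by move=> cf cg x; apply: continuous_min; [exact: cf|exact: cg]. Qed.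

Lemma compact_continuous_bounded (T : topologicalType) (K : set T) (h : T -> R) :
  compact K -> continuous h ->
  exists2 C : R, 0 <= C & forall x, K x -> `|h x| <= C.
Proof.
move=> /compact_near_coveringP cK ch.
have : \forall M \near +oo, K `<=` (fun x => `|h x| <= M).
  apply: (cK _ _ (fun (M : R) x => `|h x| <= M)) => x Kx.
  have A : \forall x' \near x, `|h x'| <= `|h x| + 1.
    have : \forall x' \near x, `|h x - h x'| <= 1 by move/cvgrPdist_le: (ch x); apply.
    apply: filterS => x' hx'.
    by have := ler_normB (h x) (h x - h x'); rewrite opprB addrC subrK; lra.
  have B : \forall M \near +oo, `|h x| + 1 <= M by exact: nbhs_pinfty_ge.
  exists ([set x' | `|h x'| <= `|h x| + 1], [set M | `|h x| + 1 <= M]) => //.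
  by move=> [x' M] [/= h1 h2]; exact: le_trans h2.
move=> H; have [M HM M0] : exists2 M : R, K `<=` (fun x => `|h x| <= M) & 0 <= M.
  have [M [HM M0]] := filter_ex (filterI H (nbhs_pinfty_ge (num_real (0:R)))).
  by exists M.
by exists M.
Unshelve. all: by end_near. Qed.

Lemma L1_mul_continuous (a b : R) (w h : R -> R) :
  L1 `]a, b[ w -> continuous h -> L1 `]a, b[ (fun x => w x * h x).
Proof.
move=> wL ch; have [C _ hC] := compact_continuous_bounded (@segment_compact R a b) ch.
apply: (@L1_mulr_bounded _ _ w h C) => //.
  by apply: measurable_funTS; exact: continuous_measurable_fun.
by move=> x xab; apply: hC; exact: subset_itv_oo_cc.
Qed.

(** Near a given parameter [H] is uniformly continuous on the compact interval, and
    [w] is integrable. *)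
Lemma continuous_param_integral (Z : topologicalType) (w : R -> R) (H : R * Z -> R) (a b : R) :
  L1 `]a, b[ w -> continuous H ->
  continuous (fun z : Z => \int[mu]_(s in `]a, b[) (w s * H (s, z))).
Proof.
move=> wL cH z0; have cHz z : continuous (fun s : R => H (s, z)).
  apply: (continuous_compose (f := fun s : R => (s, z))) => //.
  by apply: continuous_pair; [exact: continuous_id_fun|exact: continuous_cst_fun].
pose W := \int[mu]_(s in `]a, b[) `|w s|.
have W0 : 0 <= W by exact: Rintegral_ge0.
apply/cvgrPdist_le => e e0; pose e' := e / (W + 1).
have e'0 : 0 < e' by rewrite divr_gt0//; lra.
have : \forall z \near z0, `[a, b] `<=` (fun s => `|H (s, z0) - H (s, z)| <= e').
  have /compact_near_coveringP := @segment_compact R a b; apply => s _.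
  have e'20 : 0 < e' / 2 by lra.
  have A : \forall x \near (s, z0), `|H (s, z0) - H x| <= e' / 2.
    by move/cvgrPdist_le: (cH (s, z0)); apply.
  have B : \forall s' \near s, `|H (s, z0) - H (s', z0)| <= e' / 2.
    by move/cvgrPdist_le: (cHz z0 s); apply.
  have B2 : \forall p \near (s, z0), `|H (s, z0) - H (p.1, z0)| <= e' / 2.
    exists ([set s' | `|H (s, z0) - H (s', z0)| <= e' / 2], setT) => /=.
      by split => //; exact: filterT.
    by move=> [s' z] [].
  apply: filterS2 A B2 => -[s' z] /= h1 h2.
  have -> : H (s', z0) - H (s', z) =
    (H (s, z0) - H (s', z)) - (H (s, z0) - H (s', z0)) by ring.
  by apply: le_trans (ler_normB _ _) _; rewrite [leRHS](splitr e'); exact: lerD.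
apply: filterS => z Hz.
rewrite -RintegralB//; [|exact: L1_mul_continuous|exact: L1_mul_continuous].
apply: (@le_trans _ _ (e' * W)).
  rewrite /W -RintegralZl//; last exact: integrable_norm.
  apply: normr_Rintegral_le => //.
  - have := L1B (measurable_itv _) (L1_mul_continuous wL (cHz z0)) (L1_mul_continuous wL (cHz z)).
    by move/(measurable_int mu)/measurable_EFinP.
  - by apply: L1Zl => //; exact: integrable_norm.
  - move=> s sab; rewrite -mulrBr normrM mulrC ler_wpM2r//.
    by apply: Hz; exact: subset_itv_oo_cc.
by rewrite /e' mulrAC ler_pdivrMr ?ler_pM2l//; lra.
Unshelve. all: by end_near. Qed.

(** As [x `^ c] is [1] for negative [x], continuity at the origin requires a
    truncation. *)
Definition pos_powR (c x : R) : R := (Num.max x 0) `^ c.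

Lemma pos_powRE (c x : R) : 0 <= x -> pos_powR c x = x `^ c.
Proof. by move=> x0; rewrite /pos_powR max_l. Qed.

Lemma pos_powR_le0 (c x : R) : c != 0 -> x <= 0 -> pos_powR c x = 0.
Proof. by move=> c0 x0; rewrite /pos_powR max_r// powR0. Qed.

Lemma continuous_pos_powR (c : R) : 0 <= c -> continuous (pos_powR c).
Proof.
rewrite le_eqVlt => /predU1P[<- x|c0 x].
  rewrite (_ : pos_powR 0 = cst 1); first exact: cvg_cst.
  by apply/funext => y; rewrite /pos_powR powRr0.
have [x0|x0|->] := ltgtP x 0.
- rewrite /continuous_at (pos_powR_le0 _ (ltW x0)) ?gt_eqF//.
  have : (fun _ : R => (0 : R)) y @[y --> x] --> (0 : R) by exact: cvg_cst.
  apply: cvg_trans; apply: near_eq_cvg; near=> y.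
  have y0 : y < 0 by near: y; exact: lt_nbhsl.
  by rewrite /= pos_powR_le0 ?gt_eqF ?ltW.
- have : {for x, continuous (fun y : R => y `^ c)}.
    apply: differentiable_continuous; apply/derivable1_diffP.
    by apply: derivable_powR; rewrite in_itv/= x0.
  rewrite /continuous_at /pos_powR max_l ?ltW// => h.
  apply: cvg_trans h; apply: near_eq_cvg; near=> y.
  have y0 : 0 < y by near: y; exact: lt_nbhsr.
  by rewrite max_l ?ltW.
- rewrite /continuous_at {2}/pos_powR maxxx powR0 ?gt_eqF//.
  apply/cvgrPdist_lt => e e0; have d0 : 0 < e `^ c^-1 by rewrite powR_gt0.
  apply/nbhs_ballP; exists (e `^ c^-1) => //= y.
  rewrite /ball/= !sub0r !normrN => yd.
  rewrite ger0_norm ?powR_ge0//.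
  rewrite /pos_powR; rewrite -[ltRHS](@powRr1 _ e) ?ltW//.
  rewrite -(@mulVf _ c) ?gt_eqF// powRrM; apply: gt0_ltr_powR => //.
  + by rewrite nnegrE le_max lexx orbT.
  + by rewrite nnegrE powR_ge0.
  + rewrite gt_max d0 andbT; move: yd; apply: le_lt_trans.
    exact: ler_norm.
Unshelve. all: by end_near. Qed.

(** The product of the singularity of a kernel at [s = t] and of that of the
    integrand at [s = 0]. *)
Definition beta_weight (b b' t s : R) : R := (t - s) `^ (b - 1) * s `^ (b' - 1).

Lemma L1_beta_weight (b b' t : R) : 0 < b -> 0 < b' -> L1 `]0, t[ (beta_weight b b' t).
Proof.
move=> b0 b'0; have [t0|t0] := leP 0 t; first by have [] := Beta_integral b0 b'0 t0.
by rewrite set_itv_ge ?bnd_simp -?leNgt ?ltW//; exact: integrable_set0.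
Qed.

Lemma beta_weight_ge0 (b b' t s : R) : 0 <= beta_weight b b' t s.
Proof. by rewrite mulr_ge0 ?powR_ge0. Qed.

Lemma beta_weight_scale (b b' : R) (h : R * R -> R) (x : R) :
  0 < b -> 0 < b' -> b + b' - 1 != 0 -> continuous h ->
  \int[mu]_(s in `]0, x[) (beta_weight b b' x s * h (x - s, s)) =
  pos_powR (b + b' - 1) x * \int[mu]_(s in `]0, 1[) (beta_weight b b' 1 s *
     h (Num.max x 0 * (1 - s), Num.max x 0 * s)).
Proof.
move=> b0 b'0 c0 ch; have [x0|x0] := ltP 0 x; last first.
  by rewrite pos_powR_le0// mul0r set_itv_ge ?Rintegral_set0// bnd_simp -leNgt.
rewrite pos_powRE ?(ltW x0)//.
have chx : continuous (fun s : R => h (x - s, s)).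
  apply: (continuous_compose (f := fun s : R => (x - s, s))) => //.
  apply: continuous_pair; last exact: continuous_id_fun.
  by apply: continuous_sub; [exact: continuous_cst_fun|exact: continuous_id_fun].
have wL := L1_mul_continuous (L1_beta_weight x b0 b'0) chx.
have [iL ->] := Rintegral_scale x0 wL.
have E (s : R) : 0 < s < 1 -> beta_weight b b' x (x * s) * h (x - x * s, x * s) =
    x `^ (b + b' - 2) * (beta_weight b b' 1 s * h (x * (1 - s), x * s)).
  move=> /andP[s0 s1]; rewrite /beta_weight.
  have -> : x - x * s = x * (1 - s) by rewrite mulrBr mulr1.
  have s10 : 0 <= 1 - s by rewrite subr_ge0 ltW.
  rewrite (powRM _ (ltW x0) s10) (powRM _ (ltW x0) (ltW s0)).
  have -> : b + b' - 2 = (b - 1) + (b' - 1) by ring.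
  by rewrite (powR_add (b - 1) (b' - 1) x0) [X in X * _ = _]mulrACA -!mulrA.
have cc : continuous (fun s : R => h (x * (1 - s), x * s)).
  apply: (continuous_compose (f := fun s : R => (x * (1 - s), x * s))) => //.
  apply: continuous_pair; apply: continuous_mul; (try exact: continuous_cst_fun); last exact: continuous_id_fun.
  by apply: continuous_sub; [exact: continuous_cst_fun|exact: continuous_id_fun].
have bL := L1_mul_continuous (L1_beta_weight 1 b0 b'0) cc.
transitivity (x * \int[mu]_(s in `]0, 1[) (x `^ (b + b' - 2) *
    (beta_weight b b' 1 s * h (x * (1 - s), x * s)))).
  by congr (_ * _); apply: eq_Rintegral => s; rewrite inE/= in_itv/= => /E.
rewrite RintegralZl//.
rewrite mulrA; congr (_ * _); rewrite -{1}(powRr1 (ltW x0)) -(powR_add _ _ x0).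
by congr (_ `^ _); ring.
Qed.

(** After scaling the domain to [`]0, 1[] the singular weight no longer moves, and
    [continuous_param_integral] applies. *)
Lemma continuous_beta_convolution (Z : topologicalType) (b b' : R) (H : (R * R) * Z -> R) :
  0 < b -> 0 < b' -> 0 < b + b' - 1 -> continuous H ->
  continuous (fun p : R * Z =>
    \int[mu]_(s in `]0, p.1[) (beta_weight b b' p.1 s * H ((p.1 - s, s), p.2))).
Proof.
move=> b0 b'0 c0 cH.
have cHz (z : Z) : continuous (fun y : R * R => H (y, z)).
  apply: (continuous_compose (f := fun y : R * R => (y, z))) => //.
  by apply: continuous_pair; [exact: continuous_id_fun|exact: continuous_cst_fun].
pose H' (q : R * (R * Z)) : R :=
  H ((Num.max q.2.1 0 * (1 - q.1), Num.max q.2.1 0 * q.1), q.2.2).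
have cH' : continuous H'.
  have c1 : continuous (fun q : R * (R * Z) => q.1) by exact: continuous_fst_fun.
  have c2 : continuous (fun q : R * (R * Z) => q.2) by exact: continuous_snd_fun.
  have c21 : continuous (fun q : R * (R * Z) => q.2.1).
    by apply: continuous_compose c2 _; exact: continuous_fst_fun.
  have c22 : continuous (fun q : R * (R * Z) => q.2.2).
    by apply: continuous_compose c2 _; exact: continuous_snd_fun.
  have cm : continuous (fun q : R * (R * Z) => Num.max q.2.1 0).
    by apply: continuous_maxr => //; exact: continuous_cst_fun.
  apply: (continuous_compose (f := fun q : R * (R * Z) =>
    ((Num.max q.2.1 0 * (1 - q.1), Num.max q.2.1 0 * q.1), q.2.2))) => //.
  apply: continuous_pair => //; apply: continuous_pair; apply: continuous_mul => //.
  by apply: continuous_sub => //; exact: continuous_cst_fun.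
have := continuous_param_integral (L1_beta_weight 1 b0 b'0) cH'.
move=> ci p; rewrite (_ : (fun p : R * Z => _) = (fun p : R * Z => pos_powR (b + b' - 1) p.1 *
   \int[mu]_(s in `]0, 1[) (beta_weight b b' 1 s * H' (s, p)))); last first.
  apply/funext => -[x z]/=.
  by rewrite (beta_weight_scale _ b0 b'0 _ (cHz z))// gt_eqF.
apply: cvgM; last exact: ci.
apply: (continuous_comp (f := fst) (g := pos_powR (b + b' - 1))); first exact: cvg_fst.
by apply: continuous_pos_powR; exact: ltW.
Qed.

Lemma expRN_le_powRN (c y : R) : 0 < c <= 1 -> 0 < y -> expR (- y) <= y `^ (- c).
Proof.
move=> /andP[c0 c1] y0; rewrite expRN powRN lef_pV2 ?posrE ?expR_gt0 ?powR_gt0//.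
have e1 := expR_ge1Dx y.
have [y1|y1] := leP y 1.
  apply: (@le_trans _ _ 1); last by lra.
  have h : y `^ c <= 1 `^ c by apply: ge0_ler_powR; rewrite ?nnegrE ?(ltW c0) ?(ltW y0).
  by rewrite powR1 in h.
apply: (@le_trans _ _ y); last by lra.
by rewrite -[leRHS](powRr1 (ltW y0)); apply: ler_powR => //; exact: ltW.
Qed.

(** The exponential is bounded by a small power, [expR (- y) <= y `^ (- c)], which
    the weight can absorb while remaining integrable; this leaves the factor
    [m `^ (- c)]. *)
Lemma beta_weight_exp_small (b b' T e : R) : 0 < b -> 0 < b' -> 0 < b + b' - 1 ->
  0 <= T -> 0 < e ->
  exists2 m : R, 0 <= m & forall x, 0 <= x <= T ->
    \int[mu]_(s in `]0, x[) (beta_weight b b' x s * expR (- (m * (x - s)))) <= e.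
Proof.
move=> b0 b'0 c0 T0 e0.
(* Half of the room left by the integrability of the weight and by [expRN_le_powRN]. *)
pose c := Num.min (Num.min b (b + b' - 1)) 1 / 2.
have [cp [cb [cc c1]]] : 0 < c /\ (0 < b - c /\ (0 <= b + b' - 1 - c /\ c <= 1)).
  have h1 : 0 < Num.min (Num.min b (b + b' - 1)) 1 by rewrite !lt_min b0 c0 ltr01.
  have h2 : Num.min (Num.min b (b + b' - 1)) 1 <= b by rewrite !ge_min lexx.
  have h3 : Num.min (Num.min b (b + b' - 1)) 1 <= b + b' - 1 by rewrite !ge_min lexx orbT.
  have h4 : Num.min (Num.min b (b + b' - 1)) 1 <= 1 by rewrite ge_min lexx orbT.
  by rewrite /c; do !split; lra.
pose B := Gamma (b - c) * Gamma b' / Gamma (b - c + b').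
have B0 : 0 <= B by rewrite divr_ge0 ?mulr_ge0// ltW// Gamma_gt0// addr_gt0.
pose Q := T `^ (b + b' - 1 - c) * B.
have Q0 : 0 <= Q by rewrite mulr_ge0 ?powR_ge0.
have q0 : 0 < Q / e + 1 by rewrite ltr_wpDl// divr_ge0// ltW.
pose m := (Q / e + 1) `^ c^-1; have m0 : 0 < m by rewrite powR_gt0.
have mE : m `^ (- c) = (Q / e + 1)^-1.
  by rewrite /m -powRrM mulrN mulVf ?gt_eqF// powR_inv1// ltW.
exists m; first exact: ltW.
move=> x /andP[]; rewrite le_eqVlt => /predU1P[<- _|x0 xT].
  by rewrite set_itvoo0 Rintegral_set0 ltW.
have [L I] := Beta_integral cb b'0 (ltW x0).
apply: (@le_trans _ _ (\int[mu]_(s in `]0, x[) (m `^ (- c) * beta_weight (b - c) b' x s))).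
  apply: le_Rintegral => //.
  - apply: L1_mul_continuous; first exact: L1_beta_weight.
    move=> s; apply: continuous_comp; last exact: continuous_expR.
    apply: cvgN; apply: cvgM; first exact: cvg_cst.
    by apply: cvgB; [exact: cvg_cst|exact: cvg_id].
  - by apply: L1Zl.
  - move=> s /=; rewrite in_itv/= => /andP[s0 sx].
    have xs0 : 0 < x - s by rewrite subr_gt0.
    apply: (@le_trans _ _ (beta_weight b b' x s * (m * (x - s)) `^ (- c))).
      rewrite ler_wpM2l ?beta_weight_ge0//; apply: expRN_le_powRN; first by rewrite cp.
      exact: mulr_gt0.
    rewrite powRM ?(ltW m0) ?(ltW xs0)// /beta_weight.
    have -> : b - c - 1 = (b - 1) + (- c) by ring.
    rewrite (powR_add (b - 1) (- c) xs0) le_eqVlt; apply/orP; left; apply/eqP.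
    by rewrite mulrCA; congr (_ * _); rewrite mulrAC.
rewrite RintegralZl// I x0 mE.
have -> : b - c + b' - 1 = b + b' - 1 - c by ring.
rewrite -/B mulrC ler_pdivrMr//.
apply: (@le_trans _ _ Q).
  by rewrite ler_wpM2r//; apply: ge0_ler_powR; rewrite ?nnegrE ?(ltW x0).
by rewrite mulrDr mulr1 mulrCA divff ?gt_eqF// mulr1 lerDl ltW.
Qed.

End continuity_tools.

(** * Exchange of integrals *)

Lemma continuous_sectionl (T U V : topologicalType) (H : T * U -> V) (y : U) :
  continuous H -> continuous (fun x => H (x, y)).
Proof.
move=> cH; apply: (@continuous_compose T (T * U)%type V (fun x => (x, y))) => //.
exact: (continuous_pair (@continuous_id_fun _) (@continuous_cst_fun _ _ _)).
Qed.

Lemma continuous_sectionr (T U V : topologicalType) (H : T * U -> V) (x : T) :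
  continuous H -> continuous (fun y => H (x, y)).
Proof.
move=> cH; apply: (@continuous_compose U (T * U)%type V (fun y => (x, y))) => //.
exact: (continuous_pair (@continuous_cst_fun _ _ _) (@continuous_id_fun _)).
Qed.

Section swap.
Context {R : realType}.
Notation mu := (@lebesgue_measure R).
Notation RR := (measurableTypeR R * measurableTypeR R)%type.

(** Measurability is for the product of the Borel sigma-algebras. A continuous
    function of two variables is a pointwise limit of functions that are piecewise
    constant in the second variable, and those are measurable for the product. *)
Lemma measurable_continuous_pair (H : R * R -> R) : continuous H ->
  measurable_fun setT (H : RR -> R).
Proof.
move=> cH.
pose step (n : nat) (y : R) : R := (Num.floor (n.+1%:R * y))%:~R / n.+1%:R.
pose Hn (n : nat) (z : RR) : R := H (z.1, step n z.2).
have stepE n (y : R) : `|step n y - y| <= n.+1%:R^-1.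
  have n0 : 0 < (n.+1%:R : R) by rewrite ltr0n.
  have -> : step n y - y = ((Num.floor (n.+1%:R * y))%:~R - n.+1%:R * y) / n.+1%:R.
    by rewrite /step mulrBl mulrAC divff ?gt_eqF// mul1r.
  rewrite normrM [X in _ * X]ger0_norm ?invr_ge0// ler_piMl ?invr_ge0//.
  have := floor_le_tmp (n.+1%:R * y); have := lt_succ_floor (n.+1%:R * y).
  by rewrite intrD ler_norml => h1 h2; apply/andP; split; lra.
have mHn n : measurable_fun setT (Hn n).
  move=> _ A mA; rewrite setTI.
  pose I (k : int) : set R := [set y : R | Num.floor (n.+1%:R * y) = k].
  have -> : Hn n @^-1` A = \bigcup_(k in setT)
      (((fun x : R => H (x, k%:~R / n.+1%:R)) @^-1` A) `*` I k).
    apply/seteqP; split => [[x y] Axy|[x y] [k _ [/= h1 h2]]].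
      by exists (Num.floor (n.+1%:R * y)) => //; split.
    by rewrite /Hn /step/= h2.
  apply: countable_bigcupT_measurable => [|k]; first exact: countableP.
  apply: measurableX.
    have cs : continuous (fun x : R => H (x, k%:~R / n.+1%:R)) by exact: continuous_sectionl.
    rewrite -[_ @^-1` _]setTI; exact: (continuous_measurable_fun cs).
  have -> : I k = `[k%:~R / n.+1%:R, (k + 1)%:~R / n.+1%:R[%classic.
    have n0 : 0 < (n.+1%:R : R) by rewrite ltr0n.
    apply/seteqP; split => y; rewrite /I/= in_itv/=.
      move=> <-; rewrite ler_pdivrMr// ltr_pdivlMr// [y * _]mulrC.
      by rewrite floor_le_tmp lt_succ_floor.
    rewrite ler_pdivrMr// ltr_pdivlMr// [y * _]mulrC => /andP[h1 h2].
    by apply: floor_def; rewrite h1 h2.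
  exact: measurable_itv.
have lim (x y : R) : H (x, step n y) @[n --> \oo] --> H (x, y).
  have cy : {for y, continuous (fun y : R => H (x, y))} by exact: (continuous_sectionr cH).
  suff : step n y @[n --> \oo] --> y by move=> h; exact: (cvg_comp _ _ h cy).
  apply/cvgrPdist_le => e e0.
  have : n.+1%:R^-1 @[n --> \oo] --> (0 : R) by exact: cvg_harmonic.
  move/cvgrPdist_le => /(_ _ e0); apply: filterS => n.
  rewrite sub0r normrN ger0_norm ?invr_ge0// distrC => h.
  exact: le_trans (stepE n y) h.
apply: (@measurable_fun_cvg _ _ _ setT Hn) => // -[x y] _.
exact: lim.
Qed.

Lemma L1_restrict (a b : R) (w : R -> R) : L1 `]a, b[ w ->
  mu.-integrable setT (EFin \o (w \_ (`]a, b[%classic))).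
Proof.
by move=> /integrable_mkcond; rewrite restrict_EFin => /(_ (measurable_itv _)).
Qed.

(** The integrand is dominated by [|w1| |w2| C], [C] bounding [H] on the compact
    rectangle. *)
Lemma Rintegral_swap (w1 w2 : R -> R) (H : R * R -> R) (a b c d : R) :
  L1 `]a, b[ w1 -> L1 `]c, d[ w2 -> continuous H ->
  \int[mu]_(x in `]a, b[) (w1 x * \int[mu]_(y in `]c, d[) (w2 y * H (x, y))) =
  \int[mu]_(y in `]c, d[) (w2 y * \int[mu]_(x in `]a, b[) (w1 x * H (x, y))).
Proof.
move=> L1w L2w cH.
have cK : compact (`[a, b]%classic `*` `[c, d]%classic : set (R * R)).
  by apply: compact_setX; exact: segment_compact.
have [C C0 HC] := compact_continuous_bounded cK cH.
pose v1 := w1 \_ (`]a, b[%classic); pose v2 := w2 \_ (`]c, d[%classic).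
have vE1 x : v1 x = if a < x < b then w1 x else 0 by rewrite /v1 patchE mem_setE in_itv.
have vE2 x : v2 x = if c < x < d then w2 x else 0 by rewrite /v2 patchE mem_setE in_itv.
have Lv1 : mu.-integrable setT (EFin \o v1).
  by apply: L1_restrict.
have Lv2 : mu.-integrable setT (EFin \o v2).
  by apply: L1_restrict.
have mv1 : measurable_fun setT v1 by apply/measurable_EFinP; exact: measurable_int Lv1.
have mv2 : measurable_fun setT v2 by apply/measurable_EFinP; exact: measurable_int Lv2.
pose Phi (z : RR) : R := v1 z.1 * (v2 z.2 * H z).
have mPhi : measurable_fun setT Phi.
  apply: measurable_funM; first by apply: (measurableT_comp mv1); exact: measurable_fst.
  apply: measurable_funM; first by apply: (measurableT_comp mv2); exact: measurable_snd.
  exact: measurable_continuous_pair.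
have Phi_le x y : `|Phi (x, y)| <= `|v1 x| * (`|v2 y| * C).
  rewrite /Phi/= vE1 vE2; case: ifPn => hx; last by rewrite mul0r normr0 mul0r.
  case: ifPn => hy; last by rewrite mul0r mulr0 normr0 mul0r mulr0.
  rewrite !normrM !ler_wpM2l//; apply: HC; split => /=; rewrite in_itv/=.
    by case/andP: hx => /ltW -> /ltW.
  by case/andP: hy => /ltW -> /ltW.
have fin : (\int[mu]_y \int[mu]_x `|Phi (x, y)|%:E < +oo)%E.
  apply: (@le_lt_trans _ _ (\int[mu]_y (`|v2 y|%:E * (C%:E * \int[mu]_x `|v1 x|%:E)))%E).
    apply: ge0_le_integral => //.
    - by move=> y _; apply: integral_ge0 => x _; rewrite lee_fin.
    - apply: (@measurable_fun_fubini_tonelli_G _ _ _ _ R mu (fun z : RR => `|Phi z|%:E)) => //.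
      by apply/measurable_EFinP; exact: measurableT_comp.
    - apply: emeasurable_funM; last exact: measurable_cst.
      by apply/measurable_EFinP; exact: measurableT_comp.
    - move=> y _; rewrite muleA -EFinM -ge0_integralZl; last 4 first.
      + exact: measurableT.
      + by apply/measurable_EFinP; exact: measurableT_comp.
      + by move=> x _; rewrite lee_fin.
      + by rewrite lee_fin mulr_ge0.
      apply: ge0_le_integral => //.
      + apply/measurable_EFinP; apply: measurableT_comp => //.
        by apply: (measurableT_comp mPhi); exact: measurable_pair2.
      + apply: measurable_funeM; apply/measurable_EFinP; exact: measurableT_comp.
      + by move=> x _; rewrite -EFinM lee_fin (le_trans (Phi_le x y))// mulrC.
  have I1fin : (\int[mu]_x `|v1 x|%:E)%E \is a fin_num.
    by apply: integrable_fin_num => //; exact: integrable_norm.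
  rewrite ge0_integralZr; last 4 first.
  - exact: measurableT.
  - by apply/measurable_EFinP; exact: measurableT_comp.
  - by move=> y _; rewrite lee_fin.
  - by rewrite mule_ge0 ?lee_fin//; apply: integral_ge0 => x _; rewrite lee_fin.
  rewrite lte_mul_pinfty//.
  + by apply: integral_ge0 => x _; rewrite lee_fin.
  + by apply: integrable_fin_num => //; exact: integrable_norm.
  + by rewrite -(fineK I1fin) -EFinM ltry.
have [_ _ _ E] := Rintegral_Fubini mPhi fin.
have cHx x : continuous (fun y : R => H (x, y)) by exact: continuous_sectionr.
have cHy y : continuous (fun x : R => H (x, y)) by exact: continuous_sectionl.
transitivity (\int[mu]_x \int[mu]_y Phi (x, y)).
  rewrite [LHS]Rintegral_mkcond; apply: eq_Rintegral => x _.
  rewrite patchE mem_setE in_itv/= /Phi/= vE1; case: ifPn => hx.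
    have Ly := L1_mul_continuous L2w (cHx x).
    rewrite -RintegralZl// [LHS]Rintegral_mkcond; apply: eq_Rintegral => y _.
    rewrite patchE mem_setE in_itv/= vE2; case: ifPn => // _.
    by rewrite mul0r mulr0.
  rewrite /Rintegral integral0_eq// => y _.
  by rewrite mul0r.
rewrite E [RHS]Rintegral_mkcond; apply: eq_Rintegral => y _.
rewrite patchE mem_setE in_itv/= /Phi/= vE2; case: ifPn => hy; last first.
  by rewrite /Rintegral integral0_eq// => x _; rewrite mul0r mulr0.
have Lx := L1_mul_continuous L1w (cHy y).
rewrite -RintegralZl// [RHS]Rintegral_mkcond; apply: eq_Rintegral => x _.
rewrite patchE mem_setE in_itv/= vE1; case: ifPn => _; last by rewrite mul0r.
by rewrite mulrCA.
Qed.

End swap.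

(** * Neumann series, retractions and primitives *)

Section neumann.
Context {R : realType} (T : topologicalType).
Implicit Types (L : (T -> R) -> T -> R) (W g h : T -> R).

(** The weighted sup norm is expressed by pointwise bounds, so that no normed space
    of functions has to be constructed. *)
Definition half_contraction W L :=
  [/\ forall g, continuous g -> continuous (L g),
      forall g h z, continuous g -> continuous h ->
        L (fun y => g y - h y) z = L g z - L h z &
      forall g C, 0 <= C -> continuous g -> (forall z, `|g z| <= C * W z) ->
        forall z, `|L g z| <= C / 2 * W z].

Lemma half_contraction_iter W L h C n : half_contraction W L -> 0 <= C ->
  continuous h -> (forall z, `|h z| <= C * W z) ->
  continuous (iter n L h) /\ forall z, `|iter n L h z| <= C * 2^-1 ^+ n * W z.
Proof.
move=> [Lc _ Lle] C0 ch hC; elim: n => [|n [cn le_n]].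
  by split=> // z; rewrite expr0 mulr1.
split; first exact: Lc.
move=> z; rewrite exprSr [C * (_ * _)]mulrA; apply: Lle => //.
by rewrite mulr_ge0// exprn_ge0// invr_ge0.
Qed.

Lemma half_contraction_unique W L g C : half_contraction W L -> 0 <= C ->
  continuous g -> (forall z, `|g z| <= C * W z) -> (forall z, g z = L g z) ->
  forall z, g z = 0.
Proof.
move=> LW C0 cg gC gL z; apply/eqP; rewrite -normr_le0.
apply: (@le0_of_half_powers _ _ (C * W z)) => n.
have [_ /(_ z)] := half_contraction_iter n LW C0 cg gC.
have -> : iter n L g = g by elim: n => //= n ->; apply/funext => y; rewrite -gL.
by rewrite mulrAC.
Qed.

Lemma uniform_limit_continuous_half (u : nat -> T -> R) (l : T -> R) (C : R) :
  (forall n, continuous (u n)) -> (forall n z, `|l z - u n z| <= C * 2^-1 ^+ n) ->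
  continuous l.
Proof.
move=> cu ul z; apply/cvgrPdist_le => e e0.
have c0 : (fun n => C * 2^-1 ^+ n) @ \oo --> (0 : R).
  rewrite -(mulr0 C); apply: cvgM; first exact: cvg_cst.
  by apply: cvg_expr; rewrite ger0_norm ?invr_ge0// invf_lt1// ltr1n.
have e30 : 0 < e / 3 by rewrite divr_gt0.
move/cvgrPdist_le : c0 => /(_ _ e30) [n _ /(_ n (leqnn n)) hn].
rewrite sub0r normrN in hn; have {}hn := le_trans (ler_norm _) hn.
move/cvgrPdist_le : (cu n z) => /(_ _ e30); apply: filterS => y hy.
have h1 := le_trans (ul n z) hn; have h2 := le_trans (ul n y) hn.
have -> : l z - l y = (l z - u n z) + (u n z - u n y) - (l y - u n y) by ring.
by rewrite ler_norml; move: h1 h2 hy; rewrite !ler_norml;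
  move=> /andP[? ?] /andP[? ?] /andP[? ?]; apply/andP; split; lra.
Qed.

(** The terms decay like [2^-1 ^+ n] uniformly, so the sum is continuous. Its
    convergence to [rho] is part of the conclusion because it identifies the
    resolvent with a series. *)
Lemma neumann_series W L h (Wm C : R) : (forall z, 0 <= W z <= Wm) ->
  half_contraction W L -> 0 <= C -> continuous h -> (forall z, `|h z| <= C * W z) ->
  exists rho : T -> R,
    [/\ continuous rho, forall z, rho z = h z + L rho z &
        forall z, series (fun n => iter n L h z) @ \oo --> rho z].
Proof.
move=> W0 LW C0 ch hC; have [Lc LB Lle] := LW.
have iterP n := half_contraction_iter n LW C0 ch hC.
pose u n z := series (fun n => iter n L h z) n.
have uS n z : u n.+1 z = u n z + iter n L h z by rewrite /u /series/= big_nat_recr.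
have u0 z : u 0%N z = 0 by rewrite /u /series/= big_geq.
have cvu z : cvgn (u ^~ z).
  apply: normed_cvg; apply: (@series_le_cvg _ _ (fun m => C * W z * 2^-1 ^+ m)) => //.
  - by move=> m /=; exact: normr_ge0.
  - by move=> m; rewrite !mulr_ge0// ?exprn_ge0 ?invr_ge0//; case/andP: (W0 z).
  - by move=> m /=; rewrite mulrAC; case: (iterP m).
  - exact: cvg_series_half.
pose rho z := limn (u ^~ z).
have diff n k z : `|u (n + k)%N z - u n z| <= 2 * C * W z * 2^-1 ^+ n.
  have Wz : 0 <= W z by case/andP: (W0 z).
  apply: (@le_trans _ _ (2 * C * W z * (2^-1 ^+ n - 2^-1 ^+ (n + k)))); last first.
    by apply: ler_wpM2l; rewrite ?mulr_ge0// gerBl exprn_ge0// invr_ge0.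
  elim: k => [|k ih]; first by rewrite addn0 !subrr normr0 mulr0.
  rewrite addnS uS addrAC; apply: le_trans (ler_normD _ _) _.
  have [_ /(_ z) h1] := iterP (n + k)%N.
  apply: le_trans (lerD ih h1) _.
  by rewrite exprS; move: (2^-1 ^+ n) (2^-1 ^+ (n + k)) => A B; lra.
have tail n z : `|rho z - u n z| <= 2 * C * W z * 2^-1 ^+ n.
  have cr : `|u (k + n)%N z - u n z| @[k --> \oo] --> `|rho z - u n z|.
    apply: cvg_norm; apply: cvgB; last exact: cvg_cst.
    by rewrite (cvg_shiftn n); exact: cvu.
  rewrite -(cvg_lim _ cr)//; apply: limr_le; first by apply/cvg_ex; exists `|rho z - u n z|.
  by apply: nearW => k; rewrite addnC.
have tailW n z : `|rho z - u n z| <= 2 * C * Wm * 2^-1 ^+ n.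
  apply: le_trans (tail n z) _; rewrite ler_wpM2r ?exprn_ge0 ?invr_ge0//.
  by rewrite ler_wpM2l ?mulr_ge0//; case/andP: (W0 z).
have cu n : continuous (u n).
  elim: n => [|n ih z].
    by rewrite (_ : u 0%N = cst 0); [exact: cst_continuous|apply/funext => z; exact: u0].
  rewrite (_ : u n.+1 = fun z => u n z + iter n L h z); last by apply/funext => y; exact: uS.
  by apply: cvgD; [exact: ih|have [c _] := iterP n; exact: c].
have crho : continuous rho := uniform_limit_continuous_half cu tailW.
have Lu n z : u n.+1 z = h z + L (u n) z.
  elim: n z => [|n ih] z.
    rewrite uS u0 add0r (_ : u 0%N = fun y => h y - h y); last first.
      by apply/funext => y; rewrite u0 subrr.
    by rewrite LB// subrr addr0.
  have itc : continuous (iter n L h) by case: (iterP n).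
  rewrite uS ih -addrA; congr (_ + _).
  have : L (fun y => u n.+1 y - u n y) z = L (u n.+1) z - L (u n) z by exact: LB.
  rewrite (_ : (fun y => _) = iter n L h); last by apply/funext => y; rewrite uS addrC addKr.
  by move=> /= ->; rewrite addrC subrK.
exists rho; split; [exact: crho|move=> z|move=> z; exact: cvu].
apply/eqP; rewrite -subr_eq0 -normr_le0.
apply: (@le0_of_half_powers _ _ (2 * C * W z)) => n.
have h1 := tail n.+1 z.
have h2 : `|L (fun y => rho y - u n y) z| <= 2 * C * 2^-1 ^+ n / 2 * W z.
  apply: Lle; first by rewrite !mulr_ge0// exprn_ge0// invr_ge0.
    by move=> y; apply: cvgB; [exact: crho|exact: cu].
  by move=> y; rewrite mulrAC; exact: tail.
rewrite LB// in h2.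
have -> : rho z - (h z + L rho z) = (rho z - u n.+1 z) - (L rho z - L (u n) z).
  by rewrite Lu; ring.
apply: le_trans (ler_normB _ _) _; apply: le_trans (lerD h1 h2) _.
by rewrite exprS; move: (2^-1 ^+ n) => A; lra.
Qed.

End neumann.

Section retraction.
Context {R : realType}.
Notation mu := (@lebesgue_measure R).

(** Functions given on an interval or a rectangle are extended by composition with a
    retraction, so that continuity can be used without a subspace topology. *)
Lemma continuous_retract (T U : topologicalType) (K : set T) (r : T -> T) (f : T -> U) :
  continuous r -> (forall x, K (r x)) -> {within K, continuous f} ->
  continuous (fun x => f (r x)).
Proof.
move=> cr Kr /subspace_continuousP cf x B fB.
have H : within K (nbhs (r x)) (f @^-1` B) := cf _ (Kr x) B fB.
have H' : \forall y \near x, K (r y) -> B (f (r y)) := cr x _ H.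
suff : \forall y \near x, B (f (r y)) by [].
by apply: filterS H' => y; apply.
Qed.

Definition clamp (lo hi x : R) : R := Num.max lo (Num.min x hi).

Lemma continuous_clamp lo hi : continuous (clamp lo hi).
Proof.
apply: continuous_maxr; first exact: continuous_cst_fun.
by apply: continuous_minr; [exact: continuous_id_fun|exact: continuous_cst_fun].
Qed.

Lemma clamp_id lo hi x : lo <= x <= hi -> clamp lo hi x = x.
Proof. by move=> /andP[x0 xc]; rewrite /clamp min_l// max_r. Qed.

Lemma clamp_itv lo hi x : lo <= hi -> lo <= clamp lo hi x <= hi.
Proof. by move=> c0; rewrite /clamp le_max lexx/= ge_max c0 ge_min lexx orbT. Qed.

Lemma continuous_clamp_pointwise lo hi (f : R -> R) : lo <= hi ->
  (forall x, lo <= x <= hi -> {for x, continuous f}) ->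
  continuous (fun x => f (clamp lo hi x)).
Proof.
move=> lohi cf x; apply: continuous_comp; first exact: continuous_clamp.
by apply: cf; exact: clamp_itv.
Qed.

Definition clamp2 (q p : R) (z : R * R) : R * R := (clamp 0 q z.1, clamp 0 p z.2).

Lemma continuous_clamp2 q p : continuous (clamp2 q p).
Proof.
apply: continuous_pair.
  by apply: (continuous_compose (g := clamp 0 q));
    [exact: continuous_fst_fun|exact: continuous_clamp].
by apply: (continuous_compose (g := clamp 0 p));
  [exact: continuous_snd_fun|exact: continuous_clamp].
Qed.

Lemma clamp2_id q p z : 0 <= z.1 <= q -> 0 <= z.2 <= p -> clamp2 q p z = z.
Proof. by case: z => t x /= tq xp; rewrite /clamp2/= !clamp_id. Qed.

Lemma continuous_clamp_within c (f : R -> R) : 0 <= c ->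
  {within `[0, c], continuous f} -> continuous (fun x => f (clamp 0 c x)).
Proof.
move=> c0; apply: continuous_retract; first exact: continuous_clamp.
by move=> x; rewrite /= in_itv/=; exact: clamp_itv.
Qed.

(** The segment from a point of the closed rectangle to the centre is in the open
    rectangle, except for its starting point. *)
Lemma closure_Omega (p q : R) : 0 < p -> 0 < q ->
  closure (Omega p q) = [set z | 0 <= z.1 <= q /\ 0 <= z.2 <= p].
Proof.
move=> p0 q0; apply/seteqP; split => -[t x] /=.
  move=> H; split.
    have /itv_closure : closure `]0, q[%classic t.
      move=> B Bt; have [|[t' x'] [/= [h _] Bt']] := H (fst @^-1` B); first exact: cvg_fst.
      by exists t'; split => //=; rewrite in_itv.
    by rewrite /= in_itv.
  have /itv_closure : closure `]0, p[%classic x.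
    move=> B Bx; have [|[t' x'] [/= [_ h] Bx']] := H (snd @^-1` B); first exact: cvg_snd.
    by exists x'; split => //=; rewrite in_itv.
  by rewrite /= in_itv.
move=> [/andP[t0 tq] /andP[x0 xp]] B.
(* the segment from the given point to the centre of the rectangle *)
pose seg (r s c : R) := r + s * (c / 2 - r).
have cseg r c : continuous (fun s => seg r s c).
  apply: continuous_add; first exact: continuous_cst_fun.
  by apply: continuous_mul; [exact: continuous_id_fun|exact: continuous_cst_fun].
have cc : continuous (fun s => (seg t s q, seg x s p)) by exact: continuous_pair.
have seg0 r c : seg r 0 c = r by rewrite /seg mul0r addr0.
move=> BB; have {}BB : nbhs (seg t 0 q, seg x 0 p) B by rewrite !seg0.
have H1 : \forall s \near 0^'+, B (seg t s q, seg x s p) := cvg_at_right_filter (cc 0) BB.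
have segP r c (s : R) : 0 <= r <= c -> 0 < c -> 0 < s -> s < 1 -> 0 < seg r s c < c.
  by move=> /andP[r0 rc] c0 s0 s1; rewrite /seg; apply/andP; split; nra.
have [s [/= Bs s0 s1]] : exists s : R, [/\ B (seg t s q, seg x s p), 0 < s & s < 1].
  near (0 : R)^'+ => s; exists s; split; last by near: s; exact: nbhs_right_lt.
    by near: s; exact: H1.
  by near: s; exact: nbhs_right_gt.
by exists (seg t s q, seg x s p); split => //; split => /=; apply: segP => //; apply/andP.
Unshelve. all: by end_near. Qed.

Lemma continuous_clamp2_within (p q : R) (f : R * R -> R) : 0 < p -> 0 < q ->
  {within closure (Omega p q), continuous f} ->
  continuous (fun z => f (clamp2 q p z)).
Proof.
move=> p0 q0; apply: continuous_retract; first exact: continuous_clamp2.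
by move=> z; rewrite closure_Omega//; split; exact/clamp_itv/ltW.
Qed.

Lemma is_derive_primitive (h : R -> R) (l u x : R) : L1 `]l, u[ h -> l < x < u ->
  {for x, continuous h} -> is_derive x 1 (fun y => \int[mu]_(s in `]l, y[) h s) (h x).
Proof.
move=> hL /andP[x0 xu] cx; have [v xv vu] : exists2 v, x < v & v < u.
  by exists ((x + u) / 2); lra.
have hv : mu.-integrable [set` Interval (BRight l) (BRight v)] (EFin \o h).
  move: hL; apply: integrableS => // y; rewrite /= !in_itv/= => /andP[-> yv].
  exact: le_lt_trans yv vu.
have ax : (BRight l < BRight x :> itv_bound R)%O by rewrite bnd_simp.
have [d e] := @continuous_FTC1 _ h (BRight l) x v xv hv ax cx.
have vD : is_derive x 1 (fun y => \int[mu]_(s in [set` Interval (BRight l) (BRight y)]) h s) (h x).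
  by apply: (DeriveDef d); rewrite -derive1E; exact: e.
apply: (near_eq_is_derive _ vD).
near=> y; apply/esym; rewrite [LHS]Rintegral_itv_bndo_bndc//.
move: hL; apply: integrableS => // r; rewrite /= !in_itv/= => /andP[-> ry].
by apply: lt_trans ry _; near: y; exact: lt_nbhsl.
Unshelve. all: by end_near. Qed.

Lemma Rintegral_derivative (F f : R -> R) (c d : R) : c <= d ->
  (forall x, c <= x <= d -> is_derive x 1 F (f x)) ->
  (forall x, c <= x <= d -> {for x, continuous f}) ->
  \int[mu]_(x in `]c, d[) f x = F d - F c.
Proof.
rewrite le_eqVlt => /predU1P[<- _ _|cd Ff cf].
  by rewrite set_itvoo0 Rintegral_set0 subrr.
have {}cf : {within `[c, d], continuous f}.
  by apply: continuous_in_subspaceT => x; rewrite inE/= in_itv/=; exact: cf.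
have cF x : c <= x <= d -> {for x, continuous F}.
  by move=> hx; apply: differentiable_continuous; apply/derivable1_diffP; have [] := Ff x hx.
have fL : mu.-integrable `[c, d] (EFin \o f).
  by apply: continuous_compact_integrable => //; exact: segment_compact.
have E : \int[mu]_(x in `[c, d]) f x = F d - F c.
  rewrite /Rintegral (@continuous_FTC2 _ f F c d)//.
    split.
    - by move=> x /itvP hx; have [] := Ff x ltac:(by rewrite !hx).
    - by apply: cvg_at_right_filter; apply: cF; rewrite lexx ltW.
    - by apply: cvg_at_left_filter; apply: cF; rewrite lexx ltW.
  by move=> x /itvP hx; have := Ff x ltac:(by rewrite !hx) => ?; rewrite derive1E derive_val.
have subL (i : interval R) : [set` i] `<=` `[c, d]%classic -> mu.-integrable [set` i] (EFin \o f).
  by move=> h; move: fL; apply: integrableS.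
rewrite -E Rintegral_itv_obnd_cbnd; last by apply: subL; exact: subset_itv_oo_cc.
by rewrite Rintegral_itv_bndo_bndc//; apply: subL; exact: subset_itv_co_cc.
Qed.

End retraction.

(** * Weakly singular Volterra operators *)

Section volterra.
Context {R : realType}.
Notation mu := (@lebesgue_measure R).
Implicit Types (b t x : R) (F g h : R -> R).

(** The kernel [s |-> s`^(b - 1) * F s], weakly singular at the origin, acting
    on a function that may itself have the integrable singularity [s`^(b' - 1)]
    at the origin.  Both integral operators of the problem have this form: the
    Prabhakar integral in [t], and the exponential integral in [x]. *)
Definition volterra b F b' g t : R :=
  \int[mu]_(s in `]0, t[) (beta_weight b b' t s * (F (t - s) * g s)).

Lemma continuous_shift_rev F t : continuous F -> continuous (fun s => F (t - s)).
Proof.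
move=> cF; apply: (continuous_compose (g := F)) => //.
by apply: continuous_sub; [exact: continuous_cst_fun|exact: continuous_id_fun].
Qed.

Lemma L1_volterra b F b' g t : 0 < b -> 0 < b' -> continuous F -> continuous g ->
  L1 `]0, t[ (fun s => beta_weight b b' t s * (F (t - s) * g s)).
Proof.
move=> b0 b'0 cF cg.
apply: (L1_mul_continuous (w := beta_weight b b' t) (h := fun s => F (t - s) * g s)).
  exact: L1_beta_weight.
by apply: continuous_mul => //; exact: continuous_shift_rev.
Qed.

Lemma continuous_volterra (Z : topologicalType) b F b' (g : R * Z -> R) :
  0 < b -> 0 < b' -> 0 < b + b' - 1 -> continuous F -> continuous g ->
  continuous (fun p : R * Z => volterra b F b' (fun s => g (s, p.2)) p.1).
Proof.
move=> b0 b'0 bb cF cg.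
apply: (continuous_beta_convolution (H := fun w : (R * R) * Z => F w.1.1 * g (w.1.2, w.2))) => //.
have c11 : continuous (fun w : (R * R) * Z => w.1.1).
  by apply: (continuous_compose (f := fst)); exact: continuous_fst_fun.
have c12 : continuous (fun w : (R * R) * Z => w.1.2).
  by apply: (continuous_compose (f := fst)); [exact: continuous_fst_fun|exact: continuous_snd_fun].
apply: continuous_mul; first exact: (continuous_compose c11 cF).
have c3 : continuous (fun w : (R * R) * Z => (w.1.2, w.2)).
  exact: (continuous_pair c12 (@continuous_snd_fun _ _)).
exact: (continuous_compose c3 cg).
Qed.

Lemma volterra_le0 b F b' g t : t <= 0 -> volterra b F b' g t = 0.
Proof. by move=> t0; rewrite /volterra set_itv_ge ?Rintegral_set0// bnd_simp -leNgt. Qed.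

Lemma eq_volterra b F b' g h t : (forall s, 0 < s < t -> g s = h s) ->
  volterra b F b' g t = volterra b F b' h t.
Proof.
by move=> gh; apply: eq_Rintegral => s; rewrite inE/= in_itv/= => hs; rewrite gh.
Qed.

Lemma volterraD b F b' g h t : 0 < b -> 0 < b' ->
  continuous F -> continuous g -> continuous h ->
  volterra b F b' (fun s => g s + h s) t = volterra b F b' g t + volterra b F b' h t.
Proof.
move=> b0 b'0 cF cg ch.
have Lg := L1_volterra t b0 b'0 cF cg; have Lh := L1_volterra t b0 b'0 cF ch.
rewrite /volterra -(RintegralD _ Lg Lh)//; apply: eq_Rintegral => s _.
by rewrite -mulrDr -mulrDr.
Qed.

Lemma mulr_extract (u v c w : R) : u * (v * (c * w)) = c * (u * (v * w)).
Proof. by ring. Qed.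

Lemma volterraZ b F b' g c t : 0 < b -> 0 < b' -> continuous F -> continuous g ->
  volterra b F b' (fun s => c * g s) t = c * volterra b F b' g t.
Proof.
move=> b0 b'0 cF cg; have Lg := L1_volterra t b0 b'0 cF cg.
rewrite /volterra -(RintegralZl _ _ Lg)//; apply: eq_Rintegral => s _.
exact: mulr_extract.
Qed.

Lemma volterraB b F b' g h t : 0 < b -> 0 < b' ->
  continuous F -> continuous g -> continuous h ->
  volterra b F b' (fun s => g s - h s) t = volterra b F b' g t - volterra b F b' h t.
Proof.
move=> b0 b'0 cF cg ch.
have Lg := L1_volterra t b0 b'0 cF cg; have Lh := L1_volterra t b0 b'0 cF ch.
rewrite /volterra -(RintegralB _ Lg Lh)//; apply: eq_Rintegral => s _.
by rewrite -mulrBr -mulrBr.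
Qed.

(** In the norm weighted by [expR (m * t)] the operator is as small as wanted
    on a bounded interval, because the mass of the kernel concentrates at [s = t]
    when [m] is large. *)
Lemma volterra_weighted_le b F b' (T e : R) : 0 < b -> 0 < b' -> 0 < b + b' - 1 ->
  continuous F -> 0 <= T -> 0 < e ->
  exists2 m, 0 <= m & forall g C t, 0 <= t <= T -> 0 <= C -> continuous g ->
    (forall s, 0 < s < t -> `|g s| <= C * expR (m * s)) ->
    `|volterra b F b' g t| <= e * C * expR (m * t).
Proof.
move=> b0 b'0 bb cF T0 e0.
have [CF CF0 FC] := compact_continuous_bounded (@segment_compact R 0 T) cF.
have e1 : 0 < e / (CF + 1) by rewrite divr_gt0// ltr_wpDl.
have [m m0 hm] := beta_weight_exp_small b0 b'0 bb T0 e1.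
exists m => // g C t tT C0 cg gC.
have Lg := L1_volterra t b0 b'0 cF cg.
have cE : continuous (fun s : R => expR (- (m * (t - s)))).
  apply: (continuous_compose (g := expR) (f := fun s => - (m * (t - s)))).
    move=> s; apply: cvgN; apply: cvgM; first exact: cvg_cst.
    by apply: cvgB; [exact: cvg_cst|exact: cvg_id].
  exact: continuous_expR.
have Lw := L1_mul_continuous (L1_beta_weight t b0 b'0) cE.
have Lw' : L1 `]0, t[ (fun s => CF * C * expR (m * t) *
    (beta_weight b b' t s * expR (- (m * (t - s))))) by exact: L1Zl.
have mf : measurable_fun `]0, t[ (fun s => beta_weight b b' t s * (F (t - s) * g s)).
  by apply/measurable_EFinP; exact: measurable_int Lg.
apply: (le_trans (normr_Rintegral_le _ mf Lw' _)) => //.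
- move=> s /=; rewrite in_itv/= => hs; rewrite normrM (ger0_norm (beta_weight_ge0 _ _ _ _)).
  rewrite mulrCA; apply: ler_wpM2l; first exact: beta_weight_ge0.
  rewrite -[X in _ <= X]mulrA -expRD normrM -[X in _ <= X]mulrA; case/andP: hs => s0 st.
  apply: ler_pM => //; first by apply: FC; rewrite /= in_itv/=; case/andP: tT => ? ?; lra.
  have -> : m * t + - (m * (t - s)) = m * s by ring.
  by apply: gC; rewrite s0.
rewrite RintegralZl//; have h := hm t tT.
apply: le_trans (ler_wpM2l _ h) _; first by rewrite !mulr_ge0// expR_ge0.
have -> : CF * C * expR (m * t) * (e / (CF + 1)) = CF / (CF + 1) * (e * C * expR (m * t)).
  by move: (expR _) => X; ring.
have CF1 : 0 < CF + 1 by rewrite ltr_wpDl.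
rewrite ler_piMl//; first by rewrite !mulr_ge0// ?expR_ge0// ltW.
by rewrite ler_pdivrMr// mul1r lerDl.
Qed.

(** Integral operators acting on different variables commute. *)
Lemma volterra_swap b F b' b1 F1 b1' (g : R * R -> R) t x :
  0 < b -> 0 < b' -> 0 < b1 -> 0 < b1' ->
  continuous F -> continuous F1 -> continuous g ->
  volterra b F b' (fun s => volterra b1 F1 b1' (fun y => g (s, y)) x) t =
  volterra b1 F1 b1' (fun y => volterra b F b' (fun s => g (s, y)) t) x.
Proof.
move=> b0 b'0 b10 b1'0 cF cF1 cg.
have cFt := continuous_shift_rev (t := t) cF; have cFx := continuous_shift_rev (t := x) cF1.
have cfst : continuous (fun z : R * R => F (t - z.1)).
  exact: (continuous_compose (f := fst) (@continuous_fst_fun _ _) cFt).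
have csnd : continuous (fun z : R * R => F1 (x - z.2)).
  exact: (continuous_compose (f := snd) (@continuous_snd_fun _ _) cFx).
have cH := continuous_mul (continuous_mul cfst csnd) cg.
have := Rintegral_swap (L1_beta_weight t b0 b'0) (L1_beta_weight x b10 b1'0) cH.
rewrite /volterra /= => E.
transitivity (\int[mu]_(s in `]0, t[) (beta_weight b b' t s *
   \int[mu]_(y in `]0, x[) (beta_weight b1 b1' x y * (F (t - s) * F1 (x - y) * g (s, y))))).
  apply: eq_Rintegral => s _; congr (_ * _).
  have Ls := L1_volterra x b10 b1'0 cF1 (continuous_sectionr cg (x := s)).
  rewrite -(RintegralZl _ _ Ls)//; apply: eq_Rintegral => y _.
  by rewrite mulrCA -!mulrA.
rewrite E; apply: eq_Rintegral => y _; congr (_ * _).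
have Ls := L1_volterra t b0 b'0 cF (continuous_sectionl cg (y := y)).
rewrite -(RintegralZl _ _ Ls)//; apply: eq_Rintegral => s _.
by rewrite -mulrA; exact: mulr_extract.
Qed.

(** Likewise for an integral against a fixed weight, such as the nonlocal mean. *)
Lemma Rintegral_volterra_swap (w : R -> R) (c d : R) b F b' (g : R * R -> R) x :
  L1 `]c, d[ w -> 0 < b -> 0 < b' -> continuous F -> continuous g ->
  \int[mu]_(s in `]c, d[) (w s * volterra b F b' (fun y => g (s, y)) x) =
  volterra b F b' (fun y => \int[mu]_(s in `]c, d[) (w s * g (s, y))) x.
Proof.
move=> Lw b0 b'0 cF cg.
have cFx := continuous_shift_rev (t := x) cF.
have csnd : continuous (fun z : R * R => F (x - z.2)).
  exact: (continuous_compose (f := snd) (@continuous_snd_fun _ _) cFx).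
have := Rintegral_swap Lw (L1_beta_weight x b0 b'0) (continuous_mul csnd cg).
rewrite /volterra /= => ->; apply: eq_Rintegral => y _; congr (_ * _).
have Ly := L1_mul_continuous Lw (continuous_sectionl cg (y := y)).
by rewrite -(RintegralZl _ _ Ly)//; apply: eq_Rintegral => s _; rewrite mulrCA.
Qed.

(** The profile extends continuously to negative arguments the entire function
    that multiplies the singular power in the Prabhakar kernel. *)
Definition prabhakar_profile al b c d (r : R) : R := prabhakarE al b c (d * pos_powR al r).

Lemma continuous_prabhakar_profile al b c d : 0 < al -> 0 < b ->
  continuous (prabhakar_profile al b c d).
Proof.
move=> al0 b0; apply: (continuous_compose (g := prabhakarE al b c)
    (f := fun r => d * pos_powR al r)).
  apply: continuous_mul; first exact: continuous_cst_fun.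
  exact/continuous_pos_powR/ltW.
exact: continuous_prabhakarE.
Qed.

Lemma prabhakar_kernel_profile al b c d s : 0 <= s ->
  prabhakar_kernel al b c d s = s `^ (b - 1) * prabhakar_profile al b c d s.
Proof. by move=> s0; rewrite /prabhakar_profile pos_powRE. Qed.

Lemma convolution_volterra al b c d b' g t :
  convolution (prabhakar_kernel al b c d) (fun s => s `^ (b' - 1) * g s) t =
  volterra b (prabhakar_profile al b c d) b' g t.
Proof.
apply: eq_Rintegral => s; rewrite inE/= in_itv/= => /andP[s0 st].
by rewrite prabhakar_kernel_profile ?subr_ge0 ?(ltW st)// mulrACA.
Qed.

Lemma convolution_volterra1 al b c d g t :
  convolution (prabhakar_kernel al b c d) g t =
  volterra b (prabhakar_profile al b c d) 1 g t.
Proof.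
rewrite -convolution_volterra; congr (convolution _ _ _); apply/funext => s.
by rewrite subrr powRr0 mul1r.
Qed.

Lemma L1_prabhakar_convolution al b c d b' g t : 0 < al -> 0 < b -> 0 < b' -> continuous g ->
  L1 `]0, t[ (fun s => prabhakar_kernel al b c d (t - s) * (s `^ (b' - 1) * g s)).
Proof.
move=> al0 b0 b'0 cg.
have := L1_volterra t b0 b'0 (@continuous_prabhakar_profile al b c d al0 b0) cg.
apply: eq_integrable => // s; rewrite inE/= in_itv/= => /andP[s0 st].
by congr EFin; rewrite prabhakar_kernel_profile ?subr_ge0 ?(ltW st)// mulrACA.
Qed.

(** The solution operator of the initial value problem [y' = c * y + x`^(- eps) * g],
    [y 0 = 0]. *)
Definition exp_primitive c eps g x : R := volterra 1 (fun r => expR (c * r)) (1 - eps) g x.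

Lemma continuous_expRM (c : R) : continuous (fun r : R => expR (c * r)).
Proof.
apply: (continuous_compose (g := expR) (f := fun r => c * r)); last exact: continuous_expR.
by move=> r; apply: cvgM; [exact: cvg_cst|exact: cvg_id].
Qed.

Lemma is_derive_expRM (c x : R) : is_derive x 1 (fun y : R => expR (c * y)) (c * expR (c * x)).
Proof.
have dl : is_derive x 1 (fun y : R => c * y) c by apply: is_derive_eq; rewrite scaler1.
by rewrite mulrC; apply: (is_derive1_comp (f := expR) (g := fun y => c * y)).
Qed.

Lemma exp_primitiveE c eps g x : eps < 1 -> continuous g -> exp_primitive c eps g x =
  expR (c * x) * \int[mu]_(y in `]0, x[) (y `^ (- eps) * (expR (- (c * y)) * g y)).
Proof.
move=> eps1 cg.
have e10 : 0 < 1 - eps by rewrite subr_gt0.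
have cE : continuous (fun y : R => expR (- (c * y)) * g y).
  apply: continuous_mul => // y; rewrite (_ : (fun y => _) = fun y => expR (- c * y)).
    exact: continuous_expRM.
  by apply/funext => z; rewrite mulNr.
have Lx : L1 `]0, x[ (fun y => y `^ (- eps) * (expR (- (c * y)) * g y)).
  have [x0|x0] := leP x 0.
    by rewrite set_itv_ge ?bnd_simp -?leNgt//; exact: integrable_set0.
  have [+ _] := Rintegral_nonneg_power e10 (ltW x0).
  rewrite (_ : 1 - eps - 1 = - eps); last by ring.
  by move=> Lw; exact: (L1_mul_continuous Lw cE).
rewrite -(RintegralZl _ _ Lx)//; apply: eq_Rintegral => y _.
rewrite /beta_weight subrr powRr0 mul1r mulrBr expRD.
rewrite (_ : 1 - eps - 1 = - eps); last by ring.
by rewrite [RHS]mulrCA -mulrA.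
Qed.

Lemma continuous_powR_at (c x : R) : 0 < x -> {for x, continuous (fun y => y `^ c)}.
Proof.
move=> x0; apply: differentiable_continuous; apply/derivable1_diffP.
by have [] := is_derive1_powR c x0.
Qed.

(** Variation of constants: [exp_primitiveE] splits off the exponential factor. *)
Lemma is_derive_exp_primitive c eps g x : eps < 1 -> 0 < x -> continuous g ->
  is_derive x 1 (exp_primitive c eps g) (c * exp_primitive c eps g x + x `^ (- eps) * g x).
Proof.
move=> eps1 x0 cg.
pose h y := y `^ (- eps) * (expR (- (c * y)) * g y).
have cE : continuous (fun y : R => expR (- (c * y)) * g y).
  apply: continuous_mul => // y; rewrite (_ : (fun y => _) = fun y => expR (- c * y)).
    exact: continuous_expRM.
  by apply/funext => z; rewrite mulNr.
have hL : L1 `]0, x + 1[ h.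
  have e10 : 0 < 1 - eps by rewrite subr_gt0.
  have x10 : 0 <= x + 1 by rewrite addr_ge0// ltW.
  have [+ _] := Rintegral_nonneg_power e10 x10; rewrite (_ : 1 - eps - 1 = - eps); last by ring.
  by move=> Lw; exact: (L1_mul_continuous Lw cE).
have ch : {for x, continuous h}.
  apply: cvgM; last exact: cE.
  exact: continuous_powR_at.
have xx : 0 < x < x + 1 by apply/andP; split => //; rewrite ltrDl.
have dI := is_derive_primitive hL xx ch.
have D := is_deriveM (is_derive_expRM c x) dI.
have -> : exp_primitive c eps g = (fun y => expR (c * y)) * (fun y => \int[mu]_(s in `]0, y[) h s).
  by apply/funext => y; rewrite exp_primitiveE.
apply: is_derive_eq.
have E : ((fun y => expR (c * y)) * (fun y => \int[mu]_(s in `]0, y[) h s)) x =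
  expR (c * x) * \int[mu]_(s in `]0, x[) h s by [].
rewrite E /GRing.scale/= [RHS]addrC; congr (_ + _); last by rewrite mulrC -mulrA.
by rewrite /h mulrCA; congr (_ * _); rewrite mulrA -expRD subrr expR0 mul1r.
Qed.

End volterra.

(** * The resolvent function *)

Section resolvent_function.
Context {R : realType}.
Notation mu := (@lebesgue_measure R).
Variables (al b c d a : R).
Hypotheses (al0 : 0 < al) (b0 : 0 < b) (c0 : 0 < c).

Lemma Gamma_pochhammer (r : R) k : 0 < r -> Gamma (r + k%:R) = pochhammer r k * Gamma r.
Proof.
move=> r0; elim: k => [|k ih]; first by rewrite addr0 pochhammer0 mul1r.
have rk : 0 < r + k%:R by rewrite ltr_wpDr.
rewrite -natr1 addrA (GammaD1 rk) ih pochhammerS; move: (Gamma r) (pochhammer r k) => G P.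
by rewrite mulrA [_ * P]mulrC.
Qed.

Lemma Gamma_fact k : Gamma (k%:R + 1) = k`!%:R :> R.
Proof.
rewrite addrC Gamma_pochhammer// Gamma1 mulr1.
elim: k => [|k ih]; first by rewrite pochhammer0.
by rewrite pochhammerS ih factS natrM mulrC addrC natr1.
Qed.

Lemma cvg_prabhakarE (be ga z : R) : 0 < be ->
  series (fun m => pochhammer ga m / Gamma (al * m%:R + be) * (z ^+ m / (m`!)%:R)) @ \oo -->
    prabhakarE al be ga z.
Proof.
move=> be0; have := @decay_cvg _ _ z (prabhakar_coef_decay ga al0 be0).
rewrite /pseries (_ : (fun m => _) = (fun m : nat =>
  pochhammer ga m / Gamma (al * m%:R + be) * (z ^+ m / (m`!)%:R))) //.
apply/funext => m; rewrite /= /prabhakar_coef /rising_binomial -!mulrA; congr (_ * _).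
by rewrite mulrCA; congr (_ * _); exact: mulrC.
Qed.

Lemma E2_term_algebra (P G1 G2 G3 X Y F : R) : G1 != 0 -> G2 != 0 -> G3 != 0 -> F != 0 ->
  P * G1 * 1 / (G2 * 1 * G3) * (X / G1) * (Y / F) = G2^-1 * X * (P / G3 * (Y / F)).
Proof. by move=> h1 h2 h3 h4; field; rewrite h1 h2 h3 h4. Qed.

(** Summing over [k] first turns the double series into a series of Prabhakar functions. *)
Lemma E2_prabhakarE (x y : R) :
  E2 c 1 c 0 1 b al (b + 1) c c 1 1 x y =
  limn (series (fun m => (Gamma c)^-1 * x ^+ m *
     prabhakarE al (b * m.+1%:R + 1) (c * m.+1%:R) y)).
Proof.
rewrite /E2; congr (limn (series _)); apply/funext => m.
have bm : 0 < b * m.+1%:R + 1 by rewrite ltr_wpDl// mulr_ge0// ltW.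
have cm : 0 < c * m.+1%:R by rewrite mulr_gt0.
apply/cvg_lim => //.
rewrite (_ : series _ = fun n => (Gamma c)^-1 * x ^+ m * series (fun k =>
    pochhammer (c * m.+1%:R) k / Gamma (al * k%:R + (b * m.+1%:R + 1)) * (y ^+ k / (k`!)%:R)) n).
  by apply: cvgM; [exact: cvg_cst|exact: cvg_prabhakarE].
apply/funext => n; rewrite /series/= mulr_sumr; apply: eq_bigr => k _.
have -> : c * m%:R + 1 * k%:R + c = c * m.+1%:R + k%:R by rewrite -natr1; ring.
have -> : c * m%:R + c = c * m.+1%:R by rewrite -natr1; ring.
have -> : b * m%:R + al * k%:R + (b + 1) = al * k%:R + (b * m.+1%:R + 1) by rewrite -natr1; ring.
rewrite mul0r add0r Gamma1 mul1r Gamma_fact Gamma_pochhammer//.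
apply: E2_term_algebra; apply: lt0r_neq0; rewrite ?Gamma_gt0 ?ltr0n ?fact_gt0//.
by rewrite ltr_wpDl// mulr_ge0// ltW.
Qed.

(** The [n]-th convolution power of the Prabhakar kernel, applied to the constant
    [1]. *)
Definition prabhakar_iterate (n : nat) (t : R) : R :=
  prabhakar_kernel al (b * n%:R + 1) (c * n%:R) d t.

Lemma prabhakar_iterate0 t : prabhakar_iterate 0 t = 1.
Proof.
by rewrite /prabhakar_iterate /prabhakar_kernel !mulr0 add0r subrr powRr0 mul1r prabhakarE_zero.
Qed.

Lemma prabhakar_iterateS n t : 0 <= t ->
  convolution (prabhakar_kernel al b c d) (prabhakar_iterate n) t = prabhakar_iterate n.+1 t.
Proof.
have bn : 0 < b * n%:R + 1 by rewrite ltr_wpDl// mulr_ge0// ltW.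
rewrite le_eqVlt => /predU1P[<-|t0].
  rewrite convolution_le0// /prabhakar_iterate /prabhakar_kernel powR0 ?mul0r//.
  by rewrite addrK mulf_neq0// gt_eqF.
have [_ ->] := prabhakar_convolution c d (c * n%:R) al0 b0 bn t0.
rewrite /prabhakar_iterate; congr (prabhakar_kernel _ _ _ _ _).
  by rewrite -natr1; ring.
by rewrite -natr1; ring.
Qed.

Let F := prabhakar_profile al b c d.

(** The Neumann series of the constant [1] has the terms
    [a ^+ n * prabhakar_iterate n], and by [E2_prabhakarE] their sum is the
    bivariate series. The equation is stated with the clamped argument, so that [S]
    is determined on the whole line. *)
Lemma resolvent_function (q : R) : 0 <= q -> a != 0 ->
  exists S : R -> R, [/\ continuous S,
    forall t, S t = 1 + a * volterra b F 1 S (clamp 0 q t) &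
    forall t, 0 <= t <= q -> S t = 1 + a * Gamma c * t `^ b *
      E2 c 1 c 0 1 b al (b + 1) c c 1 1 (a * t `^ b) (d * t `^ al)].
Proof.
move=> q0 a0.
have cF : continuous F by exact: continuous_prabhakar_profile.
have bb : 0 < b + 1 - 1 by rewrite addrK.
pose L (g : R -> R) t := a * volterra b F 1 g (clamp 0 q t).
have na : 0 < `|a| by rewrite normr_gt0.
have e0 : 0 < (2 * `|a|)^-1 by rewrite invr_gt0 mulr_gt0.
have [m m0 hm] := volterra_weighted_le b0 ltr01 bb cF q0 e0.
pose W t := expR (m * clamp 0 q t).
have W0 t : 0 <= W t <= expR (m * q).
  rewrite expR_ge0/= /W ler_expR ler_wpM2l//.
  by have /andP[] := clamp_itv t q0.
have LW : half_contraction W L.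
  split.
  - move=> g cg; apply: continuous_mul; first exact: continuous_cst_fun.
    apply: (continuous_compose (f := clamp 0 q) (g := volterra b F 1 g)).
      exact: continuous_clamp.
    have cg2 : continuous (fun z : R * R => g z.1).
      exact: (continuous_compose (@continuous_fst_fun _ _) cg).
    exact: (continuous_sectionl (y := 0) (continuous_volterra b0 ltr01 bb cF cg2)).
  - by move=> g h t cg ch; rewrite /L volterraB// mulrBr.
  - move=> g C C0 cg gC t; rewrite /L normrM.
    have -> : C / 2 * W t = `|a| * ((2 * `|a|)^-1 * C * W t).
      by rewrite invfM; field; rewrite gt_eqF.
    apply: ler_wpM2l => //; apply: hm => //; first exact: clamp_itv.
    move=> s /andP[s0 st]; have := gC s; rewrite /W clamp_id// (ltW s0)/=.
    by apply: le_trans (ltW st) _; have /andP[] := clamp_itv t q0.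
have c1 : continuous (fun _ : R => 1 : R) by exact: continuous_cst_fun.
have [|S [cS SE Slim]] := neumann_series W0 LW ler01 c1.
  by move=> t; rewrite normr1 mul1r -[leLHS]expR0 ler_expR mulr_ge0//; have /andP[] := clamp_itv t q0.
exists S; split => // t tq.
have iterE n s : 0 <= s <= q -> iter n L (fun=> 1) s = a ^+ n * prabhakar_iterate n s.
  elim: n s => [|n ih] s sq; first by rewrite /= prabhakar_iterate0 mulr1.
  have /andP[s0 sq'] := sq.
  rewrite iterS /L clamp_id// -convolution_volterra1 exprS -mulrA; congr (_ * _).
  rewrite -prabhakar_iterateS//.
  transitivity (convolution (prabhakar_kernel al b c d) (fun r => a ^+ n * prabhakar_iterate n r) s).
    apply: eq_Rintegral => r; rewrite inE/= in_itv/= => /andP[r0 rs].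
    by rewrite ih// (ltW r0)/= (le_trans (ltW rs)).
  have bn : 0 < b * n%:R + 1 by rewrite ltr_wpDl// mulr_ge0// ltW.
  move: s0; rewrite le_eqVlt => /predU1P[<-|s0]; first by rewrite !convolution_le0// mulr0.
  have [Lc _] := prabhakar_convolution c d (c * n%:R) al0 b0 bn s0.
  rewrite /convolution -(RintegralZl _ _ Lc)//; apply: eq_Rintegral => r _.
  by rewrite mulrCA.
have /andP[t0 _] := tq.
move: t0; rewrite le_eqVlt => /predU1P[t0|t0].
  by rewrite -t0 powR0 ?gt_eqF// mulr0 mul0r SE /L clamp_id ?lexx// volterra_le0// mulr0.
pose k := a * Gamma c * t `^ b.
have k0 : k != 0 by rewrite !mulf_neq0// gt_eqF// ?Gamma_gt0// powR_gt0.
rewrite -/k E2_prabhakarE.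
suff -> : limn (series (fun m : nat => (Gamma c)^-1 * (a * t `^ b) ^+ m *
    prabhakarE al (b * m.+1%:R + 1) (c * m.+1%:R) (d * t `^ al))) = k^-1 * (S t - 1).
  by rewrite mulVKf// addrC subrK.
apply/cvg_lim => //.
rewrite (_ : series _ = fun n => k^-1 * (series (fun n => iter n L (fun=> 1) t) n.+1 - 1)).
  apply: cvgM; first exact: cvg_cst.
  apply: cvgB; last exact: cvg_cst.
  by rewrite (cvg_shiftS (series (fun n => iter n L (fun=> 1) t))); exact: Slim.
apply/funext => n; rewrite /series/= big_nat_recl//= addrC addKr mulr_sumr.
apply: eq_bigr => i _; rewrite -iterS iterE// /prabhakar_iterate /prabhakar_kernel addrK.
rewrite exprMn.
have -> : (t `^ b) ^+ i = t `^ (b * i%:R) by rewrite powRrM powR_mulrn// powR_ge0.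
have -> : t `^ (b * i.+1%:R) = t `^ b * t `^ (b * i%:R).
  by rewrite -(powR_add b (b * i%:R) t0) -natr1; congr (_ `^ _); ring.
rewrite exprS /k; move: (prabhakarE _ _ _ _) => P.
have h1 : Gamma c != 0 by rewrite gt_eqF// Gamma_gt0.
have h2 : t `^ b != 0 by rewrite gt_eqF// powR_gt0.
by move: (Gamma c) (t `^ b) (t `^ (b * i%:R)) (a ^+ i) h1 h2 => G T1 T2 A h1 h2; field; rewrite a0 h1 h2.
Qed.

End resolvent_function.

(** * Convolution with an integrable kernel *)

Section caputo.
Context {R : realType}.
Notation mu := (@lebesgue_measure R).

Lemma uniform_continuity_itv (g : R -> R) (lo hi e : R) : continuous g -> 0 < e ->
  exists2 h : R, 0 < h & forall s t : R, lo <= t <= hi -> `|s - t| <= h -> `|g s - g t| <= e.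
Proof.
move=> cg e0.
have /compact_near_coveringP cK := @segment_compact R lo hi.
have H : \forall h \near (0 : R)^'+, `[lo, hi]%classic `<=`
    (fun t => forall s, `|s - t| <= h -> `|g s - g t| <= e).
  apply: (cK _ _ (fun (h : R) t => forall s, `|s - t| <= h -> `|g s - g t| <= e)) => t0 _.
  have e20 : 0 < e / 2 by rewrite divr_gt0.
  move/cvgrPdist_le : (cg t0) => /(_ _ e20) /nbhs_ballP[d /= d0 hd].
  have d20 : 0 < d / 2 by rewrite divr_gt0.
  exists ([set t | `|t0 - t| < d / 2], [set h | h < d / 2]) => /=.
    split; last exact: nbhs_right_lt.
    by apply/nbhs_ballP; exists (d / 2).
  move=> [t h] /= [ht hh] s hs.
  have h1 : `|g t0 - g t| <= e / 2 by apply: hd; rewrite /ball/=; lra.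
  have h2 : `|g t0 - g s| <= e / 2.
    apply: hd; rewrite /ball/= (_ : t0 - s = (t0 - t) - (s - t)); last by ring.
    by apply: le_lt_trans (ler_normB _ _) _; lra.
  rewrite (_ : g s - g t = (g t0 - g t) - (g t0 - g s)); last by ring.
  by apply: le_trans (ler_normB _ _) _; lra.
near (0 : R)^'+ => h.
have h0 : 0 < h by near: h; exact: nbhs_right_gt.
exists h => // s t tlh; apply: (near H h) => //=; by rewrite in_itv.
Unshelve. all: by end_near. Qed.

Lemma continuous_at_near_eq (T : topologicalType) (f g : T -> R) (x : T) :
  {for x, continuous g} -> (\forall y \near x, g y = f y) -> {for x, continuous f}.
Proof.
move=> cg gf; rewrite /prop_for /continuous_at -(nbhs_singleton gf).
by apply: cvg_trans cg; exact: near_eq_cvg.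
Qed.

Lemma continuous_within_pointwise (A : set R) (f : R -> R) : open A ->
  (forall x, A x -> {for x, continuous f}) -> {within A, continuous f}.
Proof.
by move=> oA cf; rewrite continuous_open_subspace// => x; rewrite inE; exact: cf.
Qed.

Section kernel.
Variable k : R -> R.
Hypothesis mk : measurable_fun setT k.
Hypothesis Lk : forall t, 0 <= t -> L1 `]0, t[ k.

Lemma L1_kernel_reflect t : L1 `]0, t[ (fun s => k (t - s)).
Proof.
have [t0|t0] := leP 0 t; first exact/L1_reflect/Lk.
by rewrite set_itv_ge ?bnd_simp -?leNgt ?(ltW t0)//; exact: integrable_set0.
Qed.

Lemma L1_kernel_mul g t : continuous g -> L1 `]0, t[ (fun s => k (t - s) * g s).
Proof. by move=> cg; apply: L1_mul_continuous => //; exact: L1_kernel_reflect. Qed.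

Lemma kernel_abs_bound tau t : 0 < tau <= t ->
  (\int[mu]_(s in `]0%R, tau[) `|k (tau - s)|%:E <= (\int[mu]_(s in `]0, t[) `|k s|)%:E)%E /\
  (\int[mu]_(s in `]0%R, tau[) `|k s|%:E <= (\int[mu]_(s in `]0, t[) `|k s|)%:E)%E.
Proof.
move=> /andP[tau0 taut].
have Lt : L1 `]0, t[ (fun s => `|k s|).
  by apply: integrable_norm => //; apply: Lk; exact: le_trans (ltW tau0) taut.
have Ltau : L1 `]0, tau[ (fun s => `|k s|).
  by apply: integrable_norm => //; apply: Lk; exact: ltW.
have le_t : \int[mu]_(s in `]0, tau[) `|k s| <= \int[mu]_(s in `]0, t[) `|k s|.
  rewrite (Rintegral_itvoo_split (b := tau) _ Lt); last by rewrite (ltW tau0).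
  by rewrite lerDl; apply: Rintegral_ge0 => s _.
have E (f : R -> R) : L1 `]0, tau[ f ->
  (\int[mu]_(s in `]0%R, tau[) (f s)%:E = (\int[mu]_(s in `]0, tau[) f s)%:E)%E.
  by move=> Lf; rewrite /Rintegral fineK//; exact: (integrable_fin_num _ Lf).
have Er : \int[mu]_(s in `]0, tau[) `|k (tau - s)| = \int[mu]_(s in `]0, tau[) `|k s|.
  by rewrite -(Rintegral_reflect Ltau).
split.
  rewrite (E (fun s => `|k (tau - s)|)); last exact: (L1_reflect Ltau).
  by rewrite Er lee_fin.
by rewrite (E (fun s => `|k s|))// lee_fin.
Qed.

Lemma convolution_one (g : R -> R) t : convolution (fun=> 1) g t = \int[mu]_(s in `]0, t[) g s.
Proof. by apply: eq_Rintegral => s _; rewrite mul1r. Qed.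

(** Integration is the convolution with [1]; associativity and commutativity move it
    across [k]. *)
Lemma convolution_primitive g t : 0 < t -> measurable_fun setT g -> L1 `]0, t[ g ->
  L1 `]0, t[ (convolution k g) /\
  convolution k (fun s => \int[mu]_(r in `]0, s[) g r) t =
    \int[mu]_(s in `]0, t[) convolution k g s.
Proof.
move=> t0 mg Lg.
have m1 : measurable_fun setT (fun _ : R => 1 : R) by exact: measurable_cst.
have [] := @convolution_assoc _ k (fun=> 1) g t (\int[mu]_(s in `]0, t[) `|k s|) t0 mk m1 mg Lg.
  move=> tau htau; have [h _] := kernel_abs_bound htau.
  by under eq_integral do rewrite mulr1.
move=> _ _ E1.
have [] := @convolution_assoc _ (fun=> 1) k g t (\int[mu]_(s in `]0, t[) `|k s|) t0 m1 mk mg Lg.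
  move=> tau htau; have [_ h] := kernel_abs_bound htau.
  by under eq_integral do rewrite mul1r.
move=> L2 _ E2.
have comm r : convolution k (fun=> 1) r = convolution (fun=> 1) k r.
  apply: convolution_comm; have := L1_kernel_reflect r.
  by apply: eq_integrable => // s _ /=; rewrite mulr1.
split; first by move: L2; apply: eq_integrable => // s _ /=; rewrite mul1r.
rewrite -(convolution_one (convolution k g)) E2.
transitivity (convolution k (convolution (fun=> 1) g) t).
  by apply: eq_Rintegral => s _; rewrite convolution_one.
by rewrite E1; apply: eq_Rintegral => s _; rewrite comm.
Qed.

(** The fundamental theorem of calculus holds on [`]r, s[] with [0 < r]; the
    integrability of the derivative and the continuity of [z] at [0] allow [r] to
    tend to [0]. *)
Lemma classical_primitive (q s : R) (z : R -> R) : classical_domain q z -> 0 <= s < q ->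
  \int[mu]_(r in `]0, s[) derive1 z r = z s - z 0.
Proof.
move=> [[cz dz cdz] Lz] /andP[]; rewrite le_eqVlt => /predU1P[<- _|s0 sq].
  by rewrite set_itvoo0 Rintegral_set0 subrr.
pose g := derive1 z \_ (`]0, q[%classic).
have Lg : mu.-integrable `[0, s] (EFin \o g).
  by have := L1_restrict Lz; apply: integrableS.
have gE r : 0 < r < q -> g r = derive1 z r.
  by move=> hr; rewrite /g patchE mem_setE in_itv/= hr.
have cd r : 0 < r < q -> {for r, continuous (derive1 z)}.
  move=> hr; move: cdz; rewrite continuous_open_subspace; last exact: interval_open.
  by apply; rewrite inE/= in_itv.
have E r : 0 < r < s -> \int[mu]_(x in `[0, r]) g x =
    \int[mu]_(x in `]0, s[) derive1 z x - (z s - z r).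
  move=> /andP[r0 rs].
  have Ls : L1 `]0, s[ (derive1 z).
    by move: Lz; apply: integrableS => // x /=; rewrite !in_itv/= => /andP[-> /lt_trans->].
  rewrite (Rintegral_itvoo_split (b := r) _ Ls); last by rewrite !ltW.
  have -> : \int[mu]_(x in `]r, s[) derive1 z x = z s - z r.
    apply: Rintegral_derivative; first exact: ltW.
      move=> x /andP[rx xs]; have hx : 0 < x < q by rewrite (lt_le_trans r0)//= (le_lt_trans xs).
      by rewrite derive1E; apply: DeriveDef => //; exact: dz.
    move=> x /andP[rx xs].
    by apply: cd; rewrite (lt_le_trans r0)//= (le_lt_trans xs).
  rewrite addrK -Rintegral_itv_obnd_cbnd; last first.
    move: Lg; apply: integrableS => // x /=; rewrite !in_itv/= => /andP[x0 xr].
    by rewrite (ltW x0) (le_trans xr (ltW rs)).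
  rewrite -Rintegral_itv_bndo_bndc; last first.
    move: Lg; apply: integrableS => // x /=; rewrite !in_itv/= => /andP[x0 xr].
    by rewrite (ltW x0) ltW// (lt_trans xr rs).
  apply: eq_Rintegral => x; rewrite inE/= in_itv/= => /andP[x0 xr].
  by rewrite gE// x0 (lt_trans xr)// (lt_trans rs).
have c1 := parameterized_integral_cvg_left s0 Lg.
have {}c1 := cvg_at_right_filter c1.
have c2 : \int[mu]_(x in `]0, s[) derive1 z x - (z s - z r) @[r --> 0^'+] -->
    \int[mu]_(x in `]0, s[) derive1 z x - (z s - z 0).
  apply: cvgB; first exact: cvg_cst.
  apply: cvgB; first exact: cvg_cst.
  by have [_ + _] := (continuous_within_itvP _ (lt_trans s0 sq)).1 cz.
have c3 : \int[mu]_(x in `[0, r]) g x @[r --> 0^'+] -->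
    \int[mu]_(x in `]0, s[) derive1 z x - (z s - z 0).
  apply: cvg_trans c2; apply: near_eq_cvg; near=> r; apply/esym/E.
  by apply/andP; split; near: r; [exact: nbhs_right_gt|exact: nbhs_right_lt].
have e := cvg_unique (@Rhausdorff R) c1 c3.
by apply/eqP; rewrite -subr_eq0 -e.
Unshelve. all: by end_near. Qed.

End kernel.

End caputo.

(** * The Caputo-Prabhakar derivative as a density *)

Section caputo_characterization.
Context {R : realType}.
Notation mu := (@lebesgue_measure R).
Variables (al be ga de q : R).
Hypotheses (al0 : 0 < al) (be_itv : 0 < be < 1) (q0 : 0 < q).

Definition caputo_kernel : R -> R := prabhakar_kernel al (1 - be) (- ga) de.

Lemma order_compl_gt0 : 0 < 1 - be. Proof. by case/andP: be_itv => _; rewrite subr_gt0. Qed.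

Lemma measurable_caputo_kernel : measurable_fun setT caputo_kernel.
Proof. exact: measurable_prabhakar_kernel al0 order_compl_gt0. Qed.

Lemma L1_caputo_kernel t : 0 <= t -> L1 `]0, t[ caputo_kernel.
Proof. exact: L1_prabhakar_kernel al0 order_compl_gt0. Qed.

Lemma caputo_prabhakarE z t :
  caputo_prabhakar 1 al be ga de z t = convolution caputo_kernel (derive1 z) t.
Proof. by rewrite /caputo_prabhakar /prabhakarI /convolution /caputo_kernel /prabhakar_kernel. Qed.

(** The fractional integral whose derivative is the Caputo-Prabhakar derivative: the
    kernel is convolved with [y - y 0] in place of [y'], and this makes sense for
    all continuous [y]. *)
Definition caputo_integral (y : R -> R) (t : R) : R :=
  convolution caputo_kernel (fun s => y s - y 0) t.

Lemma eq_caputo_integral y z t : (forall s, 0 <= s <= t -> y s = z s) ->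
  caputo_integral y t = caputo_integral z t.
Proof.
move=> yz; have [t0|t0] := leP t 0; first by rewrite /caputo_integral !convolution_le0.
apply: eq_Rintegral => s; rewrite inE/= in_itv/= => /andP[s0 st].
by rewrite !yz// ?(ltW s0) ?(ltW st) ?lexx ?(ltW t0).
Qed.

(** As [z - z 0] is the primitive of [z'], [convolution_primitive] applies. *)
Lemma caputo_classical_increment (z : R -> R) (c t : R) :
  classical_domain q z -> 0 < c <= t -> t < q ->
  L1 `]c, t[ (caputo_prabhakar 1 al be ga de z) /\
  \int[mu]_(s in `]c, t[) caputo_prabhakar 1 al be ga de z s =
    caputo_integral z t - caputo_integral z c.
Proof.
move=> dz /andP[c0 ct] tq; have t0 : 0 < t := lt_le_trans c0 ct.
pose g := derive1 z \_ (`]0, q[%classic).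
have [[cz1 cz2 cz3] Lz] := dz.
have Lg := L1_restrict Lz.
have mg : measurable_fun setT g by apply/measurable_EFinP; exact: measurable_int Lg.
have gE r : 0 < r < q -> g r = derive1 z r.
  by move=> hr; rewrite /g patchE mem_setE in_itv/= hr.
have main r : 0 < r < q -> L1 `]0, r[ (convolution caputo_kernel g) /\
    \int[mu]_(s in `]0, r[) convolution caputo_kernel g s = caputo_integral z r.
  move=> /andP[r0 rq].
  have Lr : L1 `]0, r[ g by move: Lg; apply: integrableS.
  have [L E] := convolution_primitive measurable_caputo_kernel L1_caputo_kernel r0 mg Lr.
  split => //; rewrite -E; apply: eq_Rintegral => s; rewrite inE/= in_itv/= => /andP[s0 sr].
  congr (_ * _); rewrite -(classical_primitive dz) ?(ltW s0) ?(lt_trans sr)//.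
  apply: eq_Rintegral => x; rewrite inE/= in_itv/= => /andP[x0 xs].
  by rewrite gE// x0 (lt_trans xs)// (lt_trans sr).
have E s : 0 < s < q -> caputo_prabhakar 1 al be ga de z s = convolution caputo_kernel g s.
  move=> /andP[s0 sq]; rewrite caputo_prabhakarE; apply: eq_Rintegral => r.
  rewrite inE/= in_itv/= => /andP[r0 rs]; by rewrite gE// r0 (lt_trans rs).
have cq : 0 < c < q by rewrite c0 (le_lt_trans ct).
have tq' : 0 < t < q by rewrite t0.
have [Lt Et] := main _ tq'; have [Lc Ec] := main _ cq.
have Lct : L1 `]c, t[ (convolution caputo_kernel g).
  move: Lt; apply: integrableS => // x /=; rewrite !in_itv/= => /andP[cx ->].
  by rewrite (lt_trans c0 cx).
split.
  move: Lct; apply: eq_integrable => // s; rewrite inE/= in_itv/= => /andP[cs st].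
  by rewrite E// (lt_trans c0 cs) (lt_trans st).
transitivity (\int[mu]_(s in `]c, t[) convolution caputo_kernel g s).
  apply: eq_Rintegral => s; rewrite inE/= in_itv/= => /andP[cs st].
  by rewrite E// (lt_trans c0 cs) (lt_trans st).
rewrite -Et -Ec (Rintegral_itvoo_split (b := c) _ Lt); last by rewrite (ltW c0).
by rewrite addrC addKr.
Qed.

Lemma L1_pointwise (v : R -> R) (c t : R) :
  (forall s, c <= s <= t -> {for s, continuous v}) -> L1 `]c, t[ v.
Proof.
have [ct cv|ct _] := leP c t; last first.
  by rewrite set_itv_ge ?bnd_simp -?leNgt ?(ltW ct)//; exact: integrable_set0.
have cvc := continuous_clamp_pointwise ct cv.
have := L1_continuous_oo c t cvc.
apply: eq_integrable => // s; rewrite inE/= in_itv/= => /andP[cs st].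
by rewrite /= clamp_id// !ltW.
Qed.

Lemma increment_estimate (A B A' B' I E1 E2 : R) : `|A - A'| <= E1 -> `|B - B'| <= E1 ->
  `|A' - B' - I| <= E2 -> `|A - B - I| <= 2 * E1 + E2.
Proof.
by rewrite !ler_norml => /andP[? ?] /andP[? ?] /andP[? ?]; apply/andP; split; lra.
Qed.

(** Passing to the limit in the classical identity: the fractional integral of
    order [1 - be] is continuous for uniform convergence. *)
Lemma caputo_increment (y v : R -> R) (c t : R) :
  is_caputo_prabhakar q al be ga de y v -> continuous y ->
  (forall s, 0 < s < q -> {for s, continuous v}) -> 0 < c <= t -> t < q ->
  caputo_integral y t - caputo_integral y c = \int[mu]_(s in `]c, t[) v s.
Proof.
move=> yv cy cv ct tq; have /andP[c0 ct'] := ct.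
have t0 : 0 < t := lt_le_trans c0 ct'.
have Lv : L1 `]c, t[ v.
  apply: L1_pointwise => s /andP[cs st]; apply: cv.
  by rewrite (lt_le_trans c0)//= (le_lt_trans st).
pose Ik := \int[mu]_(s in `]0, q[) `|caputo_kernel s|.
have key e : 0 < e -> `|caputo_integral y t - caputo_integral y c -
    \int[mu]_(s in `]c, t[) v s| <= (4 * Ik + q) * e.
  move=> e0; have [z [dz zy zv]] := yv c t e c0 tq e0.
  have [Lz Ez] := caputo_classical_increment dz ct tq.
  have cz : continuous (fun s => z (clamp 0 q s)).
    by case: dz => -[cz _ _] _; apply: continuous_clamp_within => //; exact: ltW.
  have diff r : 0 < r < q -> `|caputo_integral y r - caputo_integral z r| <= 2 * e * Ik.
    move=> /andP[r0 rq].
    have cd : continuous (fun s => (y s - y 0) - (z (clamp 0 q s) - z 0)).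
      by apply: continuous_sub; apply: continuous_sub => //; exact: continuous_cst_fun.
    have Ld := L1_kernel_mul L1_caputo_kernel r cd.
    have Lk : L1 `]0, r[ (fun s => `|caputo_kernel s|).
      by apply: integrable_norm => //; exact: L1_caputo_kernel (ltW r0).
    have LR := L1_reflect Lk.
    have Lkr : L1 `]0, r[ (fun s => 2 * e * `|caputo_kernel (r - s)|) by exact: L1Zl.
    have -> : caputo_integral y r - caputo_integral z r =
        \int[mu]_(s in `]0, r[) (caputo_kernel (r - s) *
           ((y s - y 0) - (z (clamp 0 q s) - z 0))).
      have cy' : continuous (fun s => y s - y 0) by apply: continuous_sub => //; exact: continuous_cst_fun.
      have cz' : continuous (fun s => z (clamp 0 q s) - z 0).
        by apply: continuous_sub => //; exact: continuous_cst_fun.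
      have -> : caputo_integral z r =
          \int[mu]_(s in `]0, r[) (caputo_kernel (r - s) * (z (clamp 0 q s) - z 0)).
        apply: eq_Rintegral => s; rewrite inE/= in_itv/= => /andP[s0 sr].
        by rewrite clamp_id// (ltW s0) ltW// (lt_trans sr).
      rewrite -(RintegralB _ (L1_kernel_mul L1_caputo_kernel r cy') (L1_kernel_mul L1_caputo_kernel r cz'))//.
      by apply: eq_Rintegral => s _; rewrite -mulrBr.
    have md : measurable_fun `]0, r[ (fun s => caputo_kernel (r - s) *
           ((y s - y 0) - (z (clamp 0 q s) - z 0))).
      by apply/measurable_EFinP; exact: measurable_int Ld.
    apply: (le_trans (normr_Rintegral_le _ md Lkr _)) => //.
      move=> s /=; rewrite in_itv/= => /andP[s0 sr]; rewrite normrM mulrC ler_wpM2r//.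
      have sq : s <= q by rewrite ltW// (lt_trans sr).
      have h1 : `|z s - y s| <= e by apply: zy; rewrite (ltW s0).
      have h2 : `|z 0 - y 0| <= e by apply: zy; rewrite lexx ltW.
      rewrite clamp_id ?(ltW s0)//.
      rewrite (_ : _ - _ = (z 0 - y 0) - (z s - y s)); last by ring.
      apply: le_trans (ler_normB _ _) _.
      by apply: le_trans (lerD h2 h1) _; rewrite mulr_natl mulr2n.
    have Lq : L1 `]0, q[ (fun s => `|caputo_kernel s|).
      by apply: integrable_norm => //; exact: L1_caputo_kernel (ltW q0).
    rewrite (RintegralZl _ _ LR); last exact: measurable_itv.
    rewrite -(Rintegral_reflect Lk) ler_wpM2l ?mulr_ge0 ?(ltW e0)//.
    rewrite /Ik (Rintegral_itvoo_split (b := r) _ Lq); last by rewrite !ltW.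
    by rewrite lerDl; apply: Rintegral_ge0.
  have dv : `|\int[mu]_(s in `]c, t[) caputo_prabhakar 1 al be ga de z s -
      \int[mu]_(s in `]c, t[) v s| <= q * e.
    have Lq : L1 `]c, t[ (fun _ : R => e) by apply: L1_continuous_oo; exact: continuous_cst_fun.
    have Lb := L1B (measurable_itv _) Lz Lv.
    rewrite -(RintegralB _ Lz Lv)//.
    have md : measurable_fun `]c, t[ (fun s => caputo_prabhakar 1 al be ga de z s - v s).
      by apply/measurable_EFinP; exact: measurable_int Lb.
    apply: (le_trans (normr_Rintegral_le _ md Lq _)) => //.
      by move=> s /=; rewrite in_itv/= => /andP[cs st]; apply: zv; rewrite !ltW.
    rewrite Rintegral_cst// mulrC ler_wpM2r ?(ltW e0)//.
    rewrite /= lebesgue_measure_itv/= lte_fin; case: ifPn => //= _; last exact: ltW.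
    by rewrite lerBlDr (le_trans (ltW tq))// lerDl ltW.
  have h1 := diff t ltac:(by rewrite t0).
  have h2 := diff c ltac:(by rewrite c0 (le_lt_trans ct')).
  rewrite Ez in dv.
  apply: le_trans (increment_estimate h1 h2 dv) _.
  have E (I : R) : 2 * (2 * e * I) + q * e = (4 * I + q) * e by ring.
  by rewrite E.
apply/eqP; rewrite -subr_eq0 -normr_le0.
apply: (@le0_of_half_powers _ _ (4 * Ik + q)) => n.
by apply: key; rewrite exprn_gt0// invr_gt0.
Qed.

End caputo_characterization.

(** * Steklov averages *)

Section caputo_steklov.
Context {R : realType}.
Notation mu := (@lebesgue_measure R).
Variables (al be ga de q : R).
Hypotheses (al0 : 0 < al) (be_itv : 0 < be < 1) (q0 : 0 < q).
Notation k := (caputo_kernel al be ga de).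
Notation G := (caputo_integral al be ga de).

Lemma dist_left_le (s t h e : R) : t - h < s -> s < t -> h <= e -> `|s - t| <= e.
Proof. by move=> ? ? ?; rewrite ler_norml; apply/andP; split; lra. Qed.

Lemma Rintegral_mean_le (g : R -> R) (l h e r : R) : 0 < h ->
  L1 `]l, (l + h)[ g -> (forall s, l < s < l + h -> `|g s - r| <= e) ->
  `|h^-1 * \int[mu]_(s in `]l, (l + h)[) g s - r| <= e.
Proof.
move=> h0 Lg ge.
have lh : l < l + h by rewrite ltrDl.
have muI : fine (mu `]l, (l + h)[%classic) = h.
  by rewrite lebesgue_measure_itv/= lte_fin lh /= addrAC subrr add0r.
have Lr (c : R) : L1 `]l, (l + h)[ (fun=> c) by apply: L1_continuous_oo; exact: continuous_cst_fun.
have Er (c : R) : \int[mu]_(s in `]l, (l + h)[) c = c * h by rewrite Rintegral_cst// muI.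
have e0 : 0 <= e.
  apply: le_trans (ge (l + h / 2) _); first exact: normr_ge0.
  by rewrite ltrDl divr_gt0//= ltrD2l gtr_pMr// invf_lt1// ltr1n.
have -> : h^-1 * \int[mu]_(s in `]l, (l + h)[) g s - r =
    h^-1 * \int[mu]_(s in `]l, (l + h)[) (g s - r).
  rewrite (RintegralB _ Lg (Lr r)); last exact: measurable_itv.
  by rewrite Er mulrBr [r * h]mulrC mulKf// gt_eqF.
rewrite normrM ger0_norm ?invr_ge0 ?(ltW h0)// mulrC ler_pdivrMr// -Er.
have Lb := L1B (measurable_itv _) Lg (Lr r).
have mb : measurable_fun `]l, (l + h)[ (fun s => g s - r).
  by apply/measurable_EFinP; exact: measurable_int Lb.
by apply: (le_trans (normr_Rintegral_le _ mb (Lr e) _)) => // s /=; rewrite in_itv/=; exact: ge.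
Qed.

(** Convolutions commute with delays when the function vanishes before time [0]. *)
Lemma caputo_integral_delay (y : R -> R) (h t : R) : continuous y -> 0 < h <= t ->
  (forall s, s <= 0 -> y s = y 0) ->
  convolution k (fun s => y (s - h) - y 0) t = G y (t - h).
Proof.
move=> cy /andP[h0 ht] yneg.
have cd : continuous (fun s => y (s - h) - y 0).
  apply: continuous_sub; last exact: continuous_cst_fun.
  apply: (continuous_compose (g := y)) => //.
  by apply: continuous_sub; [exact: continuous_id_fun|exact: continuous_cst_fun].
have Lt := L1_kernel_mul (L1_caputo_kernel ga de al0 be_itv) t cd.
rewrite /convolution (Rintegral_itvoo_split (b := h) _ Lt); last by rewrite (ltW h0).
have -> : \int[mu]_(s in `]0, h[) (k (t - s) * (y (s - h) - y 0)) = 0.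
  transitivity (\int[mu]_(s in `]0, h[) (0 : R)); last by rewrite /Rintegral integral0.
  apply: eq_Rintegral => s; rewrite inE/= in_itv/= => /andP[s0 sh].
  by rewrite yneg ?subrr ?mulr0// subr_le0 ltW.
rewrite add0r.
have Lht : L1 `]h, t[ (fun s => k (t - s) * (y (s - h) - y 0)).
  move: Lt; apply: integrableS => // s /=; rewrite !in_itv/= => /andP[hs ->].
  by rewrite (lt_trans h0 hs).
have [_ ->] := Rintegral_translate h Lht; rewrite subrr.
apply: eq_Rintegral => s _; rewrite addrK.
have -> : t - (s + h) = t - h - s by ring.
exact: erefl.
Qed.

(** Conversely, if the fractional integral has density [v], the Steklov averages
    [h^-1 * \int_(t - h)^t y] approximate [y], and their images
    [h^-1 * (G t - G (t - h))] are the averages of [v]. *)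
Lemma caputo_of_increment (y v : R -> R) : continuous y ->
  (forall s, 0 < s < q -> {for s, continuous v}) ->
  (forall c t, 0 < c <= t -> t < q -> G y t - G y c = \int[mu]_(s in `]c, t[) v s) ->
  is_caputo_prabhakar q al be ga de y v.
Proof.
move=> cy cv Gv c0 d0 e c00 d0q e0.
(* enlarging [c0, d0] makes it nonempty *)
pose c := Num.min c0 (q / 2); pose d := Num.max d0 (q / 2).
have q20 : 0 < q / 2 by rewrite divr_gt0.
have q2q : q / 2 < q by rewrite gtr_pMr// invf_lt1// ltr1n.
have c_gt0 : 0 < c by rewrite lt_min c00.
have dq : d < q by rewrite gt_max d0q.
have cd : c <= d by apply: (@le_trans _ _ (q / 2)); rewrite ?ge_min ?le_max lexx orbT.
(* The extension is constant before [0] and after [q]. The averages are taken over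
   [`]t - h, t[], so that their derivative is a difference of [yb] and its delay. *)
pose yb s := y (clamp 0 q s).
have cyb : continuous yb := continuous_compose (@continuous_clamp R 0 q) cy.
have yb0 s : s <= 0 -> yb s = y 0.
  by move=> s0; rewrite /yb /clamp min_l ?max_l// (le_trans s0)// ltW.
have [h1 h10 yh1] := @uniform_continuity_itv R yb 0 q e cyb e0.
have c20 : 0 < c / 2 by rewrite divr_gt0.
have c2c : c / 2 < c by rewrite gtr_pMr// invf_lt1// ltr1n.
have cdd : c / 2 <= d by rewrite (le_trans (ltW c2c)).
have cvb : continuous (fun s => v (clamp (c / 2) d s)).
  apply: continuous_clamp_pointwise => // s /andP[cs sd].
  by apply: cv; rewrite (lt_le_trans c20)//= (le_lt_trans sd).
have [h2 h20 vh2] := @uniform_continuity_itv R _ c d e cvb e0.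
pose h := Num.min (c / 2) (Num.min h1 h2).
have h0 : 0 < h by rewrite !lt_min c20 h10.
have hc : h <= c / 2 by rewrite ge_min lexx.
have hh1 : h <= h1 by rewrite !ge_min lexx !orbT.
have hh2 : h <= h2 by rewrite !ge_min lexx !orbT.
pose y1 s := yb (s - h).
have cy1 : continuous y1.
  apply: (continuous_compose (g := yb)) => //.
  by apply: continuous_sub; [exact: continuous_id_fun|exact: continuous_cst_fun].
pose P r := \int[mu]_(s in `]0, r[) y1 s.
have PE : P = volterra 1 (fun=> 1) 1 y1.
  apply/funext => r; apply: eq_Rintegral => s _.
  by rewrite /beta_weight subrr !powRr0 !mul1r.
have cP : continuous P.
  have cg2 : continuous (fun z : R * R => y1 z.1).
    exact: (continuous_compose (@continuous_fst_fun _ _) cy1).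
  have b1 : 0 < 1 + 1 - 1 :> R by rewrite addrK.
  have := continuous_sectionl (y := 0)
    (continuous_volterra ltr01 ltr01 b1 (@continuous_cst_fun R R 1) cg2).
  by rewrite PE.
have Ly1 l r : L1 `]l, r[ y1 by exact: L1_continuous_oo.
have dP (r : R) : 0 < r -> is_derive r 1 P (y1 r).
  move=> r0; apply: (is_derive_primitive (u := r + 1)) => //; last exact: cy1.
  by rewrite r0 ltrDl/=.
pose z t := h^-1 * (P (t + h) - P t).
have cshift : continuous (fun t : R => t + h).
  by apply: continuous_add; [exact: continuous_id_fun|exact: continuous_cst_fun].
have cz : continuous z.
  apply: continuous_mul; first exact: continuous_cst_fun.
  by apply: continuous_sub => //; exact: (continuous_compose cshift cP).
pose z' t := h^-1 * (yb t - y1 t).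
have cz' : continuous z'.
  apply: continuous_mul; first exact: continuous_cst_fun.
  exact: continuous_sub.
have dz (t : R) : 0 < t -> is_derive t 1 z (z' t).
  move=> t0; have th0 : 0 < t + h by rewrite addr_gt0.
  have d1 := dP _ th0; have d2 := dP _ t0.
  have ds : is_derive t 1 (fun t : R => t + h) 1.
    by apply: is_derive_eq; rewrite addr0.
  have d3 : is_derive t 1 (fun t => P (t + h)) (y1 (t + h) * 1).
    exact: (is_derive1_comp (f := P) (g := fun t => t + h)).
  have d4 := is_deriveZ (h^-1) (is_deriveB d3 d2).
  apply: is_derive_eq; rewrite mulr1 /z' /y1 addrK; exact: erefl.
have dz1 (t : R) : 0 < t -> derive1 z t = z' t.
  by move=> t0; have := dz _ t0 => ?; rewrite derive1E derive_val.
exists z; split.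
- split; last first.
    have := L1_continuous_oo 0 q cz'; apply: eq_integrable => // s.
    by rewrite inE/= in_itv/= => /andP[s0 _]; rewrite dz1.
  split; first exact: continuous_subspaceT.
    by move=> t /andP[t0 _]; have [] := dz t t0.
  apply: continuous_within_pointwise; first exact: interval_open.
  move=> t /=; rewrite in_itv/= => /andP[t0 tq].
  apply: (continuous_at_near_eq (cz' t)).
  near=> s; apply/esym/dz1; near: s; exact: lt_nbhsr.
- move=> t /andP[t0 tq].
  have -> : y t = yb t by rewrite /yb clamp_id// t0.
  have -> : z t = h^-1 * \int[mu]_(s in `]t, (t + h)[) y1 s.
    rewrite /z /P (Rintegral_itvoo_split (b := t) _ (Ly1 0 (t + h))); last first.
      by rewrite t0 lerDl ltW.
    by rewrite addrC addKr.
  apply: Rintegral_mean_le => // s /andP[ts sth].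
  apply: yh1; first by rewrite t0.
  by apply: dist_left_le hh1; [rewrite ltrD2r|rewrite ltrBlDr].
- move=> t /andP[c0t td0].
  have ct : c <= t by rewrite ge_min c0t.
  have td : t <= d by rewrite le_max td0.
  have t0 : 0 < t := lt_le_trans c_gt0 ct.
  have tq : t < q := le_lt_trans td dq.
  have ht : h < t by apply: le_lt_trans hc _; exact: lt_le_trans c2c ct.
  have th0 : 0 < t - h by rewrite subr_gt0.
  have cyb' : continuous (fun s => yb s - y 0) by apply: continuous_sub => //; exact: continuous_cst_fun.
  have cy1' : continuous (fun s => y1 s - y 0) by apply: continuous_sub => //; exact: continuous_cst_fun.
  have L1' := L1_kernel_mul (L1_caputo_kernel ga de al0 be_itv) t cyb'.
  have L2' := L1_kernel_mul (L1_caputo_kernel ga de al0 be_itv) t cy1'.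
  have L3' := L1B (measurable_itv _) L1' L2'.
  have -> : caputo_prabhakar 1 al be ga de z t = h^-1 * (G y t - G y (t - h)).
    have <- : convolution k (fun s => y1 s - y 0) t = G y (t - h).
      have := @caputo_integral_delay yb h t cyb; rewrite (yb0 0 (lexx _)) => -> //.
      + by apply: eq_caputo_integral => s /andP[s0 sth]; rewrite /yb clamp_id// s0/= (le_trans sth)// lerBlDr (le_trans (ltW tq))// lerDl ltW.
      + by rewrite h0 ltW.
    have -> : G y t = convolution k (fun s => yb s - y 0) t.
      apply: eq_Rintegral => s; rewrite inE/= in_itv/= => /andP[s0 st].
      by rewrite /yb clamp_id// (ltW s0) ltW// (lt_trans st).
    rewrite caputo_prabhakarE /convolution -(RintegralB _ L1' L2'); last exact: measurable_itv.
    rewrite -(RintegralZl _ _ L3'); last exact: measurable_itv.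
    apply: eq_Rintegral => s; rewrite inE/= in_itv/= => /andP[s0 st].
    rewrite dz1// /z' -mulrBr opprB addrA subrK mulrCA; congr (_ * (_ * _)).
  rewrite Gv//; last by rewrite th0 lerBlDr lerDl ltW.
  have Lv : L1 `](t - h), t[ v.
    apply: L1_pointwise => s /andP[hs st]; apply: cv.
    by rewrite (lt_le_trans th0)//= (le_lt_trans st).
  have := @Rintegral_mean_le v (t - h) h e (v t) h0; rewrite subrK; apply => //.
  move=> s /andP[hs st].
  have ch2 : c / 2 <= t - h.
    by rewrite lerBrDr; apply: le_trans ct; rewrite [leRHS](splitr c) lerD2l.
  have scd : c / 2 <= s <= d by rewrite (le_trans ch2 (ltW hs)) (le_trans (ltW st) td).
  have tcd : c / 2 <= t <= d by rewrite (le_trans (ltW c2c) ct) td.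
  have := vh2 s t; rewrite (clamp_id scd) (clamp_id tcd); apply; first by rewrite ct.
  exact: dist_left_le hs st hh2.
Unshelve. all: by end_near. Qed.

End caputo_steklov.

(** * Fractional integrals of continuously differentiable data *)

Section caputo_C1.
Context {R : realType}.
Notation mu := (@lebesgue_measure R).
Variables (al be ga de q : R).
Hypotheses (al0 : 0 < al) (be_itv : 0 < be < 1) (q0 : 0 < q).
Notation k := (caputo_kernel al be ga de).
Notation G := (caputo_integral al be ga de).

(** Away from the singularity the kernel is built from powers and an entire
    function. *)
Lemma caputo_kernel_C1 : exists k1 : R -> R, forall r : R, 0 < r ->
  is_derive r 1 k (k1 r) /\ {for r, continuous k1}.
Proof.
have b1 := order_compl_gt0 be_itv.
pose a := prabhakar_coef al (1 - be) (- ga).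
have da : superexponential_decay a := prabhakar_coef_decay (- ga) al0 b1.
pose E1 z := limn (pseries (pseries_diffs a) z).
have cE1 : continuous E1 by exact: (decay_continuous (decay_diffs da)).
have dE (z : R) : is_derive z 1 (prabhakarE al (1 - be) (- ga)) (E1 z).
  rewrite (_ : prabhakarE _ _ _ = fun z => limn (pseries a z)); first exact: decay_is_derive.
  by apply/funext => y; exact: prabhakarE_pseries.
pose E0 := prabhakarE al (1 - be) (- ga).
have cE0 : continuous E0 by exact: continuous_prabhakarE.
pose arg (r : R) := de * r `^ al; pose arg' (r : R) := de * (al * r `^ (al - 1)).
exists (fun r => r `^ (1 - be - 1) * (arg' r * E1 (arg r)) +
    E0 (arg r) * ((1 - be - 1) * r `^ (1 - be - 1 - 1))) => r r0.
have carg : {for r, continuous arg}.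
  by apply: cvgM; [exact: cvg_cst|exact: continuous_powR_at].
split.
  have darg : is_derive r 1 arg (arg' r).
    exact: (is_deriveZ de (is_derive1_powR al r0)).
  have d1 : is_derive r 1 (fun r => E0 (arg r)) (E1 (arg r) * arg' r).
    exact: (is_derive1_comp (f := E0) (g := arg)).
  have := is_deriveM (is_derive1_powR (1 - be - 1) r0) d1.
  by move=> D; apply: is_derive_eq; rewrite /GRing.scale/= [arg' r * _]mulrC.
apply: cvgD; apply: cvgM.
- exact: continuous_powR_at.
- apply: cvgM; last by apply: continuous_comp => //; exact: cE1.
  by apply: cvgM; [exact: cvg_cst|apply: cvgM; [exact: cvg_cst|exact: continuous_powR_at]].
- by apply: continuous_comp => //; exact: cE0.
- by apply: cvgM; [exact: cvg_cst|exact: continuous_powR_at].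
Qed.

Lemma increment_rearrange (a b c d : R) : a + (c + d) - (b + c) = a - b + d.
Proof. by ring. Qed.

Lemma continuous_caputo_convolution (g : R -> R) : continuous g -> continuous (convolution k g).
Proof.
move=> cg; have cg2 : continuous (fun z : R * R => g z.1).
  exact: (continuous_compose (@continuous_fst_fun _ _) cg).
have cF := @continuous_prabhakar_profile R al (1 - be) (- ga) de al0 (order_compl_gt0 be_itv).
have bb : 0 < 1 - be + 1 - 1 by rewrite addrK; exact: order_compl_gt0 be_itv.
have := continuous_sectionl (y := 0) (continuous_volterra (order_compl_gt0 be_itv) ltr01 bb cF cg2).
rewrite (_ : (fun _ => _) = convolution k g)//.
by apply/funext => t; rewrite convolution_volterra1.
Qed.

(** The part of the memory before [c0] enters through the smooth values of the
    kernel; the part after [c0] is integrated by parts, [phi] being C^1 there. *)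
Lemma caputo_integral_C1_local (phi : R -> R) (c1 d1 : R) : C0_C1 q phi ->
  0 < c1 < d1 -> d1 < q ->
  exists D : R -> R, (forall r, c1 <= r <= d1 -> {for r, continuous D}) /\
    forall c t, c1 <= c <= t -> t <= d1 -> G phi t - G phi c = \int[mu]_(s in `]c, t[) D s.
Proof.
move=> [cphi dphi cdphi] /andP[c10 cd1] d1q.
have [k1 k1P] := caputo_kernel_C1.
(* Times before [c0] are separated from the singularity of the kernel by at least
   [c0], as only [t >= c1] occur. *)
pose c0 := c1 / 2; have c00 : 0 < c0 by rewrite divr_gt0.
have cc : c1 = c0 + c0 by rewrite /c0 -splitr.
have c01 : c0 < c1 by rewrite cc ltrDl.
have c0q : c0 <= q by rewrite ltW// (lt_trans c01)// (lt_trans cd1).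
have c0d1 : c0 <= d1 by rewrite ltW// (lt_trans c01).
pose w s := phi (clamp 0 q s) - phi 0.
have cw : continuous w.
  apply: continuous_sub; last exact: continuous_cst_fun.
  by apply: continuous_clamp_within => //; exact: ltW.
have wE s : 0 <= s <= q -> w s = phi s - phi 0 by move=> sq; rewrite /w clamp_id.
pose k1c s := k1 (clamp c0 q s).
have ck1c : continuous k1c.
  apply: continuous_clamp_pointwise => // r /andP[r0 _].
  by have [] := k1P r (lt_le_trans c00 r0).
have Lw : L1 `]0, c0[ w by exact: L1_continuous_oo.
have cH : continuous (fun z : R * R => k1c (z.2 - z.1)).
  apply: (continuous_compose (g := k1c) (f := fun z : R * R => z.2 - z.1)) => //.
  by apply: continuous_sub; [exact: continuous_snd_fun|exact: continuous_fst_fun].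
pose D1 r := \int[mu]_(s in `]0, c0[) (w s * k1c (r - s)).
have cD1 : continuous D1 := continuous_param_integral Lw cH.
pose g1 r := derive1 phi (clamp c0 d1 (r + c0)).
have cdphi' r : 0 < r < q -> {for r, continuous (derive1 phi)}.
  move=> hr; move: cdphi; rewrite continuous_open_subspace; last exact: interval_open.
  by apply; rewrite inE/= in_itv.
have cshift : continuous (fun r : R => r + c0).
  by apply: continuous_add; [exact: continuous_id_fun|exact: continuous_cst_fun].
have cg1 : continuous g1.
  apply: (continuous_compose (g := fun r => derive1 phi (clamp c0 d1 r)) cshift).
  apply: continuous_clamp_pointwise => // r /andP[c0r rd].
  by apply: cdphi'; rewrite (lt_le_trans c00)//= (le_lt_trans rd).
have mk := measurable_caputo_kernel ga de al0 be_itv.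
have Lk := L1_caputo_kernel ga de al0 be_itv.
(* The derivative of the convolution of [k] with [w] after time [c0]: the boundary
   term and the convolution with the derivative. *)
pose h r := w c0 * k r + convolution k g1 r.
have wc0 s : 0 <= s -> s <= d1 - c0 -> w (s + c0) = w c0 + \int[mu]_(r in `]0, s[) g1 r.
  move=> s0 sd; rewrite lerBrDr in sd.
  have -> : \int[mu]_(r in `]0, s[) g1 r = phi (s + c0) - phi c0.
    rewrite -[in RHS](add0r c0); rewrite addrA addr0.
    apply: (@Rintegral_derivative _ (fun r => phi (r + c0))) => // [r /andP[r0 rs]|r _]; last exact: cg1.
    have hr : c0 <= r + c0 <= d1 by rewrite lerDr r0 (le_trans _ sd)// lerD2r.
    have ds : is_derive r 1 (fun r : R => r + c0) 1 by apply: is_derive_eq; rewrite addr0.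
    have hr' : 0 < r + c0 < q by case/andP: hr => h1 h2; rewrite (lt_le_trans c00)//= (le_lt_trans h2).
    have dp : is_derive (r + c0) 1 phi (g1 r).
      by rewrite /g1 clamp_id// derive1E; apply: DeriveDef => //; exact: dphi.
    have := is_derive1_comp (f := phi) (g := fun r => r + c0) dp ds.
    by rewrite mulr1.
  rewrite !wE ?c0q ?(ltW c00)//.
    by rewrite [RHS]addrC addrA subrK.
  by rewrite addr_ge0 ?(ltW c00)//= (le_trans sd)// ltW.
have Lh tau : 0 <= tau -> L1 `]0, tau[ h.
  move=> tau0; apply: L1D => //; first by apply: L1Zl => //; exact: Lk.
  by apply: L1_continuous_oo; exact: continuous_caputo_convolution.
have Lkw t := L1_kernel_mul Lk t cw.
have GE t : c1 <= t <= d1 -> G phi t =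
    \int[mu]_(s in `]0, c0[) (k (t - s) * w s) + \int[mu]_(s in `]0, (t - c0)[) h s.
  move=> /andP[ct td]; have c0t : c0 <= t := le_trans (ltW c01) ct.
  have tq : t <= q := le_trans td (ltW d1q).
  have -> : G phi t = \int[mu]_(s in `]0, t[) (k (t - s) * w s).
    apply: eq_Rintegral => s; rewrite inE/= in_itv/= => /andP[s0 st].
    by rewrite wE// (ltW s0) (le_trans (ltW st)).
  rewrite (Rintegral_itvoo_split (b := c0) _ (Lkw t)); last by rewrite (ltW c00).
  congr (_ + _).
  have Lct : L1 `]c0, t[ (fun s => k (t - s) * w s).
    move: (Lkw t); apply: integrableS => // s /=; rewrite !in_itv/= => /andP[hs ->].
    by rewrite (lt_trans c00 hs).
  have [_ ->] := Rintegral_translate c0 Lct; rewrite subrr.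
  pose tau := t - c0; rewrite -/tau.
  have [tau0|tau0] := leP tau 0.
    by rewrite !set_itv_ge ?bnd_simp -?leNgt// !Rintegral_set0.
  have taud : tau <= d1 - c0 by rewrite lerD2r.
  have Lg1 : L1 `]0, tau[ g1 by exact: L1_continuous_oo.
  have mg1 : measurable_fun setT g1 by exact: continuous_measurable_fun.
  have [Lc Ec] := convolution_primitive mk Lk tau0 mg1 Lg1.
  have LR := L1_reflect (Lk tau (ltW tau0)).
  have LRw := L1Zl (w c0) (measurable_itv _) LR.
  have cpr : continuous (fun s => w (s + c0) - w c0).
    by apply: continuous_sub; [exact: (continuous_compose cshift cw)|exact: continuous_cst_fun].
  have Lpr := L1_kernel_mul Lk tau cpr.
  transitivity (\int[mu]_(s in `]0, tau[) (w c0 * k (tau - s) + k (tau - s) * (w (s + c0) - w c0))).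
    apply: eq_Rintegral => s _; have -> : t - (s + c0) = tau - s by rewrite /tau opprD addrCA addrC -addrA addrC.
    by rewrite [w c0 * _]mulrC -mulrDr [w c0 + _]addrC subrK.
  rewrite (RintegralD _ LRw Lpr); last exact: measurable_itv.
  rewrite (RintegralZl _ _ LR); last exact: measurable_itv.
  rewrite -(Rintegral_reflect (Lk tau (ltW tau0))).
  have LZ := L1Zl (w c0) (measurable_itv _) (Lk tau (ltW tau0)).
  rewrite /h (RintegralD _ LZ Lc); last exact: measurable_itv.
  rewrite (RintegralZl _ _ (Lk tau (ltW tau0))); last exact: measurable_itv.
  congr (_ + _); rewrite -Ec; apply: eq_Rintegral => s; rewrite inE/= in_itv/= => /andP[s0 st].
  congr (_ * _); rewrite wc0 ?(ltW s0)//; last exact: le_trans (ltW st) taud.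
  by rewrite addrC addKr.
exists (fun r => D1 r + h (r - c0)); split.
  move=> r /andP[c1r rd]; have rc : 0 < r - c0 by rewrite subr_gt0 (lt_le_trans c01).
  apply: cvgD; first exact: cD1.
  have ch : {for (r - c0), continuous h}.
    apply: cvgD; last exact: continuous_caputo_convolution.
    apply: cvgM; first exact: cvg_cst.
    apply: differentiable_continuous; apply/derivable1_diffP.
    by have [[]] := k1P _ rc.
  apply: (continuous_comp (f := fun r => r - c0) (g := h)) => //.
  by apply: cvgB; [exact: cvg_id|exact: cvg_cst].
move=> c t /andP[c1c ct] td.
have c1t : c1 <= t := le_trans c1c ct; have cd : c <= d1 := le_trans ct td.
rewrite GE ?c1t// GE ?c1c//.
have LP r : c1 <= r -> L1 `]0, c0[ (fun s => k (r - s) * w s).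
  move=> c1r; move: (Lkw r); apply: integrableS => // s /=; rewrite !in_itv/= => /andP[->] /= sc.
  by rewrite (lt_le_trans sc)// (le_trans (ltW c01)).
have tc0 : 0 <= t - c0 by rewrite subr_ge0 (le_trans (ltW c01)).
have cc0 : 0 <= c - c0 by rewrite subr_ge0 (le_trans (ltW c01)).
have Lhct : L1 `](c - c0), (t - c0)[ h.
  move: (Lh _ tc0); apply: integrableS => // s /=; rewrite !in_itv/= => /andP[hs ->].
  by rewrite (le_lt_trans cc0 hs).
have [] := Rintegral_translate (- c0) Lhct; rewrite !opprK !subrK => Lh' Eh.
have LD1 : L1 `]c, t[ D1 by exact: L1_continuous_oo.
rewrite (RintegralD _ LD1 Lh'); last exact: measurable_itv.
rewrite -Eh (Rintegral_itvoo_split (b := c - c0) _ (Lh _ tc0)); last by rewrite cc0 lerD2r.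
have kE (s : R) : 0 < s -> s < c0 ->
    \int[mu]_(r in `]c, t[) k1c (r - s) = k (t - s) - k (c - s).
  move=> s0 sc; pose ks r := k (r - s).
  have cs : continuous (fun r : R => r - s).
    by apply: continuous_sub; [exact: continuous_id_fun|exact: continuous_cst_fun].
  suff : \int[mu]_(r in `]c, t[) k1c (r - s) = ks t - ks c by [].
  apply: (@Rintegral_derivative _ ks (fun r => k1c (r - s)) c t ct) => [r /andP[cr rt]|r _]; last first.
    exact: (continuous_compose cs ck1c).
  have h1 : c0 + s <= c1 by rewrite [leRHS]cc lerD2l (ltW sc).
  have h2 : c0 + s <= r := le_trans h1 (le_trans c1c cr).
  have rs : c0 <= r - s by rewrite lerBrDr.
  have rsq : r - s <= q.
    by rewrite lerBlDr; apply: le_trans (le_trans rt (le_trans td (ltW d1q))) _; rewrite lerDl (ltW s0).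
  have ds : is_derive r 1 (fun r : R => r - s) 1 by apply: is_derive_eq; rewrite subr0.
  have [dk _] := k1P _ (lt_le_trans c00 rs).
  have D := is_derive1_comp (f := k) (g := fun r => r - s) dk ds.
  have e : clamp c0 q (r - s) = r - s by apply: clamp_id; apply/andP; split; [exact: rs|exact: rsq].
  rewrite mulr1 in D.
  rewrite /k1c e.
  exact: D.
have -> : \int[mu]_(x in `]c, t[) D1 x =
    \int[mu]_(s in `]0, c0[) (k (t - s) * w s) - \int[mu]_(s in `]0, c0[) (k (c - s) * w s).
  rewrite -(RintegralB _ (LP _ c1t) (LP _ c1c)); last exact: measurable_itv.
  have L1o : L1 `]c, t[ (fun _ : R => 1 : R) by apply: L1_continuous_oo; exact: continuous_cst_fun.
  have := Rintegral_swap Lw L1o cH => /= E.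
  transitivity (\int[mu]_(y in `]c, t[) (1 * \int[mu]_(x in `]0, c0[) (w x * k1c (y - x)))).
    by apply: eq_Rintegral => r _; rewrite mul1r.
  rewrite -E; apply: eq_Rintegral => s; rewrite inE/= in_itv/= => /andP[s0 sc].
  rewrite -mulrBl mulrC; congr (_ * _).
  transitivity (\int[mu]_(r in `]c, t[) k1c (r - s)).
    by apply: eq_Rintegral => r _; rewrite mul1r.
  exact: kE.
exact: increment_rearrange.
Qed.

(** The local densities agree with the derivative of the fractional integral, so
    they fit together. *)
Lemma caputo_integral_C1 (phi : R -> R) : C0_C1 q phi ->
  exists D : R -> R, (forall r, 0 < r < q -> {for r, continuous D}) /\
    forall c t, 0 < c <= t -> t < q -> G phi t - G phi c = \int[mu]_(s in `]c, t[) D s.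
Proof.
move=> phiC.
have loc (c t : R) : 0 < c <= t -> t < q -> exists D c1 d1, [/\ c1 < c, t < d1,
    forall r, c1 <= r <= d1 -> {for r, continuous D},
    forall r, c1 < r < d1 -> derive1 (G phi) r = D r &
    forall c' t', c1 <= c' <= t' -> t' <= d1 -> G phi t' - G phi c' = \int[mu]_(s in `]c', t'[) D s].
  move=> /andP[c0 ct] tq; pose c1 := c / 2; pose d1 := (t + q) / 2.
  have c10 : 0 < c1 by rewrite divr_gt0.
  have c1c : c1 < c by rewrite gtr_pMr// invf_lt1// ltr1n.
  have [td1 d1q] : t < d1 /\ d1 < q by rewrite /d1; split; lra.
  have [|D [cD DE]] := @caputo_integral_C1_local phi c1 d1 phiC _ d1q.
    by rewrite c10 (lt_trans c1c)// (le_lt_trans ct).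
  exists D, c1, d1; split => // r /andP[c1r rd].
  have LD : L1 `]c1, d1[ D by exact: L1_pointwise.
  have cDr : {for r, continuous D} by apply: cD; rewrite !ltW.
  have dP := is_derive_primitive LD (ltac:(by rewrite c1r) : c1 < r < d1) cDr.
  have d2 : is_derive r 1 (G phi) (D r).
    have := is_deriveD (is_derive_cst (G phi c1) r 1) dP; rewrite add0r => d3.
    apply: (near_eq_is_derive _ d3); near=> y.
    have c1y : c1 <= y by apply: ltW; near: y; exact: lt_nbhsr.
    have yd : y <= d1 by apply: ltW; near: y; exact: lt_nbhsl.
    have E := DE c1 y (ltac:(by rewrite lexx c1y) : c1 <= c1 <= y) yd.
    transitivity (G phi c1 + \int[mu]_(s in `]c1, y[) D s); first by [].
    by rewrite -E addrC subrK.
  by rewrite derive1E derive_val.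
exists (derive1 (G phi)); split.
  move=> r /andP[r0 rq].
  have [|D [c1 [d1 [c1r rd1 cD dD _]]]] := loc r r _ rq; first by rewrite r0 lexx.
  have cDr : {for r, continuous D} by apply: cD; rewrite !ltW.
  apply: (continuous_at_near_eq cDr); near=> y; apply/esym/dD.
  by apply/andP; split; near: y; [exact: lt_nbhsr|exact: lt_nbhsl].
move=> c t ct tq; have [D [c1 [d1 [c1c td1 cD dD DE]]]] := loc c t ct tq.
have /andP[_ ct'] := ct.
rewrite DE ?(ltW c1c)// ?ltW//; apply: eq_Rintegral => s; rewrite inE/= in_itv/= => /andP[cs st].
by rewrite dD// (lt_trans c1c cs) (lt_trans st).
Unshelve. all: by end_near. Qed.

End caputo_C1.

(** * The fixed-point operator *)

Section fixed_point.
Context {R : realType}.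
Notation mu := (@lebesgue_measure R).
Variables (al be ga de a b p q A : R) (M S : R -> R).
Hypotheses (al0 : 0 < al) (be0 : 0 < be) (a0 : a != 0) (p0 : 0 < p) (q0 : 0 < q).
Hypotheses (A0 : A != 0).
Hypotheses (cM : continuous M) (cS : continuous S).

Definition prabhakar_op (g : R -> R) (t : R) : R :=
  volterra be (prabhakar_profile al be ga de) 1 g t.

Definition weighted_mean (g : R -> R) : R := \int[mu]_(t in `]0, q[) (M t * g t).

Definition x_primitive (e : R) (g : R * R -> R) (z : R * R) : R :=
  exp_primitive b e (fun y => g (z.1, y)) z.2.

(** The solution operator of the nonlocal condition: adding a multiple of [S]
    turns a function vanishing at [t = 0] into one that satisfies the
    homogeneous condition. *)
Definition nonlocal_lift (g : R * R -> R) (z : R * R) : R :=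
  g z + S z.1 * (weighted_mean (fun s => g (s, z.2)) / A).

(** The operator of the fixed-point equation. The factor [z.2 `^ e] compensates the
    singularity [z.2 `^ (- e)] which [x_primitive e] puts in front of the density. *)
Definition volterra_step (e : R) (g : R * R -> R) (z : R * R) : R :=
  a * prabhakar_op (fun s => g (s, z.2)) z.1 +
  a * b * pos_powR e z.2 *
    prabhakar_op (fun s => nonlocal_lift (x_primitive e g) (s, z.2)) z.1.

Let cF : continuous (prabhakar_profile al be ga de).
Proof. exact: continuous_prabhakar_profile. Qed.

Lemma L1_weight : L1 `]0, q[ M.
Proof. exact: L1_continuous_oo. Qed.

Let bb : 0 < be + 1 - 1. Proof. by rewrite addrK. Qed.

Lemma continuous_prabhakar_op (g : R * R -> R) : continuous g ->
  continuous (fun z : R * R => prabhakar_op (fun s => g (s, z.2)) z.1).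
Proof. by move=> cg; exact: (continuous_volterra be0 ltr01 bb cF cg). Qed.

Lemma continuous_x_primitive (e : R) (g : R * R -> R) : e < 1 -> continuous g ->
  continuous (x_primitive e g).
Proof.
move=> e1 cg; have e10 : 0 < 1 - e by rewrite subr_gt0.
have ee : 0 < 1 + (1 - e) - 1 by rewrite addrC addKr.
have cg' : continuous (fun z : R * R => g (z.2, z.1)).
  apply: (continuous_compose (g := g) (f := fun z : R * R => (z.2, z.1))) => //.
  by apply: continuous_pair; [exact: continuous_snd_fun|exact: continuous_fst_fun].
have c1 := continuous_volterra ltr01 e10 ee (@continuous_expRM R b) cg'.
have c2 : continuous (fun z : R * R => (z.2, z.1)).
  by apply: continuous_pair; [exact: continuous_snd_fun|exact: continuous_fst_fun].
exact: (continuous_compose c2 c1).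
Qed.

Lemma continuous_weighted_mean (g : R * R -> R) : continuous g ->
  continuous (fun x => weighted_mean (fun s => g (s, x))).
Proof. by move=> cg; exact: (continuous_param_integral L1_weight cg). Qed.

Lemma continuous_nonlocal_lift (g : R * R -> R) : continuous g ->
  continuous (nonlocal_lift g).
Proof.
move=> cg; apply: continuous_add => //.
apply: continuous_mul.
  exact: (continuous_compose (@continuous_fst_fun _ _) cS).
apply: continuous_mul; last exact: continuous_cst_fun.
exact: (continuous_compose (@continuous_snd_fun _ _) (continuous_weighted_mean cg)).
Qed.

Lemma continuous_volterra_step (e : R) (g : R * R -> R) : 0 <= e < 1 -> continuous g ->
  continuous (volterra_step e g).
Proof.
move=> /andP[e0 e1] cg; apply: continuous_add.
  by apply: continuous_mul; [exact: continuous_cst_fun|exact: continuous_prabhakar_op].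
apply: continuous_mul; last first.
  by apply: continuous_prabhakar_op; apply: continuous_nonlocal_lift; exact: continuous_x_primitive.
apply: continuous_mul; first exact: continuous_cst_fun.
exact: (continuous_compose (@continuous_snd_fun _ _) (continuous_pos_powR e0)).
Qed.

Lemma prabhakar_opB (g h : R -> R) t : continuous g -> continuous h ->
  prabhakar_op (fun s => g s - h s) t = prabhakar_op g t - prabhakar_op h t.
Proof. by move=> cg ch; exact: volterraB. Qed.

Lemma x_primitiveB (e : R) (g h : R * R -> R) z : e < 1 -> continuous g -> continuous h ->
  x_primitive e (fun z => g z - h z) z = x_primitive e g z - x_primitive e h z.
Proof.
move=> e1 cg ch; apply: volterraB => //; first by rewrite subr_gt0.
- exact: continuous_expRM.
- exact: continuous_sectionr.
- exact: continuous_sectionr.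
Qed.

Lemma weighted_meanB (g h : R -> R) : continuous g -> continuous h ->
  weighted_mean (fun s => g s - h s) = weighted_mean g - weighted_mean h.
Proof.
move=> cg ch; rewrite /weighted_mean.
rewrite -(RintegralB _ (L1_mul_continuous L1_weight cg) (L1_mul_continuous L1_weight ch)); last exact: measurable_itv.
by apply: eq_Rintegral => s _; rewrite mulrBr.
Qed.

Lemma weighted_meanD (g h : R -> R) : continuous g -> continuous h ->
  weighted_mean (fun s => g s + h s) = weighted_mean g + weighted_mean h.
Proof.
move=> cg ch; rewrite /weighted_mean.
rewrite -(RintegralD _ (L1_mul_continuous L1_weight cg) (L1_mul_continuous L1_weight ch)); last exact: measurable_itv.
by apply: eq_Rintegral => s _; rewrite mulrDr.
Qed.

Lemma weighted_meanZ (g : R -> R) c : continuous g ->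
  weighted_mean (fun s => c * g s) = c * weighted_mean g.
Proof.
move=> cg; rewrite /weighted_mean -(RintegralZl _ _ (L1_mul_continuous L1_weight cg)); last exact: measurable_itv.
by apply: eq_Rintegral => s _; rewrite mulrCA.
Qed.

Lemma lift_sub_algebra (u v s m n c : R) :
  u - v + s * ((m - n) / c) = u + s * (m / c) - (v + s * (n / c)).
Proof. by ring. Qed.

Lemma nonlocal_liftB (g h : R * R -> R) z : continuous g -> continuous h ->
  nonlocal_lift (fun z => g z - h z) z = nonlocal_lift g z - nonlocal_lift h z.
Proof.
move=> cg ch; rewrite /nonlocal_lift weighted_meanB; last 2 first.
- exact: continuous_sectionl.
- exact: continuous_sectionl.
exact: lift_sub_algebra.
Qed.

Lemma step_sub_algebra (c d u v m n : R) :
  c * (u - v) + d * (m - n) = c * u + d * m - (c * v + d * n).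
Proof. by ring. Qed.

Lemma volterra_stepB (e : R) (g h : R * R -> R) z : 0 <= e < 1 -> continuous g -> continuous h ->
  volterra_step e (fun z => g z - h z) z = volterra_step e g z - volterra_step e h z.
Proof.
move=> /andP[e0 e1] cg ch.
have cX (w : R * R -> R) : continuous w -> continuous (x_primitive e w).
  exact: continuous_x_primitive.
rewrite /volterra_step prabhakar_opB; last 2 first.
- exact: continuous_sectionl.
- exact: continuous_sectionl.
have -> : x_primitive e (fun z => g z - h z) = (fun z => x_primitive e g z - x_primitive e h z).
  by apply/funext => y; exact: x_primitiveB.
have -> : (fun s => nonlocal_lift (fun z => x_primitive e g z - x_primitive e h z) (s, z.2)) =
    (fun s => nonlocal_lift (x_primitive e g) (s, z.2) - nonlocal_lift (x_primitive e h) (s, z.2)).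
  by apply/funext => s; exact: (nonlocal_liftB (s, z.2) (cX g cg) (cX h ch)).
rewrite prabhakar_opB; [exact: step_sub_algebra| |].
- by apply: continuous_sectionl; exact/continuous_nonlocal_lift/cX.
- by apply: continuous_sectionl; exact/continuous_nonlocal_lift/cX.
Qed.

(** Clamped, so that weight and operator only depend on the values in the closed
    rectangle. *)
Definition exp_weight (l m : R) (z : R * R) : R :=
  expR (l * (clamp2 q p z).1) * expR (m * (clamp2 q p z).2).

Lemma clamp2_itv z : 0 <= (clamp2 q p z).1 <= q /\ 0 <= (clamp2 q p z).2 <= p.
Proof. by split; apply: clamp_itv; exact: ltW. Qed.

Lemma exp_weight_ge1 l m z : 0 <= l -> 0 <= m -> 1 <= exp_weight l m z.
Proof.
move=> l0 m0; have [/andP[t0 _] /andP[x0 _]] := clamp2_itv z.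
by rewrite /exp_weight -expRD -[leLHS]expR0 ler_expR addr_ge0// mulr_ge0.
Qed.

Lemma exp_weight_le l m z : 0 <= l -> 0 <= m -> exp_weight l m z <= expR (l * q) * expR (m * p).
Proof.
move=> l0 m0; have [/andP[_ tq] /andP[_ xp]] := clamp2_itv z.
by rewrite ler_pM ?expR_ge0// ler_expR ler_wpM2l.
Qed.

Definition clamped_step (e : R) (g : R * R -> R) (z : R * R) : R :=
  volterra_step e g (clamp2 q p z).

Lemma step_estimate (na nb eK C Et Ex P eX EQ B k1 k2 : R) :
  0 <= C -> 0 <= Et -> 0 <= Ex -> na * eK = 4^-1 -> nb * P * EQ * B * eX <= 1 ->
  `|k1| <= eK * (C * Ex) * Et -> `|k2| <= eK * (eX * C * EQ * B * Ex) * Et ->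
  0 <= na -> 0 <= nb -> forall P', 0 <= P' <= P -> 0 <= eK -> 0 <= eX -> 0 <= EQ -> 0 <= B ->
  na * `|k1| + na * nb * P' * `|k2| <= C / 2 * (Et * Ex).
Proof.
move=> C0 Et0 Ex0 eK1 eX1 h1 h2 na0 nb0 P' /andP[P'0 P'P] eK0 eX0 EQ0 B0.
have W0 : 0 <= C * Ex * Et by rewrite !mulr_ge0.
have i1 : na * `|k1| <= 4^-1 * (C * Ex * Et).
  rewrite -eK1 (le_trans (ler_wpM2l na0 h1))//.
  by rewrite le_eqVlt; apply/orP; left; apply/eqP; ring.
have i2 : na * nb * P' * `|k2| <= 4^-1 * (C * Ex * Et).
  have n0 : 0 <= na * nb by rewrite mulr_ge0.
  apply: (@le_trans _ _ (na * nb * P * (eK * (eX * C * EQ * B * Ex) * Et))).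
    apply: ler_pM => //; first by rewrite mulr_ge0.
    by rewrite ler_wpM2l.
  have -> : na * nb * P * (eK * (eX * C * EQ * B * Ex) * Et) =
      (nb * P * EQ * B * eX) * (na * eK * (C * Ex * Et)) by ring.
  by rewrite eK1 ler_piMl// mulr_ge0// invr_ge0.
have -> : C / 2 * (Et * Ex) = 4^-1 * (C * Ex * Et) + 4^-1 * (C * Ex * Et) by field.
exact: lerD.
Qed.

(** The operator [prabhakar_op] gets small norm from a large [l], and [x_primitive]
    from a large [m]. The nonlocal mean couples all times and costs a factor
    [expR (l * q)]; since it is preceded by [x_primitive], choosing [m] after [l]
    compensates this. *)
Lemma clamped_step_contraction (e : R) : 0 <= e < 1 -> exists l m, [/\ 0 <= l, 0 <= m &
  half_contraction (exp_weight l m) (clamped_step e)].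
Proof.
move=> e01; have /andP[e0 e1] := e01.
have na : 0 < `|a| by rewrite normr_gt0.
(* The first summand of the operator takes a quarter of the norm, and the second,
   after [eX], another quarter. *)
pose eK := (4 * `|a|)^-1; have eK0 : 0 < eK by rewrite invr_gt0 mulr_gt0.
have [l l0 Kl] := volterra_weighted_le be0 ltr01 bb cF (ltW q0) eK0.
have [MB MB0 MBP] := compact_continuous_bounded (@segment_compact R 0 q) cM.
have [SB SB0 SBP] := compact_continuous_bounded (@segment_compact R 0 q) cS.
pose EQ := expR (l * q); have EQ0 : 0 < EQ by exact: expR_gt0.
pose B := 1 + SB * (MB * q / `|A|).
have B0 : 0 <= B by rewrite addr_ge0// !mulr_ge0// ?invr_ge0// ltW.
pose P := p `^ e; have P0 : 0 <= P by exact: powR_ge0.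
have den : 0 < `|b| * P * EQ * B + 1 by rewrite ltr_wpDl// !mulr_ge0// ltW.
pose eX := (`|b| * P * EQ * B + 1)^-1; have eX0 : 0 < eX by rewrite invr_gt0.
have e10 : 0 < 1 - e by rewrite subr_gt0.
have ee : 0 < 1 + (1 - e) - 1 by rewrite addrC addKr.
have [m m0 Xm] := volterra_weighted_le ltr01 e10 ee (@continuous_expRM R b) (ltW p0) eX0.
exists l, m; split => //; split.
- move=> g cg; exact: (continuous_compose (@continuous_clamp2 R q p) (continuous_volterra_step e01 cg)).
- by move=> g h z cg ch; exact: volterra_stepB.
move=> g C C0 cg gC z0; rewrite /clamped_step /exp_weight.
case: (clamp2 q p z0) (clamp2_itv z0) => t x /= [tq xp] {z0}.
have /andP[t0 tq'] := tq; have /andP[x0 xp'] := xp.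
have gE s y : 0 <= s <= q -> 0 <= y <= p -> `|g (s, y)| <= C * (expR (l * s) * expR (m * y)).
  by move=> hs hy; have := gC (s, y); rewrite /exp_weight clamp2_id.
have Kg : `|prabhakar_op (fun s => g (s, x)) t| <= eK * (C * expR (m * x)) * expR (l * t).
  apply: Kl => //; first by rewrite mulr_ge0 ?expR_ge0.
    exact: continuous_sectionl.
  move=> s /andP[s0 st]; rewrite -mulrA [expR (m * x) * _]mulrC.
  by apply: gE => //; rewrite (ltW s0) (le_trans (ltW st)).
have Xg s : 0 <= s <= q -> `|x_primitive e g (s, x)| <= eX * C * EQ * expR (m * x).
  move=> hs; apply: (@le_trans _ _ (eX * (C * expR (l * s)) * expR (m * x))).
    apply: Xm => //; first by rewrite mulr_ge0 ?expR_ge0.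
      exact: continuous_sectionr.
    move=> y /andP[y0 yx]; rewrite -mulrA.
    by apply: gE => //; rewrite (ltW y0) (le_trans (ltW yx)).
  rewrite ler_wpM2r ?expR_ge0// -mulrA ler_wpM2l ?(ltW eX0)// ler_wpM2l//.
  by rewrite ler_expR ler_wpM2l//; case/andP: hs.
have cX : continuous (x_primitive e g) by exact: continuous_x_primitive.
pose c0 := eX * C * EQ * expR (m * x).
have c00 : 0 <= c0 by rewrite !mulr_ge0 ?expR_ge0// ltW.
have mX : `|weighted_mean (fun s => x_primitive e g (s, x))| <= MB * q * c0.
  have Lm := L1_mul_continuous L1_weight (continuous_sectionl (y := x) cX).
  have mm : measurable_fun `]0, q[ (fun s => M s * x_primitive e g (s, x)).
    by apply/measurable_EFinP; exact: measurable_int Lm.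
  have Lc : L1 `]0, q[ (fun _ : R => MB * c0) by apply: L1_continuous_oo; exact: continuous_cst_fun.
  apply: (le_trans (normr_Rintegral_le _ mm Lc _)) => //.
    move=> s /=; rewrite in_itv/= => /andP[s0 sq]; rewrite normrM; apply: ler_pM => //.
      by apply: MBP; rewrite /= in_itv/= !ltW.
    by apply: Xg; rewrite !ltW.
  rewrite Rintegral_cst// /= lebesgue_measure_itv/= lte_fin q0/= subr0.
  by rewrite mulrAC.
have cL : continuous (nonlocal_lift (x_primitive e g)) by exact: continuous_nonlocal_lift.
have KU : `|prabhakar_op (fun s => nonlocal_lift (x_primitive e g) (s, x)) t| <=
    eK * (eX * C * EQ * B * expR (m * x)) * expR (l * t).
  apply: Kl => //; first by rewrite !mulr_ge0 ?expR_ge0// ltW.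
    exact: continuous_sectionl.
  move=> s /andP[s0 st]; have sq : 0 <= s <= q by rewrite (ltW s0) (le_trans (ltW st)).
  have hB : eX * C * EQ * B * expR (m * x) = c0 + SB * (MB * q * c0 / `|A|).
    have E (u v w : R) : u * C * EQ * (1 + SB * (MB * q / w)) * v =
       u * C * EQ * v + SB * (MB * q * (u * C * EQ * v) / w) by ring.
    exact: E.
  rewrite hB; apply: (@le_trans _ _ (c0 + SB * (MB * q * c0 / `|A|))); last first.
    apply: ler_peMr.
      by rewrite addr_ge0// !mulr_ge0 ?invr_ge0// ltW.
    by rewrite -[leLHS]expR0 ler_expR mulr_ge0// ltW.
  apply: le_trans (ler_normD _ _) _; apply: lerD; first exact: Xg.
  rewrite normrM normrM normfV; apply: ler_pM => //.
    by apply: SBP; rewrite /= in_itv/=.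
  by rewrite ler_wpM2r// invr_ge0.
rewrite /volterra_step/=; apply: le_trans (ler_normD _ _) _.
rewrite normrM [X in _ + X]normrM [X in _ + X * _]normrM [X in _ + X * _ * _]normrM.
have eKa : `|a| * eK = 4^-1 by rewrite /eK invfM mulrCA divff ?mulr1// gt_eqF.
apply: (@step_estimate _ _ eK C _ _ P eX EQ B) => //; rewrite ?expR_ge0 ?(ltW eK0) ?(ltW eX0) ?(ltW EQ0)//.
- by rewrite /eX ler_pdivrMr// mul1r lerDl.
- rewrite pos_powRE// ger0_norm ?powR_ge0//=.
  by apply: ge0_ler_powR; rewrite ?nnegrE// ltW.
Qed.

Lemma clamped_step_solve (e : R) (h : R * R -> R) : 0 <= e < 1 -> continuous h ->
  exists rho : R * R -> R, continuous rho /\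
    forall t x, 0 <= t <= q -> 0 <= x <= p -> rho (t, x) = h (t, x) + volterra_step e rho (t, x).
Proof.
move=> e01 ch; have [l [m [l0 m0 LW]]] := clamped_step_contraction e01.
have ch' : continuous (fun z => h (clamp2 q p z)).
  exact: (continuous_compose (@continuous_clamp2 R q p) ch).
have cK : compact (`[0, q]%classic `*` `[0, p]%classic : set (R * R)).
  by apply: compact_setX; exact: segment_compact.
have [C C0 HC] := compact_continuous_bounded cK ch.
have W0 z : 0 <= exp_weight l m z <= expR (l * q) * expR (m * p).
  by rewrite exp_weight_le// (le_trans ler01)// exp_weight_ge1.
have hC z : `|h (clamp2 q p z)| <= C * exp_weight l m z.
  have [h1 h2] := clamp2_itv z.
  apply: (le_trans (HC _ _)); first by split => /=; rewrite in_itv.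
  by rewrite ler_peMr// exp_weight_ge1.
have [rho [crho rhoE _]] := neumann_series W0 LW C0 ch' hC.
exists rho; split; first exact: crho.
move=> t x tq xp; have E : clamp2 q p (t, x) = (t, x) by exact: clamp2_id.
by have := rhoE (t, x); rewrite /clamped_step E.
Qed.

Lemma clamped_step_unique (e : R) (g : R * R -> R) : 0 <= e < 1 -> continuous g ->
  (forall z, g z = clamped_step e g z) -> forall z, g z = 0.
Proof.
move=> e01 cg gE; have [l [m [l0 m0 LW]]] := clamped_step_contraction e01.
have cK : compact (`[0, q]%classic `*` `[0, p]%classic : set (R * R)).
  by apply: compact_setX; exact: segment_compact.
have cl : continuous (volterra_step e g) by exact: continuous_volterra_step.
have [C C0 HC] := compact_continuous_bounded cK cl.
apply: (half_contraction_unique LW C0 cg _ gE) => z.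
have [h1 h2] := clamp2_itv z.
rewrite gE; apply: (le_trans (HC _ _)); first by split => /=; rewrite in_itv.
by rewrite ler_peMr// exp_weight_ge1.
Qed.

End fixed_point.

(** * Inversion of the Prabhakar integral *)

Section kernel_inverse.
Context {R : realType}.
Notation mu := (@lebesgue_measure R).
Variables (al be ga de : R).
Hypotheses (al0 : 0 < al) (be_itv : 0 < be < 1).
Notation k := (caputo_kernel al be ga de).
Notation K := (prabhakar_kernel al be ga de).
Let b0 : 0 < be. Proof. by case/andP: be_itv. Qed.
Let b1 : 0 < 1 - be. Proof. exact: order_compl_gt0. Qed.

(** The orders and the parameters [ga] and [- ga] of the two kernels cancel. *)
Lemma kernel_inverse t : 0 < t -> convolution k K t = 1.
Proof.
move=> t0; have [_ ->] := prabhakar_convolution (- ga) de ga al0 b1 b0 t0.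
by rewrite subrK addNr /prabhakar_kernel subrr powRr0 mul1r prabhakarE_zero.
Qed.

Lemma kernel_inverse_abs (t : R) : 0 < t -> exists C : R, forall tau, 0 < tau <= t ->
  (\int[mu]_(s in `]0%R, tau[) `|k (tau - s) * K s|%:E <= C%:E)%E /\
  (\int[mu]_(s in `]0%R, tau[) `|K (tau - s) * k s|%:E <= C%:E)%E.
Proof.
move=> t0.
have [C1 C10 h1] := prabhakar_kernel_le (- ga) de t al0 b1.
have [C2 C20 h2] := prabhakar_kernel_le ga de t al0 b0.
pose I := Gamma (1 - be) * Gamma be / Gamma 1 : R.
exists (C1 * C2 * I) => tau /andP[tau0 taut].
have bound (c c' : R) (k1 k2 : R -> R) D1 D2 : 0 < c -> 0 < c' -> c + c' = 1 ->
    0 <= D1 -> 0 <= D2 -> measurable_fun setT k1 -> measurable_fun setT k2 ->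
    (forall s, 0 <= s <= t -> `|k1 s| <= D1 * s `^ (c - 1)) ->
    (forall s, 0 <= s <= t -> `|k2 s| <= D2 * s `^ (c' - 1)) ->
    (\int[mu]_(s in `]0%R, tau[) `|k1 (tau - s) * k2 s|%:E <=
       (D1 * D2 * (Gamma c * Gamma c' / Gamma 1))%:E)%E.
  move=> c0 c'0 cc D10 D20 mk1 mk2 k1P k2P.
  have [L E] := Beta_integral c0 c'0 (ltW tau0).
  have L2 := L1Zl (D1 * D2) (measurable_itv _) L.
  have mkk : measurable_fun `]0, tau[ (fun s => k1 (tau - s) * k2 s).
    apply: measurable_funTS; apply: measurable_funM => //.
    apply: (measurableT_comp mk1); apply: measurable_funB; first exact: measurable_cst.
    exact: measurable_id.
  have pt s : 0 < s < tau -> `|k1 (tau - s) * k2 s| <=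
      D1 * D2 * ((tau - s) `^ (c - 1) * s `^ (c' - 1)).
    move=> /andP[s0 st]; rewrite normrM mulrACA; apply: ler_pM => //.
      by apply: k1P; rewrite subr_ge0 (ltW st)/= (le_trans _ taut)// gerBl ltW.
    by apply: k2P; rewrite (ltW s0) (le_trans (ltW st)).
  have Lk : L1 `]0, tau[ (fun s => k1 (tau - s) * k2 s).
    by apply: (le_L1 _ mkk L2) => // s /=; rewrite in_itv/=; exact: pt.
  have Lka : L1 `]0, tau[ (fun s => `|k1 (tau - s) * k2 s|) by exact: integrable_norm.
  have EI : (\int[mu]_(s in `]0%R, tau[) `|k1 (tau - s) * k2 s|%:E =
      (\int[mu]_(s in `]0, tau[) `|k1 (tau - s) * k2 s|)%:E)%E.
    by rewrite /Rintegral fineK//; exact: (integrable_fin_num _ Lka).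
  rewrite EI lee_fin.
  have -> : D1 * D2 * (Gamma c * Gamma c' / Gamma 1) =
      \int[mu]_(s in `]0, tau[) (D1 * D2 * ((tau - s) `^ (c - 1) * s `^ (c' - 1))).
    rewrite (RintegralZl _ _ L); last exact: measurable_itv.
    by rewrite E tau0 cc subrr powRr0 mul1r.
  apply: le_Rintegral => // s /=; rewrite in_itv/=; exact: pt.
have mk : measurable_fun setT k by exact: measurable_caputo_kernel.
have mK : measurable_fun setT K by exact: measurable_prabhakar_kernel.
split; first by apply: (bound (1 - be) be) => //; rewrite subrK.
have -> : C1 * C2 * I = C2 * C1 * (Gamma be * Gamma (1 - be) / Gamma 1).
  rewrite /I; move: (Gamma be) (Gamma (1 - be)) (Gamma 1) => G1 G2 G3.
  by rewrite [C1 * C2]mulrC [G2 * _]mulrC.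
by apply: (bound be (1 - be)) => //; rewrite addrC subrK.
Qed.

(** Associativity and [kernel_inverse]. *)
Lemma convolution_kernel_inverse (g : R -> R) t : 0 < t -> measurable_fun setT g ->
  L1 `]0, t[ g ->
  convolution k (convolution K g) t = \int[mu]_(s in `]0, t[) g s /\
  convolution K (convolution k g) t = \int[mu]_(s in `]0, t[) g s.
Proof.
move=> t0 mg Lg; have [C CP] := kernel_inverse_abs t0.
have mk : measurable_fun setT k by exact: measurable_caputo_kernel.
have mK : measurable_fun setT K by exact: measurable_prabhakar_kernel.
have cK s : 0 < s -> convolution K k s = 1.
  move=> s0; have [_ ->] := prabhakar_convolution ga de (- ga) al0 b0 b1 s0.
  by rewrite addrC subrK addrN /prabhakar_kernel subrr powRr0 mul1r prabhakarE_zero.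
split.
  have [] := @convolution_assoc _ k K g t C t0 mk mK mg Lg.
    by move=> tau /CP[].
  move=> _ _ ->; apply: eq_Rintegral => s; rewrite inE/= in_itv/= => /andP[s0 st].
  by rewrite kernel_inverse ?subr_gt0// mul1r.
have [] := @convolution_assoc _ K k g t C t0 mK mk mg Lg.
  by move=> tau /CP[].
move=> _ _ ->; apply: eq_Rintegral => s; rewrite inE/= in_itv/= => /andP[s0 st].
by rewrite cK ?subr_gt0// mul1r.
Qed.

Lemma measurable_powR_continuous (e : R) (g : R -> R) : continuous g ->
  measurable_fun setT (fun s => s `^ e * g s).
Proof.
move=> cg; apply: measurable_funM; first exact: measurable_powR.
exact: continuous_measurable_fun.
Qed.

Lemma L1_powR_continuous (e t : R) (g : R -> R) : e < 1 -> continuous g ->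
  L1 `]0, t[ (fun s => s `^ (- e) * g s).
Proof.
move=> e1 cg; have e10 : 0 < 1 - e by rewrite subr_gt0.
have [t0|t0] := leP t 0.
  by rewrite set_itv_ge ?bnd_simp -?leNgt//; exact: integrable_set0.
have [+ _] := Rintegral_nonneg_power e10 (ltW t0).
rewrite (_ : 1 - e - 1 = - e); last by rewrite addrAC subrr add0r.
by move=> Lw; exact: (L1_mul_continuous Lw cg).
Qed.

(** Prabhakar integrals of a source with an integrable singularity at the origin
    are turned by the inverse kernel into plain integrals of that source. *)
Lemma caputo_kernel_prabhakar (e t : R) (g0 g1 : R -> R) : 0 < t -> e < 1 ->
  continuous g0 -> continuous g1 ->
  convolution k (fun s => volterra be (prabhakar_profile al be ga de) 1 g0 s +
    volterra be (prabhakar_profile al be ga de) (1 - e) g1 s) t =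
  \int[mu]_(s in `]0, t[) (g0 s + s `^ (- e) * g1 s).
Proof.
move=> t0 e1 cg0 cg1; have e10 : 0 < 1 - e by rewrite subr_gt0.
pose g s := g0 s + s `^ (- e) * g1 s.
have mg : measurable_fun setT g.
  apply: measurable_funD; first exact: continuous_measurable_fun.
  exact: measurable_powR_continuous.
have L0 : L1 `]0, t[ g0 by exact: L1_continuous_oo.
have Lg : L1 `]0, t[ g by apply: L1D => //; exact: L1_powR_continuous.
have [<- _] := convolution_kernel_inverse t0 mg Lg.
apply: eq_Rintegral => s _; congr (_ * _).
rewrite -convolution_volterra1 -convolution_volterra.
have eE : 1 - e - 1 = - e by rewrite addrAC subrr add0r.
have LK0 := L1_kernel_mul (fun t t0 => @L1_prabhakar_kernel R al be ga de t al0 b0 t0) s cg0.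
have LK1 := L1_prabhakar_convolution ga de s al0 b0 e10 cg1.
rewrite /convolution -(RintegralD _ LK0 LK1); last exact: measurable_itv.
by apply: eq_Rintegral => r _; rewrite -mulrDr /g eE.
Qed.

Lemma exp_primitive_powR (c e x : R) (g : R -> R) :
  exp_primitive c e (fun y => pos_powR e y * g y) x = exp_primitive c 0 g x.
Proof.
apply: eq_Rintegral => y; rewrite inE/= in_itv/= => /andP[y0 yx].
rewrite mulr_extract mulrA; congr (_ * _).
rewrite /beta_weight subr0 subrr !powRr0 mulr1 mul1r (pos_powRE e (ltW y0)).
rewrite -(powR_add e (1 - e - 1) y0) (_ : e + (1 - e - 1) = 0); last by ring.
by rewrite powRr0.
Qed.

End kernel_inverse.

(** * Construction of a solution *)

Section derivation_rules.
Context {R : realType}.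
Implicit Types (f g : R -> R) (x df dg c : R).

Lemma is_derive_add f g x df dg : is_derive x 1 f df -> is_derive x 1 g dg ->
  is_derive x 1 (fun y => f y + g y) (df + dg).
Proof. by move=> hf hg; exact: (is_deriveD hf hg). Qed.

Lemma is_derive_sub f g x df dg : is_derive x 1 f df -> is_derive x 1 g dg ->
  is_derive x 1 (fun y => f y - g y) (df - dg).
Proof. by move=> hf hg; exact: (is_deriveB hf hg). Qed.

Lemma is_derive_mull f x df c : is_derive x 1 f df -> is_derive x 1 (fun y => c * f y) (c * df).
Proof. by move=> hf; exact: (is_deriveZ c hf). Qed.

Lemma is_derive_mulr f x df c : is_derive x 1 f df -> is_derive x 1 (fun y => f y * c) (df * c).
Proof.
move=> hf; have -> : (fun y => f y * c) = (fun y => c * f y) by apply/funext => y; rewrite mulrC.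
by rewrite mulrC; exact: is_derive_mull.
Qed.

End derivation_rules.

Section existence.
Context {R : realType}.
Notation mu := (@lebesgue_measure R).
Variables (al be ga de a b p q e1 e2 : R).
Variables (phi psi psi' M S D : R -> R) (f1 rho : R * R -> R).
Hypotheses (al0 : 0 < al) (be_itv : 0 < be < 1) (a0 : a != 0) (p0 : 0 < p) (q0 : 0 < q).
Hypotheses (e1_itv : 0 <= e1 < be) (e2_itv : 0 <= e2 < 1).
Hypotheses (cphi : continuous phi) (cpsi : continuous psi) (cM : continuous M)
  (cS : continuous S) (cf1 : continuous f1) (crho : continuous rho).
Notation F := (prabhakar_profile al be ga de).
Notation K := (prabhakar_op al be ga de).
Notation wm := (weighted_mean q M).
Notation G := (caputo_integral al be ga de).
Hypothesis SE : forall t, S t = 1 + a * volterra be F 1 S (clamp 0 q t).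
Definition nonlocal_det : R := 1 - wm S.
Notation A := nonlocal_det.
Hypothesis A0 : A != 0.

Let be0 : 0 < be. Proof. by case/andP: be_itv. Qed.
Let e20 : 0 <= e2. Proof. by case/andP: e2_itv. Qed.
Let e21 : e2 < 1. Proof. by case/andP: e2_itv. Qed.
Let e10 : 0 < 1 - e1.
Proof. by case/andP: e1_itv => _ h; case/andP: be_itv => _ h'; rewrite subr_gt0 (lt_trans h). Qed.
Let e11 : e1 < 1. Proof. by rewrite -subr_gt0. Qed.
Let be1e : 0 < be + (1 - e1) - 1.
Proof.
have -> : be + (1 - e1) - 1 = be - e1 by ring.
by rewrite subr_gt0; case/andP: e1_itv.
Qed.
Let cF : continuous F. Proof. exact: continuous_prabhakar_profile. Qed.

(** This vanishes at [t = 0] and solves the Volterra equation with right-hand side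
    [phi - phi 0 - a K phi]. *)
Definition initial_defect (t : R) : R := phi t - phi 0 * S t.
Notation N := initial_defect.

(** The part of the solution that does not depend on [rho]. *)
Definition boundary_part (z : R * R) : R :=
  expR (b * z.2) * N z.1 + S z.1 * ((psi z.2 + expR (b * z.2) * wm N) / A).

Definition singular_source (z : R * R) : R :=
  volterra be F (1 - e1) (fun s => f1 (s, z.2)) z.1.

Definition step_source (z : R * R) : R :=
  singular_source z + a * b * pos_powR e2 z.2 * K (fun s => boundary_part (s, z.2)) z.1.

Hypothesis rhoE : forall t x, 0 <= t <= q -> 0 <= x <= p ->
  rho (t, x) = step_source (t, x) + volterra_step al be ga de a b q A M S e2 rho (t, x).

Notation X := (x_primitive b e2 rho).

(** The value of the solution at [t = 0], found by solving the nonlocal condition. *)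
Definition initial_value (x : R) : R :=
  (psi x + expR (b * x) * wm N + wm (fun s => X (s, x))) / A.
Notation tau := initial_value.

(** The three summands carry the boundary values, the source and the interior of the
    rectangle, and the initial values; the first two vanish at [t = 0]. *)
Definition solution (z : R * R) : R := expR (b * z.2) * N z.1 + X z + S z.1 * tau z.2.
Notation u := solution.

Lemma continuous_initial_defect : continuous N.
Proof.
apply: continuous_sub => //; apply: continuous_mul => //; exact: continuous_cst_fun.
Qed.

Lemma continuous_exp_snd : continuous (fun z : R * R => expR (b * z.2)).
Proof. exact: (continuous_compose (@continuous_snd_fun _ _) (@continuous_expRM R b)). Qed.

Lemma continuous_comp_fst (g : R -> R) : continuous g -> continuous (fun z : R * R => g z.1).
Proof. exact: (continuous_compose (@continuous_fst_fun _ _)). Qed.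

Lemma continuous_comp_snd (g : R -> R) : continuous g -> continuous (fun z : R * R => g z.2).
Proof. exact: (continuous_compose (@continuous_snd_fun _ _)). Qed.

Lemma continuous_density_primitive : continuous X.
Proof. exact: continuous_x_primitive. Qed.

Lemma continuous_initial_value : continuous tau.
Proof.
apply: continuous_mul; last exact: continuous_cst_fun.
apply: continuous_add; last exact: (continuous_weighted_mean cM continuous_density_primitive).
apply: continuous_add => //; apply: continuous_mul; first exact: continuous_expRM.
exact: continuous_cst_fun.
Qed.

Lemma continuous_boundary_part : continuous boundary_part.
Proof.
apply: continuous_add; first by apply: continuous_mul; [exact: continuous_exp_snd|exact/continuous_comp_fst/continuous_initial_defect].
apply: continuous_mul; first exact: continuous_comp_fst.
apply: continuous_mul; last exact: continuous_cst_fun.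
apply: continuous_add; first exact: continuous_comp_snd.
by apply: continuous_mul; [exact: continuous_exp_snd|exact: continuous_cst_fun].
Qed.

Lemma continuous_singular_source : continuous singular_source.
Proof. exact: (continuous_volterra be0 e10 be1e cF cf1). Qed.

Lemma continuous_step_source : continuous step_source.
Proof.
apply: continuous_add; first exact: continuous_singular_source.
apply: continuous_mul; last first.
  exact: (continuous_prabhakar_op al0 be0 continuous_boundary_part).
apply: continuous_mul; first exact: continuous_cst_fun.
exact/continuous_comp_snd/continuous_pos_powR.
Qed.

Lemma continuous_solution : continuous u.
Proof.
apply: continuous_add; last by apply: continuous_mul; [exact: continuous_comp_fst|exact/continuous_comp_snd/continuous_initial_value].
by apply: continuous_add; [apply: continuous_mul; [exact: continuous_exp_snd|exact/continuous_comp_fst/continuous_initial_defect]|exact: continuous_density_primitive].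
Qed.

Lemma solution_split z : u z = boundary_part z + nonlocal_lift q A M S X z.
Proof.
rewrite /solution /boundary_part /nonlocal_lift /initial_value.
have E (x s w1 w2 w3 w4 c : R) :
  x + w3 + s * ((w1 + w2 + w4) / c) = x + s * ((w1 + w2) / c) + (w3 + s * (w4 / c)) by ring.
exact: E.
Qed.

Lemma resolvent0 : S 0 = 1.
Proof. by rewrite SE clamp_id ?lexx ?(ltW q0)// volterra_le0// mulr0 addr0. Qed.

Lemma initial_defect0 : N 0 = 0.
Proof. by rewrite /initial_defect resolvent0 mulr1 subrr. Qed.

(** The unknown [rho] satisfies an equation in which only the solution itself
    and the source occur. *)
Lemma density_equation t x : 0 <= t <= q -> 0 <= x <= p ->
  rho (t, x) = a * K (fun s => rho (s, x)) t +
    (a * b * (pos_powR e2 x * K (fun s => u (s, x)) t) + singular_source (t, x)).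
Proof.
move=> tq xp; rewrite rhoE// /step_source /volterra_step/=.
have cB := continuous_sectionl (y := x) continuous_boundary_part.
have cL0 : continuous (nonlocal_lift q A M S X) by apply: continuous_nonlocal_lift => //; exact: continuous_density_primitive.
have cL := continuous_sectionl (y := x) cL0.
have -> : K (fun s => u (s, x)) t = K (fun s => boundary_part (s, x)) t +
    K (fun s => nonlocal_lift q A M S X (s, x)) t.
  rewrite /prabhakar_op -volterraD//; apply: eq_volterra => s _; exact: solution_split.
have E (s c d pw k1 k2 k3 : R) :
  s + c * d * pw * k1 + (c * k2 + c * d * pw * k3) = c * k2 + (c * d * (pw * (k1 + k3)) + s) by ring.
exact: E.
Qed.

Lemma density_primitive_initial x : 0 <= x <= p -> X (0, x) = 0.
Proof.
move=> /andP[x0 xp]; rewrite /x_primitive /exp_primitive/=.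
rewrite (@eq_volterra _ _ _ _ _ (fun=> 0 * 0)).
  by rewrite volterraZ ?mul0r// ?subr_gt0//; [exact: continuous_expRM|exact: continuous_cst_fun].
move=> y /andP[y0 yx]; rewrite density_equation ?lexx ?(ltW q0) ?(ltW y0) ?(le_trans (ltW yx))//.
by rewrite /prabhakar_op /singular_source/= !volterra_le0// !mulr0 !addr0.
Qed.

Lemma solution_initial x : 0 <= x <= p -> u (0, x) = tau x.
Proof.
by move=> xp; rewrite /solution density_primitive_initial//= initial_defect0 resolvent0 mulr0 !add0r mul1r.
Qed.

Lemma solution_nonlocal x : tau x - wm (fun t => u (t, x)) = psi x.
Proof.
have -> : wm (fun t => u (t, x)) = expR (b * x) * wm N + wm (fun s => X (s, x)) + tau x * wm S.
  have cE : continuous (fun t => expR (b * x) * N t).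
    by apply: continuous_mul; [exact: continuous_cst_fun|exact: continuous_initial_defect].
  have cXx := continuous_sectionl (y := x) continuous_density_primitive.
  have cT : continuous (fun t => tau x * S t).
    by apply: continuous_mul => //; exact: continuous_cst_fun.
  rewrite -(weighted_meanZ q cM (tau x) cS) -(weighted_meanZ q cM (expR (b * x)) continuous_initial_defect).
  rewrite -(weighted_meanD q cM cE cXx) -weighted_meanD//; last exact: continuous_add.
  by apply: eq_Rintegral => s _; rewrite /solution/= [S s * _]mulrC.
have -> : tau x = (psi x + expR (b * x) * wm N + wm (fun s => X (s, x))) / A by [].
have A0' : 1 - wm S != 0 := A0.
rewrite /nonlocal_det; move: (wm S) A0' (expR (b * x) * wm N) (wm (fun s => X (s, x))) => w w0 n m.
by field.
Qed.

Lemma solution_boundary t : phi 0 - wm phi = psi 0 -> u (t, 0) = phi t.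
Proof.
move=> comp; have X0 s : X (s, 0) = 0 by exact: volterra_le0.
have wN : wm N = wm phi - phi 0 * wm S.
  rewrite -weighted_meanZ// -weighted_meanB//.
  by apply: continuous_mul => //; exact: continuous_cst_fun.
have -> : u (t, 0) = N t + S t * tau 0 by rewrite /solution/= X0 mulr0 expR0 mul1r addr0.
have -> : tau 0 = phi 0.
  rewrite /initial_value mulr0 expR0 mul1r -comp wN.
  have -> : wm (fun s => X (s, 0)) = 0.
    rewrite /weighted_mean; transitivity (\int[mu]_(s in `]0, q[) (0 : R)); last first.
      by rewrite /Rintegral integral0.
    by apply: eq_Rintegral => s _; rewrite X0 mulr0.
  have A0' : 1 - wm S != 0 := A0.
  rewrite /nonlocal_det; move: (wm S) A0' (wm phi) => w w0 m.
  by field.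
by rewrite /initial_defect [S t * _]mulrC subrK.
Qed.

Definition solution_memory : R * R -> R := x_primitive b 0 u.
Notation J := solution_memory.
Definition source_memory : R * R -> R := x_primitive b e2 f1.
Notation XF := source_memory.
Notation VF := (fun x t => volterra be F (1 - e1) (fun s => XF (s, x)) t).

Lemma continuous_solution_memory : continuous J.
Proof. exact: (continuous_x_primitive ltr01 continuous_solution). Qed.

Lemma continuous_source_memory : continuous XF.
Proof. exact: continuous_x_primitive. Qed.

(** The exponential primitive in [x] of [density_equation]; it commutes with the
    operators in [t]. *)
Lemma density_primitive_equation t x : 0 <= t <= q -> 0 <= x <= p ->
  X (t, x) = a * K (fun s => X (s, x)) t + (a * b * K (fun s => J (s, x)) t + VF x t).
Proof.
move=> tq /andP[x0 xp]; have e2p : 0 < 1 - e2 by rewrite subr_gt0.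
have cE := @continuous_expRM R b; have cu := continuous_solution; have cXc := continuous_density_primitive.
pose V g := volterra 1 (fun r => expR (b * r)) (1 - e2) g x.
pose Kr y := K (fun s => rho (s, y)) t.
pose Ku y := K (fun s => u (s, y)) t.
pose Ks y := singular_source (t, y).
have cKr : continuous Kr := continuous_sectionr (x := t) (continuous_prabhakar_op al0 be0 crho).
have cKu : continuous Ku := continuous_sectionr (x := t) (continuous_prabhakar_op al0 be0 cu).
have cKs : continuous Ks := continuous_sectionr (x := t) continuous_singular_source.
have cpK : continuous (fun y => pos_powR e2 y * Ku y).
  by apply: continuous_mul => //; exact: continuous_pos_powR.
have -> : X (t, x) = V (fun y => a * Kr y + (a * b * (pos_powR e2 y * Ku y) + Ks y)).
  apply: eq_volterra => y /andP[y0 yx].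
  by rewrite density_equation ?(ltW y0) ?(le_trans (ltW yx)).
have c1 : continuous (fun y => a * Kr y).
  by apply: continuous_mul => //; exact: continuous_cst_fun.
have c2 : continuous (fun y => a * b * (pos_powR e2 y * Ku y)).
  by apply: continuous_mul => //; exact: continuous_cst_fun.
have c3 : continuous (fun y => a * b * (pos_powR e2 y * Ku y) + Ks y) by exact: continuous_add.
rewrite /V (volterraD _ ltr01 e2p cE c1 c3) (volterraD _ ltr01 e2p cE c2 cKs).
rewrite (volterraZ _ _ ltr01 e2p cE cKr) (volterraZ _ _ ltr01 e2p cE cpK).
have e00 : 0 < 1 - 0 :> R by rewrite subr0.
have E1 : volterra 1 (fun r => expR (b * r)) (1 - e2) Kr x = K (fun s => X (s, x)) t.
  exact: (esym (volterra_swap t x be0 ltr01 ltr01 e2p cF cE crho)).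
have E2 : volterra 1 (fun r => expR (b * r)) (1 - e2) (fun y => pos_powR e2 y * Ku y) x =
    K (fun s => J (s, x)) t.
  apply: (etrans (exp_primitive_powR b e2 x Ku)).
  exact: (esym (volterra_swap t x be0 ltr01 ltr01 e00 cF cE cu)).
have E3 : volterra 1 (fun r => expR (b * r)) (1 - e2) Ks x = VF x t.
  exact: (esym (volterra_swap t x be0 e10 ltr01 e2p cF cE cf1)).
by rewrite E1 E2 E3.
Qed.

(** The Caputo-Prabhakar derivative of the solution without its two less regular
    parts, which stem from [phi] and from the singular source. *)
Definition regular_density (z : R * R) : R :=
  a * u z - a * (expR (b * z.2) * phi z.1) + a * b * J z.
Notation w := regular_density.

Lemma continuous_regular_density : continuous w.
Proof.
apply: continuous_add.
  apply: continuous_sub; first by apply: continuous_mul; [exact: continuous_cst_fun|exact: continuous_solution].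
  apply: continuous_mul; first exact: continuous_cst_fun.
  by apply: continuous_mul; [exact: continuous_exp_snd|exact: continuous_comp_fst].
by apply: continuous_mul; [exact: continuous_cst_fun|exact: continuous_solution_memory].
Qed.

Lemma solution_equation_algebra (E ph ph0 s x ta kp ks kx kj vf : R) :
  x = a * kx + (a * b * kj + vf) -> s = 1 + a * ks ->
  E * (ph - ph0 * s) + x + s * ta - ta =
  E * (ph - ph0) + (a * (E * (kp - ph0 * ks) + kx + ta * ks) - a * (E * kp) + a * b * kj + vf).
Proof. by move=> -> ->; ring. Qed.

(** The equation for the solution after inversion of the fractional derivative. *)
Lemma solution_equation t x : 0 <= t <= q -> 0 <= x <= p ->
  u (t, x) - tau x = expR (b * x) * (phi t - phi 0) + (K (fun s => w (s, x)) t + VF x t).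
Proof.
move=> tq xp.
have cc (g : R -> R) (c : R) : continuous g -> continuous (fun s => c * g s).
  by move=> cg; apply: continuous_mul => //; exact: continuous_cst_fun.
have cux := continuous_sectionl (y := x) continuous_solution.
have cJx := continuous_sectionl (y := x) continuous_solution_memory.
have cXx := continuous_sectionl (y := x) continuous_density_primitive.
have cN' := continuous_initial_defect.
have KZ (g : R -> R) c : continuous g -> K (fun s => c * g s) t = c * K g t.
  by move=> cg; exact: volterraZ.
have KD (g h : R -> R) : continuous g -> continuous h ->
    K (fun s => g s + h s) t = K g t + K h t by move=> cg ch; exact: volterraD.
have KB (g h : R -> R) : continuous g -> continuous h ->
    K (fun s => g s - h s) t = K g t - K h t by move=> cg ch; exact: volterraB.
have KN : K N t = K phi t - phi 0 * K S t.
  by rewrite KB ?KZ//; exact: cc.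
have Ku : K (fun s => u (s, x)) t =
    expR (b * x) * (K phi t - phi 0 * K S t) + K (fun s => X (s, x)) t + tau x * K S t.
  rewrite -KN -KZ// -(KZ S)// -(KD _ _ _ cXx); last exact: cc.
  rewrite -KD; last 2 first.
  - by apply: continuous_add => //; exact: cc.
  - exact: cc.
  by apply: eq_volterra => s _; rewrite /solution/= [S s * _]mulrC.
have -> : K (fun s => w (s, x)) t = a * K (fun s => u (s, x)) t - a * (expR (b * x) * K phi t) +
    a * b * K (fun s => J (s, x)) t.
  rewrite -(KZ (fun s => J (s, x)))// -(KZ (fun s => u (s, x)))// -(KZ phi)//.
  rewrite -(KZ (fun s => expR (b * x) * phi s)); last exact: cc.
  rewrite -KB; [|exact: cc|by apply/cc/cc].
  rewrite -KD//; last exact: cc.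
  by apply: continuous_sub; [exact: cc|by apply/cc/cc].
rewrite Ku; apply: (@solution_equation_algebra _ _ _ (S t)); first exact: density_primitive_equation.
by rewrite SE clamp_id.
Qed.

Hypothesis DE : forall c t, 0 < c <= t -> t < q ->
  G phi t - G phi c = \int[mu]_(s in `]c, t[) D s.
Hypothesis cD : forall t, 0 < t < q -> {for t, continuous D}.

Definition solution_derivative (z : R * R) : R :=
  expR (b * z.2) * D z.1 + (w z + z.1 `^ (- e1) * XF z).
Notation v := solution_derivative.

(** In [solution_equation] the kernel [k] undoes [K]. *)
Lemma caputo_integral_solution t x : 0 < t <= q -> 0 <= x <= p ->
  G (fun s => u (s, x)) t = expR (b * x) * G phi t +
    \int[mu]_(s in `]0, t[) (w (s, x) + s `^ (- e1) * XF (s, x)).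
Proof.
move=> /andP[t0 tq] xp.
have cw := continuous_sectionl (y := x) continuous_regular_density.
have cF1 := continuous_sectionl (y := x) continuous_source_memory.
rewrite -(caputo_kernel_prabhakar ga de al0 be_itv t0 e11 cw cF1).
have Lk := fun t => @L1_caputo_kernel R al be ga de al0 be_itv t.
have cp : continuous (fun s => phi s - phi 0) by apply: continuous_sub => //; exact: continuous_cst_fun.
have cg : continuous (fun s => K (fun s => w (s, x)) s + VF x s).
  apply: continuous_add.
    exact: (continuous_sectionl (y := x) (continuous_prabhakar_op al0 be0 continuous_regular_density)).
  exact: (continuous_sectionl (y := x) (continuous_volterra be0 e10 be1e cF continuous_source_memory)).
have Lp := L1_kernel_mul Lk t cp; have Lg := L1_kernel_mul Lk t cg.
rewrite /caputo_integral /convolution -(RintegralZl _ _ Lp); last exact: measurable_itv.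
have LZ := L1Zl (expR (b * x)) (measurable_itv _) Lp.
rewrite -(RintegralD _ LZ Lg); last exact: measurable_itv.
apply: eq_Rintegral => s; rewrite inE/= in_itv/= => /andP[s0 st].
rewrite solution_initial// solution_equation ?(ltW s0) ?(le_trans (ltW st))//.
by rewrite mulrDr mulrCA.
Qed.

Lemma solution_derivative_continuous t x : 0 < t < q -> {for (t, x), continuous v}.
Proof.
move=> /andP[t0 tq]; apply: cvgD.
  apply: cvgM; first exact: continuous_exp_snd.
  apply: (continuous_comp (f := fun z : R * R => z.1) (g := D)); first exact: continuous_fst_fun.
  by apply: cD; rewrite t0.
apply: cvgD; first exact: continuous_regular_density.
apply: cvgM; last exact: continuous_source_memory.
apply: (continuous_comp (f := fun z : R * R => z.1) (g := fun r => r `^ (- e1))).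
  exact: continuous_fst_fun.
exact: continuous_powR_at.
Qed.

Lemma solution_caputo x : 0 <= x <= p ->
  is_caputo_prabhakar q al be ga de (fun t => u (t, x)) (fun t => v (t, x)).
Proof.
move=> xp; apply: (caputo_of_increment al0 be_itv q0).
- exact: (continuous_sectionl (y := x) continuous_solution).
- have cp : continuous (fun t : R => (t, x)).
    by apply: continuous_pair; [exact: continuous_id_fun|exact: continuous_cst_fun].
  move=> s sq; apply: (continuous_comp (f := fun t => (t, x)) (g := v)); first exact: cp.
  exact: solution_derivative_continuous.
move=> c t ct tq; have /andP[c0 ct'] := ct; have t0 : 0 < t := lt_le_trans c0 ct'.
have cw := continuous_sectionl (y := x) continuous_regular_density.
have cF1 := continuous_sectionl (y := x) continuous_source_memory.
have Lw : L1 `]0, t[ (fun s => w (s, x) + s `^ (- e1) * XF (s, x)).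
  by apply: L1D => //; [exact: L1_continuous_oo|exact: L1_powR_continuous].
have Lct : L1 `]c, t[ (fun s => w (s, x) + s `^ (- e1) * XF (s, x)).
  move: Lw; apply: integrableS => // s /=; rewrite !in_itv/= => /andP[cs ->].
  by rewrite (lt_trans c0 cs).
have LD : L1 `]c, t[ D.
  apply: L1_pointwise => s /andP[cs st]; apply: cD.
  by rewrite (lt_le_trans c0)//= (le_lt_trans st).
have LED := L1Zl (expR (b * x)) (measurable_itv _) LD.
rewrite !caputo_integral_solution ?t0 ?c0 ?(ltW tq) ?(le_trans ct' (ltW tq))//.
rewrite (RintegralD _ LED Lct); last exact: measurable_itv.
rewrite (RintegralZl _ _ LD); last exact: measurable_itv.
rewrite -DE// (Rintegral_itvoo_split (b := c) _ Lw); last by rewrite (ltW c0).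
have E (e g1 g2 i1 i2 : R) : e * g1 + (i1 + i2) - (e * g2 + i1) = e * (g1 - g2) + i2 by ring.
exact: E.
Qed.

Hypothesis dpsi : forall x : R, 0 < x < p -> is_derive x 1 psi (psi' x).
Hypothesis cpsi' : forall x, 0 < x < p -> {for x, continuous psi'}.

Lemma density_primitive_derive (t x : R) : 0 < x ->
  is_derive x 1 (fun y => X (t, y)) (b * X (t, x) + x `^ (- e2) * rho (t, x)).
Proof.
move=> x0; have cr := continuous_sectionr (x := t) crho.
exact: (is_derive_exp_primitive b e21 x0 cr).
Qed.

Lemma mean_density_primitive_derive (x : R) : 0 < x -> is_derive x 1 (fun y => wm (fun s => X (s, y)))
  (b * wm (fun s => X (s, x)) + x `^ (- e2) * wm (fun s => rho (s, x))).
Proof.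
move=> x0; have e2p : 0 < 1 - e2 by rewrite subr_gt0.
have E (y : R) : wm (fun s => X (s, y)) = exp_primitive b e2 (fun y => wm (fun s => rho (s, y))) y.
  have L : L1 `]0, q[ M by exact: L1_continuous_oo.
  have := Rintegral_volterra_swap y L ltr01 e2p (@continuous_expRM R b) crho.
  rewrite /weighted_mean /x_primitive /exp_primitive /=; exact.
have -> : (fun y => wm (fun s => X (s, y))) = exp_primitive b e2 (fun y => wm (fun s => rho (s, y))).
  by apply/funext => y; exact: E.
rewrite E; apply: (is_derive_exp_primitive b e21 x0).
exact: (continuous_weighted_mean cM crho).
Qed.

Definition initial_value' (x : R) : R :=
  (psi' x + b * expR (b * x) * wm N +
   (b * wm (fun s => X (s, x)) + x `^ (- e2) * wm (fun s => rho (s, x)))) / A.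
Notation tau' := initial_value'.

Lemma initial_value_derive (x : R) : 0 < x < p -> is_derive x 1 tau (tau' x).
Proof.
move=> xp; have x0 : 0 < x by case/andP: xp.
apply: is_derive_mulr; apply: is_derive_add; last exact: mean_density_primitive_derive.
apply: is_derive_add; first exact: dpsi.
by apply: is_derive_mulr; exact: is_derive_expRM.
Qed.

Definition solution_x (z : R * R) : R :=
  b * expR (b * z.2) * N z.1 + (b * X z + z.2 `^ (- e2) * rho z) + S z.1 * tau' z.2.
Notation u_x := solution_x.

Lemma solution_x_derive (t x : R) : 0 < x < p -> is_derive x 1 (fun y => u (t, y)) (u_x (t, x)).
Proof.
move=> xp; have x0 : 0 < x by case/andP: xp.
have d1 := is_derive_mulr (N t) (is_derive_expRM b x).
have d2 := is_derive_mull (S t) (initial_value_derive xp).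
exact: (is_derive_add (is_derive_add d1 (density_primitive_derive t x0)) d2).
Qed.

Lemma continuous_snd_at (g : R -> R) (z : R * R) : {for z.2, continuous g} ->
  {for z, continuous (fun z : R * R => g z.2)}.
Proof.
move=> cg; apply: (continuous_comp (f := fun z : R * R => z.2) (g := g)); last exact: cg.
exact: continuous_snd_fun.
Qed.

Lemma solution_x_continuous t x : 0 < x < p -> {for (t, x), continuous u_x}.
Proof.
move=> xp; have x0 : 0 < x by case/andP: xp.
apply: cvgD.
  apply: cvgD.
    apply: cvgM; last exact: (continuous_comp_fst continuous_initial_defect).
    by apply: cvgM; [exact: cvg_cst|exact: continuous_exp_snd].
  apply: cvgD; first by apply: cvgM; [exact: cvg_cst|exact: continuous_density_primitive].
  apply: cvgM; last exact: crho.
  apply: (@continuous_snd_at (fun y => y `^ (- e2)) (t, x)); exact: continuous_powR_at.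
apply: cvgM; first exact: (continuous_comp_fst cS).
apply: (@continuous_snd_at tau' (t, x)) => /=.
apply: cvgM; last exact: cvg_cst.
apply: cvgD.
  apply: cvgD; first exact: cpsi'.
  apply: cvgM; last exact: cvg_cst.
  by apply: cvgM; [exact: cvg_cst|exact: continuous_expRM].
apply: cvgD.
  by apply: cvgM; [exact: cvg_cst|exact: (continuous_weighted_mean cM continuous_density_primitive)].
apply: cvgM; first exact: continuous_powR_at.
exact: (continuous_weighted_mean cM crho).
Qed.

Definition solution_derivative_x (z : R * R) : R :=
  b * expR (b * z.2) * D z.1 +
  (a * u_x z - a * (b * expR (b * z.2) * phi z.1) + a * b * (b * J z + u z) +
   z.1 `^ (- e1) * (b * XF z + z.2 `^ (- e2) * f1 z)).
Notation v_x := solution_derivative_x.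

Lemma solution_derivative_x_derive (t x : R) : 0 < x < p ->
  is_derive x 1 (fun y => v (t, y)) (v_x (t, x)).
Proof.
move=> xp; have x0 : 0 < x by case/andP: xp.
have d1 := is_derive_mulr (D t) (is_derive_expRM b x).
have d2 := is_derive_mull a (solution_x_derive t xp).
have d3 := is_derive_mull a (is_derive_mulr (phi t) (is_derive_expRM b x)).
have d4 : is_derive x 1 (fun y => J (t, y)) (b * J (t, x) + u (t, x)).
  have cr := continuous_sectionr (x := t) continuous_solution.
  have := is_derive_exp_primitive b (@ltr01 R) x0 cr.
  by rewrite oppr0 powRr0 mul1r.
have cr := continuous_sectionr (x := t) cf1.
have d5 := is_derive_mull (t `^ (- e1)) (is_derive_exp_primitive b e21 x0 cr).
have d6 := is_derive_add (is_derive_sub d2 d3) (is_derive_mull (a * b) d4).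
exact: (is_derive_add d1 (is_derive_add d6 d5)).
Qed.

(** In [v - a * u] the terms in [u] cancel; what remains is a multiple of
    [expR (b * x)] and the exponential primitives of [a * b * u] and of the source. *)
Lemma solution_pde z : v_x z - a * u_x z - b * v z = z.1 `^ (- e1) * z.2 `^ (- e2) * f1 z.
Proof.
rewrite /solution_derivative_x /solution_derivative /regular_density.
have E (ex d ux ph j uu t1 x2 xf f : R) :
  b * ex * d + (a * ux - a * (b * ex * ph) + a * b * (b * j + uu) + t1 * (b * xf + x2 * f))
  - a * ux - b * (ex * d + (a * uu - a * (ex * ph) + a * b * j + t1 * xf)) = t1 * x2 * f by ring.
exact: E.
Qed.

End existence.

(** * Vanishing of the difference of two solutions *)

Section uniqueness.
Context {R : realType}.
Notation mu := (@lebesgue_measure R).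
Variables (al be ga de a b p q : R) (M S : R -> R) (d om : R * R -> R).
Hypotheses (al0 : 0 < al) (be_itv : 0 < be < 1) (a0 : a != 0) (p0 : 0 < p) (q0 : 0 < q).
Hypotheses (cM : continuous M) (cS : continuous S) (cd : continuous d).
Notation F := (prabhakar_profile al be ga de).
Notation K := (prabhakar_op al be ga de).
Notation wm := (weighted_mean q M).
Notation G := (caputo_integral al be ga de).
Hypothesis SE : forall t, S t = 1 + a * volterra be F 1 S (clamp 0 q t).
Notation A := (1 - wm S).
Hypothesis A0 : A != 0.
Hypothesis d_clamp : forall z, d (clamp2 q p z) = d z.
Hypothesis om_cont : forall t x, 0 < t < q -> 0 < x < p ->
  {for t, continuous (fun s => om (s, x))}.
Hypothesis d_caputo : forall x c t, 0 < x < p -> 0 < c <= t -> t < q ->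
  G (fun s => d (s, x)) t - G (fun s => d (s, x)) c =
  \int[mu]_(s in `]c, t[) (om (s, x) + a * d (s, x)).
Hypothesis om_derive : forall t x : R, 0 < t < q -> 0 < x < p ->
  is_derive x 1 (fun y => om (t, y)) (b * om (t, x) + a * b * d (t, x)).
Hypothesis d_boundary : forall t, 0 <= t <= q -> d (t, 0) = 0.
Hypothesis d_nonlocal : forall x, 0 <= x <= p -> d (0, x) = wm (fun t => d (t, x)).

Let be0 : 0 < be. Proof. by case/andP: be_itv. Qed.
Let bec0 : 0 < 1 - be. Proof. by case/andP: be_itv => _; rewrite subr_gt0. Qed.
Let cF : continuous F. Proof. exact: continuous_prabhakar_profile. Qed.

Lemma continuous_zero_closure (f : R -> R) (lo hi : R) : lo < hi -> continuous f ->
  (forall y, lo < y < hi -> f y = 0) -> forall y, lo <= y <= hi -> f y = 0.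
Proof.
move=> lohi cf f0 y /andP[]; rewrite le_eqVlt => /predU1P[<- _|ly].
  have c1 : f x @[x --> lo^'+] --> f lo by apply: cvg_at_right_filter; exact: cf.
  have c2 : f x @[x --> lo^'+] --> (0 : R).
    apply: cvg_near_cst; near=> x; apply: f0.
    by apply/andP; split; near: x; [exact: nbhs_right_gt|exact: nbhs_right_lt].
  exact: (cvg_unique (@Rhausdorff R) c1 c2).
rewrite le_eqVlt => /predU1P[->|yh]; last by rewrite f0// ly.
have c1 : f x @[x --> hi^'-] --> f hi by apply: cvg_at_left_filter; exact: cf.
have c2 : f x @[x --> hi^'-] --> (0 : R).
  apply: cvg_near_cst; near=> x; apply: f0.
  by apply/andP; split; near: x; [exact: nbhs_left_gt|exact: nbhs_left_lt].
exact: (cvg_unique (@Rhausdorff R) c1 c2).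
Unshelve. all: by end_near. Qed.

Definition primitive1 (g : R * R -> R) (z : R * R) : R := \int[mu]_(s in `]0, z.1[) g (s, z.2).
Definition primitive2 (g : R * R -> R) (z : R * R) : R := \int[mu]_(y in `]0, z.2[) g (z.1, y).

Lemma continuous_primitive1 (g : R * R -> R) : continuous g -> continuous (primitive1 g).
Proof.
move=> cg; have b1 : 0 < 1 + 1 - 1 :> R by rewrite addrK.
have := continuous_volterra ltr01 ltr01 b1 (@continuous_cst_fun R R 1) cg.
rewrite (_ : (fun _ => _) = primitive1 g)//; apply/funext => z.
by apply: eq_Rintegral => s _; rewrite /beta_weight subrr !powRr0 !mul1r.
Qed.

Lemma continuous_primitive2 (g : R * R -> R) : continuous g -> continuous (primitive2 g).
Proof.
move=> cg; have csw : continuous (fun z : R * R => (z.2, z.1)).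
  by apply: continuous_pair; [exact: continuous_snd_fun|exact: continuous_fst_fun].
have c1 := continuous_primitive1 (continuous_compose csw cg).
exact: (continuous_compose csw c1).
Qed.

(** The factor [expR (- b * x)] turns the equation [om_x = b * om + a * b * d] into
    [(expR (- b * x) * om)_x = a * b * damped]. *)
Definition damped (z : R * R) : R := expR (- b * z.2) * d z.

Lemma continuous_damped : continuous damped.
Proof.
apply: continuous_mul => //.
exact: (continuous_compose (@continuous_snd_fun _ _) (@continuous_expRM R (- b))).
Qed.

(** A primitive in [t] of [om]; it is continuous up to the boundary, which is not
    known of [om]. *)
Definition caputo_potential (z : R * R) : R :=
  G (fun s => d (s, z.2)) z.1 - a * primitive1 d z.
Notation H := caputo_potential.

Lemma continuous_caputo_potential : continuous H.
Proof.
have continuous_initial_difference : continuous (fun z : R * R => d (0, z.2)).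
  exact: (continuous_compose (@continuous_snd_fun _ _) (continuous_sectionr (x := 0) cd)).
have cg2 : continuous (fun z : R * R => d z - d (0, z.2)) by exact: continuous_sub.
apply: continuous_sub; last first.
  by apply: continuous_mul; [exact: continuous_cst_fun|exact: continuous_primitive1].
have cFk := @continuous_prabhakar_profile R al (1 - be) (- ga) de al0 bec0.
have bb : 0 < 1 - be + 1 - 1 by rewrite addrK.
have := continuous_volterra bec0 ltr01 bb cFk cg2.
set f1 := (fun _ : R * R => _); set f2 := (fun _ : R * R => _).
suff -> : f1 = f2 by [].
by apply/funext => z; rewrite /f1 /f2 -convolution_volterra1.
Qed.

Lemma potential_increment x c t : 0 < x < p -> 0 < c <= t -> t < q ->
  H (t, x) - H (c, x) = \int[mu]_(s in `]c, t[) om (s, x).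
Proof.
move=> xp ct tq; have /andP[c0 ct'] := ct; have t0 : 0 < t := lt_le_trans c0 ct'.
have cdx := continuous_sectionl (y := x) cd.
have Lo : L1 `]c, t[ (fun s => om (s, x)).
  apply: L1_pointwise => s /andP[cs st]; apply: om_cont => //.
  by rewrite (lt_le_trans c0)//= (le_lt_trans st).
have Lct : L1 `]c, t[ (fun s => d (s, x)) by exact: L1_continuous_oo.
have Lt : L1 `]0, t[ (fun s => d (s, x)) by exact: L1_continuous_oo.
have LZ := L1Zl a (measurable_itv _) Lct.
have := d_caputo xp ct tq.
rewrite (RintegralD _ Lo LZ); last exact: measurable_itv.
rewrite (RintegralZl _ _ Lct); last exact: measurable_itv.
have E : primitive1 d (t, x) = primitive1 d (c, x) + \int[mu]_(s in `]c, t[) d (s, x).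
  by rewrite /primitive1/= (Rintegral_itvoo_split (b := c) _ Lt)// (ltW c0).
rewrite /caputo_potential E /=.
have alg (g1 g2 P I J : R) : g1 - g2 = J + a * I -> g1 - a * (P + I) - (g2 - a * P) = J.
  move=> h; have -> : g1 = g2 + (J + a * I) by rewrite -h addrC subrK.
  by ring.
exact: alg.
Qed.

Lemma om_increment t x y : 0 < t < q -> 0 < y <= x -> x < p ->
  expR (- b * x) * om (t, x) - expR (- b * y) * om (t, y) =
  a * b * (primitive2 damped (t, x) - primitive2 damped (t, y)).
Proof.
move=> tq /andP[y0 yx] xp; have x0 : 0 < x := lt_le_trans y0 yx.
have cr := continuous_sectionr (x := t) continuous_damped.
have L0 : L1 `]0, x[ (fun r => damped (t, r)) by exact: L1_continuous_oo.
have Ly : L1 `]y, x[ (fun r => damped (t, r)) by exact: L1_continuous_oo.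
have -> : primitive2 damped (t, x) - primitive2 damped (t, y) = \int[mu]_(r in `]y, x[) damped (t, r).
  by rewrite /primitive2/= (Rintegral_itvoo_split (b := y) _ L0) ?(ltW y0)// addrC addKr.
rewrite -(RintegralZl _ _ Ly); last exact: measurable_itv.
pose Fo r := expR (- b * r) * om (t, r).
apply: (esym (@Rintegral_derivative _ Fo (fun r => a * b * damped (t, r)) y x yx _ _)).
  move=> r /andP[yr rx]; have rp : 0 < r < p by rewrite (lt_le_trans y0 yr) (le_lt_trans rx).
  have := is_deriveM (is_derive_expRM (- b) r) (om_derive tq rp).
  rewrite (_ : _ *: _ + _ *: _ = a * b * damped (t, r)) //.
  rewrite /GRing.scale/= /damped/=; move: (expR _) (om _) (d _) => X Y Z; ring.
move=> r _; apply: cvgM; [exact: cvg_cst|exact: cr].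
Qed.

(** The integrated form of [(expR (- b * x) * om)_x = a * b * damped], integrated in
    both variables. *)
Definition mixed_potential (z : R * R) : R :=
  expR (- b * z.2) * H z - a * b * primitive1 (primitive2 damped) z.
Notation Phi := mixed_potential.

Lemma continuous_mixed_potential : continuous Phi.
Proof.
apply: continuous_sub.
  apply: continuous_mul; last exact: continuous_caputo_potential.
  exact: (continuous_compose (@continuous_snd_fun _ _) (@continuous_expRM R (- b))).
apply: continuous_mul; first exact: continuous_cst_fun.
apply: continuous_primitive1; apply: continuous_primitive2; exact: continuous_damped.
Qed.

Lemma mixed_potential_increment t c x y : 0 < c <= t -> t < q -> 0 < y <= x -> x < p ->
  Phi (t, x) - Phi (c, x) = Phi (t, y) - Phi (c, y).
Proof.
move=> ct tq yx xp; have /andP[c0 ct'] := ct; have /andP[y0 yx'] := yx.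
have x0 : 0 < x := lt_le_trans y0 yx'; have yp : y < p := le_lt_trans yx' xp.
have cP : continuous (primitive2 damped) by apply: continuous_primitive2; exact: continuous_damped.
have Lo z : 0 < z < p -> L1 `]c, t[ (fun s => om (s, z)).
  move=> zp; apply: L1_pointwise => s /andP[cs st]; apply: om_cont => //.
  by rewrite (lt_le_trans c0)//= (le_lt_trans st).
have xp' : 0 < x < p by rewrite x0. have yp' : 0 < y < p by rewrite y0.
have LP z : L1 `]c, t[ (fun s => primitive2 damped (s, z)).
  by apply: L1_continuous_oo; exact: continuous_sectionl.
have Q z : primitive1 (primitive2 damped) (t, z) - primitive1 (primitive2 damped) (c, z) =
    \int[mu]_(s in `]c, t[) primitive2 damped (s, z).
  have L0 : L1 `]0, t[ (fun s => primitive2 damped (s, z)).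
    by apply: L1_continuous_oo; exact: continuous_sectionl.
  by rewrite /primitive1/= (Rintegral_itvoo_split (b := c) _ L0) ?(ltW c0)// addrC addKr.
have E : expR (- b * x) * (H (t, x) - H (c, x)) - expR (- b * y) * (H (t, y) - H (c, y)) =
   a * b * (\int[mu]_(s in `]c, t[) primitive2 damped (s, x) -
            \int[mu]_(s in `]c, t[) primitive2 damped (s, y)).
  rewrite !potential_increment// -(RintegralB _ (LP x) (LP y)); last exact: measurable_itv.
  have LB := L1B (measurable_itv _) (LP x) (LP y).
  have Zx := L1Zl (expR (- b * x)) (measurable_itv _) (Lo _ xp').
  have Zy := L1Zl (expR (- b * y)) (measurable_itv _) (Lo _ yp').
  rewrite -(RintegralZl _ _ (Lo _ xp')); last exact: measurable_itv.
  rewrite -(RintegralZl _ _ (Lo _ yp')); last exact: measurable_itv.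
  rewrite -(RintegralB _ Zx Zy); last exact: measurable_itv.
  rewrite -(RintegralZl _ _ LB); last exact: measurable_itv.
  apply: eq_Rintegral => s; rewrite inE/= in_itv/= => /andP[cs st].
  by apply: om_increment => //; rewrite (lt_trans c0 cs) (lt_trans st).
rewrite -!Q in E; rewrite /mixed_potential/=.
have alg (h1 h2 h3 h4 q1 q2 q3 q4 x1 y1 : R) :
  x1 * (h1 - h2) - y1 * (h3 - h4) = a * b * ((q1 - q2) - (q3 - q4)) ->
  x1 * h1 - a * b * q1 - (x1 * h2 - a * b * q2) = y1 * h3 - a * b * q3 - (y1 * h4 - a * b * q4).
  move=> h; apply/eqP; rewrite -subr_eq0; apply/eqP.
  transitivity (x1 * (h1 - h2) - y1 * (h3 - h4) - a * b * ((q1 - q2) - (q3 - q4))); first by ring.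
  by rewrite h subrr.
exact: alg.
Qed.

Lemma mixed_potential_t0 x : Phi (0, x) = 0.
Proof.
rewrite /mixed_potential /caputo_potential /primitive1/= /caputo_integral convolution_le0//.
by rewrite set_itvoo0 !Rintegral_set0 !mulr0 subrr mulr0 subrr.
Qed.

Lemma Rintegral_zero (I : set R) (g : R -> R) : (forall s, I s -> g s = 0) ->
  \int[mu]_(s in I) g s = 0.
Proof.
move=> g0; transitivity (\int[mu]_(s in I) (0 : R)); last by rewrite /Rintegral integral0.
by apply: eq_Rintegral => s; rewrite inE; exact: g0.
Qed.

Lemma mixed_potential_x0 t : 0 <= t <= q -> Phi (t, 0) = 0.
Proof.
move=> /andP[t0 tq]; have d0 s : 0 <= s -> s <= t -> d (s, 0) = 0.
  by move=> s0 st; apply: d_boundary; rewrite s0 (le_trans st).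
have G0 : G (fun s => d (s, 0)) t = 0.
  apply: Rintegral_zero => s /=; rewrite in_itv/= => /andP[s0 st].
  by rewrite d0 ?(ltW s0) ?(ltW st)// d0// subrr mulr0.
have P0 : primitive1 d (t, 0) = 0.
  apply: Rintegral_zero => s /=; rewrite in_itv/= => /andP[s0 st].
  by rewrite d0 ?ltW.
have Q0 : primitive1 (primitive2 damped) (t, 0) = 0.
  by apply: Rintegral_zero => s _; rewrite /primitive2/= set_itvoo0 Rintegral_set0.
by rewrite /mixed_potential/caputo_potential/= G0 P0 Q0 !mulr0 subrr mulr0 subrr.
Qed.

(** The mixed second difference of the potential vanishes; letting [y] and then [c]
    tend to [0] gives the potential itself. *)
Lemma mixed_potential_zero t x : 0 <= t <= q -> 0 <= x <= p -> Phi (t, x) = 0.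
Proof.
have cPhi := continuous_mixed_potential.
have step1 t' c x' : 0 < c <= t' -> t' < q -> 0 < x' < p -> Phi (t', x') - Phi (c, x') = 0.
  move=> ct tq /andP[x0 xp]; have /andP[c0 ct'] := ct.
  pose f y := Phi (t', x') - Phi (c, x') - (Phi (t', y) - Phi (c, y)).
  have cf : continuous f.
    apply: continuous_sub; first exact: continuous_cst_fun.
    by apply: continuous_sub; exact: continuous_sectionr.
  have f0 y : 0 < y < x' -> f y = 0.
    move=> /andP[y0 yx]; have yx' : 0 < y <= x' by rewrite y0 ltW.
    by apply/eqP; rewrite subr_eq0; apply/eqP; exact: mixed_potential_increment.
  have z0 : 0 <= (0 : R) <= x' by rewrite lexx ltW.
  have h1 : 0 <= t' <= q by rewrite (le_trans (ltW c0) ct') ltW.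
  have h2 : 0 <= c <= q by rewrite (ltW c0) (le_trans ct') ?(ltW tq).
  have := continuous_zero_closure x0 cf f0 z0.
  by rewrite /f (mixed_potential_x0 h1) (mixed_potential_x0 h2) subrr subr0.
have step2 t' x' : 0 < t' < q -> 0 < x' < p -> Phi (t', x') = 0.
  move=> /andP[t0 tq] xp; pose f c := Phi (t', x') - Phi (c, x').
  have cf : continuous f.
    apply: continuous_sub; first exact: continuous_cst_fun.
    exact: continuous_sectionl.
  have f0 c : 0 < c < t' -> f c = 0.
    by move=> /andP[c0 ct]; apply: step1 => //; rewrite c0 ltW.
  have z0 : 0 <= (0 : R) <= t' by rewrite lexx ltW.
  by have := continuous_zero_closure t0 cf f0 z0; rewrite /f mixed_potential_t0 subr0.
have step3 t' x' : 0 <= t' <= q -> 0 < x' < p -> Phi (t', x') = 0.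
  move=> tq xp; apply: (continuous_zero_closure (f := fun s => Phi (s, x')) q0 _ _ tq).
    exact: continuous_sectionl.
  by move=> s sq; exact: step2.
move=> tq xp; apply: (continuous_zero_closure (f := fun y => Phi (t, y)) p0 _ _ xp).
  exact: continuous_sectionr.
by move=> y yp; exact: step3.
Qed.

Notation J := (x_primitive b 0 d).

Lemma memory_damped z : J z = expR (b * z.2) * primitive2 damped z.
Proof.
rewrite /x_primitive exp_primitiveE//; last exact: continuous_sectionr.
congr (_ * _); apply: eq_Rintegral => y _.
by rewrite oppr0 powRr0 mul1r /damped/= mulNr.
Qed.

Lemma continuous_difference_memory : continuous J. Proof. exact: continuous_x_primitive. Qed.

Lemma caputo_integral_identity t x : 0 <= t <= q -> 0 <= x <= p ->
  G (fun s => d (s, x)) t = \int[mu]_(s in `]0, t[) (a * d (s, x) + a * b * J (s, x)).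
Proof.
move=> tq xp; have := mixed_potential_zero tq xp.
have cdx := continuous_sectionl (y := x) cd.
have cJx := continuous_sectionl (y := x) continuous_difference_memory.
have Ld : L1 `]0, t[ (fun s => d (s, x)) by exact: L1_continuous_oo.
have LJ : L1 `]0, t[ (fun s => J (s, x)) by exact: L1_continuous_oo.
have Zd := L1Zl a (measurable_itv _) Ld; have ZJ := L1Zl (a * b) (measurable_itv _) LJ.
rewrite (RintegralD _ Zd ZJ); last exact: measurable_itv.
rewrite (RintegralZl _ _ Ld); last exact: measurable_itv.
rewrite (RintegralZl _ _ LJ); last exact: measurable_itv.
have EJ : \int[mu]_(s in `]0, t[) J (s, x) = expR (b * x) * primitive1 (primitive2 damped) (t, x).
  have cP : continuous (primitive2 damped) by apply: continuous_primitive2; exact: continuous_damped.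
  have LP : L1 `]0, t[ (fun s => primitive2 damped (s, x)).
    by apply: L1_continuous_oo; exact: continuous_sectionl.
  rewrite -(RintegralZl _ _ LP); last exact: measurable_itv.
  by apply: eq_Rintegral => s _; rewrite memory_damped.
rewrite EJ /mixed_potential /caputo_potential/= /primitive1/=.
have ee : expR (b * x) * expR (- b * x) = 1 by rewrite -expRD mulNr subrr expR0.
have alg (g e e' P I : R) : e * e' = 1 -> e' * (g - a * I) - a * b * P = 0 -> g = a * I + a * b * (e * P).
  move=> h1 h2; have h3 : e * (e' * (g - a * I) - a * b * P) = 0 by rewrite h2 mulr0.
  have h4 : e * (e' * (g - a * I) - a * b * P) = e * e' * (g - a * I) - a * b * (e * P) by ring.
  rewrite h4 h1 mul1r in h3; move/eqP: h3; rewrite subr_eq0 => /eqP h3.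
  by rewrite -h3 addrC subrK.
by move=> h; exact: (alg _ _ _ _ _ ee h).
Qed.

(** Convolving [caputo_integral_identity] with the Prabhakar kernel gives the
    equation in integrated form; both sides being continuous, it can be
    differentiated. *)
Lemma difference_equation t x : 0 <= t <= q -> 0 <= x <= p ->
  d (t, x) - d (0, x) = a * K (fun s => d (s, x)) t + a * b * K (fun s => J (s, x)) t.
Proof.
move=> tq xp.
have cdx := continuous_sectionl (y := x) cd.
have cJx := continuous_sectionl (y := x) continuous_difference_memory.
pose g s := a * d (s, x) + a * b * J (s, x).
have cg : continuous g.
  by apply: continuous_add; apply: continuous_mul => //; exact: continuous_cst_fun.
have cg2 : continuous (fun z : R * R => g z.1) := continuous_compose (@continuous_fst_fun _ _) cg.
have cKg : continuous (K g) := continuous_sectionl (y := 0) (continuous_prabhakar_op al0 be0 cg2).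
have KE s : K g s = a * K (fun s => d (s, x)) s + a * b * K (fun s => J (s, x)) s.
  rewrite /prabhakar_op volterraD//; last 2 first.
  - by apply: continuous_mul => //; exact: continuous_cst_fun.
  - by apply: continuous_mul => //; exact: continuous_cst_fun.
  by rewrite !volterraZ.
rewrite -KE.
pose y s := d (s, x) - d (0, x).
have cy : continuous y by apply: continuous_sub => //; exact: continuous_cst_fun.
have mK : measurable_fun setT (prabhakar_kernel al be ga de) by exact: measurable_prabhakar_kernel.
have LK s : 0 <= s -> L1 `]0, s[ (prabhakar_kernel al be ga de) by exact: L1_prabhakar_kernel.
have Eint r : 0 < r < q -> \int[mu]_(s in `]0, r[) (y s - K g s) = 0.
  move=> /andP[r0 rq].
  have Ly : L1 `]0, r[ y by exact: L1_continuous_oo.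
  have Lg : L1 `]0, r[ g by exact: L1_continuous_oo.
  have LKg : L1 `]0, r[ (K g) by exact: L1_continuous_oo.
  rewrite (RintegralB _ Ly LKg); last exact: measurable_itv.
  have my : measurable_fun setT y by exact: continuous_measurable_fun.
  have mg : measurable_fun setT g by exact: continuous_measurable_fun.
  have [_ E2] := convolution_kernel_inverse ga de al0 be_itv r0 my Ly.
  have [_ E3] := convolution_primitive mK LK r0 mg Lg.
  apply/eqP; rewrite subr_eq0 -E2; apply/eqP.
  have -> : \int[mu]_(s in `]0, r[) K g s = \int[mu]_(s in `]0, r[) convolution (prabhakar_kernel al be ga de) g s.
    by apply: eq_Rintegral => s _; rewrite convolution_volterra1.
  rewrite -E3; apply: eq_Rintegral => s; rewrite inE/= in_itv/= => /andP[s0 sr].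
  congr (_ * _).
  have sq : 0 <= s <= q by rewrite (ltW s0) ltW// (lt_trans sr).
  exact: (caputo_integral_identity sq xp).
have cyK : continuous (fun s => y s - K g s) by exact: continuous_sub.
have zero r : 0 < r < q -> y r - K g r = 0.
  move=> rq; have /andP[r0 rq'] := rq.
  have LyK : L1 `]0, q[ (fun s => y s - K g s) by exact: L1_continuous_oo.
  have dP := is_derive_primitive LyK rq (cyK r).
  have d0 : is_derive r 1 (fun r => \int[mu]_(s in `]0, r[) (y s - K g s)) 0.
    apply: (near_eq_is_derive _ (is_derive_cst 0 r 1)); near=> s; apply/esym/Eint.
    by apply/andP; split; near: s; [exact: lt_nbhsr|exact: lt_nbhsl].
  by have [_ <-] := dP; have [_ ->] := d0.
apply/eqP; rewrite -subr_eq0; apply/eqP.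
exact: (continuous_zero_closure q0 cyK zero tq).
Unshelve. all: by end_near. Qed.

Lemma resolvent_clamp t : S (clamp 0 q t) = S t.
Proof. by rewrite [LHS]SE [RHS]SE (@clamp_id _ _ _ (clamp 0 q t))//; apply: clamp_itv; exact: ltW. Qed.

(** The resolvent solves the equation with initial value [1], so this solves it with
    initial value [0]. *)
Definition reduced_difference (z : R * R) : R := d z - d (0, z.2) * S z.1.
Notation D := reduced_difference.

Lemma continuous_initial_difference : continuous (fun x => d (0, x)).
Proof. exact: continuous_sectionr. Qed.

Lemma continuous_reduced_difference : continuous D.
Proof.
apply: continuous_sub => //; apply: continuous_mul.
  exact: (continuous_compose (@continuous_snd_fun _ _) continuous_initial_difference).
exact: (continuous_compose (@continuous_fst_fun _ _) cS).
Qed.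

Lemma difference_initial x : 0 <= x <= p -> d (0, x) = wm (fun s => D (s, x)) / A.
Proof.
move=> xp; have cdx := continuous_sectionl (y := x) cd.
have -> : wm (fun s => D (s, x)) = d (0, x) - d (0, x) * wm S.
  rewrite {1}(d_nonlocal xp) -weighted_meanZ// -weighted_meanB//.
  by apply: continuous_mul => //; exact: continuous_cst_fun.
by rewrite -{2}[d (0, x)]mulr1 -mulrBr mulfK.
Qed.

Lemma reduced_equation t x : 0 <= t <= q -> 0 <= x <= p ->
  D (t, x) = volterra_step al be ga de a b q A M S 0 D (t, x).
Proof.
move=> tq xp; have /andP[x0 xp'] := xp.
have cDD := continuous_reduced_difference.
have cDx := continuous_sectionl (y := x) cDD.
have cJx := continuous_sectionl (y := x) continuous_difference_memory.
have cE := @continuous_expRM R b.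
have e00 : 0 < 1 - 0 :> R by rewrite subr0.
have cdS : continuous (fun s => d (0, x) * S s).
  by apply: continuous_mul => //; exact: continuous_cst_fun.
rewrite /volterra_step/=.
have -> : pos_powR 0 x = 1 by rewrite /pos_powR powRr0.
have -> : K (fun s => nonlocal_lift q A M S (x_primitive b 0 D) (s, x)) t = K (fun s => J (s, x)) t.
  apply: eq_volterra => s _; rewrite /nonlocal_lift/=.
  have -> : wm (fun s => x_primitive b 0 D (s, x)) / A = exp_primitive b 0 (fun y => d (0, y)) x.
    have L : L1 `]0, q[ M by exact: L1_continuous_oo.
    have := Rintegral_volterra_swap x L ltr01 e00 cE cDD.
    rewrite /weighted_mean /x_primitive /exp_primitive/= => ->.
    have cm := continuous_weighted_mean (q := q) cM cDD.
    rewrite mulrC -(volterraZ _ _ ltr01 e00 cE cm).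
    apply: eq_volterra => y /andP[y0 yx]; rewrite mulrC -difference_initial//.
    by rewrite (ltW y0) (le_trans (ltW yx)).
  have cDs := continuous_sectionr (x := s) cDD.
  have cz : continuous (fun y => S s * d (0, y)).
    by apply: continuous_mul; [exact: continuous_cst_fun|exact: continuous_initial_difference].
  rewrite /x_primitive /exp_primitive/= -(volterraZ _ _ ltr01 e00 cE continuous_initial_difference).
  rewrite -(volterraD _ ltr01 e00 cE cDs cz); apply: eq_volterra => y _.
  by rewrite /reduced_difference/= [S s * _]mulrC subrK.
have h := difference_equation tq xp.
have Kd : K (fun s => d (s, x)) t = K (fun s => D (s, x)) t + d (0, x) * K S t.
  rewrite /prabhakar_op -volterraZ// -volterraD//.
  by apply: eq_volterra => s _; rewrite /reduced_difference/= subrK.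
rewrite Kd in h.
have hS : S t = 1 + a * K S t by rewrite SE clamp_id.
rewrite /reduced_difference/= -/(reduced_difference) hS mulr1.
have alg (u c kd ks kj : R) : u - c = a * (kd + c * ks) + a * b * kj ->
    u - c * (1 + a * ks) = a * kd + a * b * kj.
  move=> e; have -> : u = c + (a * (kd + c * ks) + a * b * kj) by rewrite -e addrC subrK.
  by ring.
exact: alg.
Qed.

(** Both the reduced difference and, through [difference_initial], the initial
    values vanish. *)
Lemma difference_zero z : d z = 0.
Proof.
have cDD := continuous_reduced_difference.
have D_clamp w : D (clamp2 q p w) = D w.
  rewrite /reduced_difference d_clamp/= resolvent_clamp; congr (_ - _ * _).
  by rewrite -[LHS]d_clamp -[RHS]d_clamp /clamp2/= (@clamp_id _ _ _ (clamp 0 p w.2))//; apply: clamp_itv; exact: ltW.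
have e0 : 0 <= (0 : R) < 1 by rewrite lexx ltr01.
have D0 := clamped_step_unique al0 be0 a0 p0 q0 cM cS e0 cDD (A := A) (b := b) (ga := ga) (de := de).
have {}D0 w : D w = 0.
  apply: D0 => {}w; rewrite -D_clamp /clamped_step.
  have [h1 h2] := clamp2_itv p0 q0 w.
  by move: h1 h2; case: (clamp2 q p w) => t x /= h1 h2; exact: reduced_equation.
have c0 x : 0 <= x <= p -> d (0, x) = 0.
  move=> xp; rewrite difference_initial//.
  have -> : wm (fun s => D (s, x)) = 0.
    by apply: Rintegral_zero => s _; rewrite D0 mulr0.
  by rewrite mul0r.
rewrite -d_clamp; have [h1 h2] := clamp2_itv p0 q0 z.
have := D0 (clamp2 q p z); rewrite /reduced_difference c0// mul0r subr0; exact.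
Qed.

End uniqueness.

(** * Regular solutions *)

Section regular_solutions.
Context {R : realType}.
Notation mu := (@lebesgue_measure R).
Variables (p q al be ga de a b e1 e2 : R).
Variables (phi psi M S : R -> R) (f f1 : R * R -> R).
Hypotheses (p0 : 0 < p) (q0 : 0 < q) (al0 : 0 < al) (be_itv : 0 < be < 1) (a0 : a != 0).
Hypotheses (e1_itv : 0 <= e1 < be) (e2_itv : 0 <= e2 < 1).
Hypotheses (phi_reg : C0_C1 q phi) (psi_reg : C0_C1 p psi).
Hypothesis M_cont : {within `[0, q], continuous M}.
Hypothesis f1_cont : {within closure (Omega p q), continuous f1}.
Hypothesis f_def : forall z : R * R, Omega p q z ->
  f z = z.1 `^ (- e1) * z.2 `^ (- e2) * f1 z.
Hypothesis cS : continuous S.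
Hypothesis SE : forall t, S t = 1 + a * volterra be (prabhakar_profile al be ga de) 1 S (clamp 0 q t).
Notation Mc := (fun t => M (clamp 0 q t)).
Notation phic := (fun t => phi (clamp 0 q t)).
Notation psic := (fun x => psi (clamp 0 p x)).
Notation f1c := (fun z => f1 (clamp2 q p z)).
Hypothesis A0 : nonlocal_det q Mc S != 0.
Hypothesis compat : phi 0 - \int[mu]_(t in `[0, q]) (M t * phi t) = psi 0.
Notation regular := (regular_solution p q al be ga de a b f phi psi M).
Notation G := (caputo_integral al be ga de).

Lemma continuous_clamped_weight : continuous Mc.
Proof. by apply: continuous_clamp_within => //; exact: ltW. Qed.

Lemma weighted_mean_closed (g gc : R -> R) : continuous gc ->
  (forall t, 0 <= t <= q -> g t = gc t) ->
  \int[mu]_(t in `[0, q]) (M t * g t) = weighted_mean q Mc gc.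
Proof.
move=> cgc gE.
have cp : continuous (fun t => Mc t * gc t) by apply: continuous_mul => //; exact: continuous_clamped_weight.
transitivity (\int[mu]_(t in `[0, q]) (Mc t * gc t)).
  apply: eq_Rintegral => t; rewrite inE/= in_itv/= => tq.
  by rewrite gE// clamp_id.
rewrite -Rintegral_itv_obnd_cbnd; last first.
  by apply: (L1_continuous_itv (a := 0) (b := q)) => //; exact: subset_itv_oc_cc.
rewrite -Rintegral_itv_bndo_bndc//; exact: L1_continuous_oo.
Qed.

Lemma open_Omega : open (Omega p q).
Proof.
have -> : Omega p q = (fst @^-1` `]0, q[%classic) `&` (snd @^-1` `]0, p[%classic).
  by apply/seteqP; split => -[t x]; rewrite /Omega/= !in_itv.
apply: openI; apply: open_comp.
- by move=> z _; exact: continuous_fst_fun.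
- exact: interval_open.
- by move=> z _; exact: continuous_snd_fun.
- exact: interval_open.
Qed.

Lemma Omega_closure z : Omega p q z -> 0 <= z.1 <= q /\ 0 <= z.2 <= p.
Proof. by move=> [/andP[h1 h2] /andP[h3 h4]]; rewrite !ltW. Qed.

Lemma psic_derive (x : R) : 0 < x < p -> is_derive x 1 psic (derive1 psi x).
Proof.
move=> xp; have [_ dpsi _] := psi_reg.
have h : is_derive x 1 psi (derive1 psi x) by rewrite derive1E; apply: DeriveDef => //; exact: dpsi.
have /andP[x0 xp'] := xp.
apply: (near_eq_is_derive _ h); near=> y.
have y0 : 0 < y by near: y; exact: lt_nbhsr.
have yp : y < p by near: y; exact: lt_nbhsl.
by rewrite clamp_id// (ltW y0) (ltW yp).
Unshelve. all: by end_near. Qed.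

Lemma psi_derive_continuous (x : R) : 0 < x < p -> {for x, continuous (derive1 psi)}.
Proof.
move=> xp; have [_ _ cd] := psi_reg.
move: cd; rewrite continuous_open_subspace; last exact: interval_open.
by apply; rewrite inE/= in_itv.
Qed.

(** The data are clamped to the closed intervals, which makes them continuous
    everywhere, and the fixed-point equation is solved for the clamped data. *)
Lemma regular_solution_exists : exists u, regular u.
Proof.
have [e20 _] := andP e2_itv.
have cphic : continuous phic.
  by case: phi_reg => c _ _; apply: continuous_clamp_within => //; exact: ltW.
have cpsic : continuous psic.
  by case: psi_reg => c _ _; apply: continuous_clamp_within => //; exact: ltW.
have cf1c : continuous f1c by exact: continuous_clamp2_within.
have be0 : 0 < be by case/andP: be_itv.
have cM := continuous_clamped_weight.
have [D [cD DE0]] := caputo_integral_C1 ga de al0 be_itv q0 phi_reg.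
have GE t : t <= q -> G phi t = G phic t.
  move=> tq; apply: eq_caputo_integral => s /andP[s0 st].
  by rewrite clamp_id// s0 (le_trans st).
have DE c t : 0 < c <= t -> t < q -> G phic t - G phic c = \int[mu]_(s in `]c, t[) D s.
  move=> ct tq; rewrite -DE0// !GE ?(ltW tq)//.
  by case/andP: ct => _ ct; rewrite (le_trans ct)// ltW.
pose h := step_source al be ga de a b q e1 e2 phic psic Mc S f1c.
have ch : continuous h by exact: continuous_step_source.
have [rho [crho rhoE]] := clamped_step_solve ga de b (nonlocal_det q Mc S)
  al0 be0 a0 p0 q0 cM cS e2_itv ch.
pose u := solution b q e2 phic psic Mc S rho.
pose v := solution_derivative a b q e1 e2 phic psic Mc S D f1c rho.
pose u_x := solution_x b q e2 phic (derive1 psi) Mc S rho.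
pose v_x := solution_derivative_x a b q e1 e2 phic psic (derive1 psi) Mc S D f1c rho.
have cu : continuous u by exact: continuous_solution.
have du (t x : R) : 0 < x < p -> is_derive x 1 (fun y => u (t, y)) (u_x (t, x)).
  by apply: solution_x_derive => // y; exact: psic_derive.
have dv (t x : R) : 0 < x < p -> is_derive x 1 (fun y => v (t, y)) (v_x (t, x)).
  by apply: solution_derivative_x_derive => // y; exact: psic_derive.
have pu z : Omega p q z -> partial_x u z = u_x z.
  case: z => t x [_ xp]; rewrite /partial_x/= derive1E.
  by have [_ ->] := du t x xp.
have pv z : Omega p q z -> partial_x v z = v_x z.
  case: z => t x [_ xp]; rewrite /partial_x/= derive1E.
  by have [_ ->] := dv t x xp.
have z0 : 0 <= (0 : R) <= q by rewrite lexx ltW.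
have z1 : 0 <= (0 : R) <= p by rewrite lexx ltW.
exists u, v; split.
- split; first exact: continuous_subspaceT.
    move=> x xp; have xp' : 0 <= x <= p by case/andP: xp => ? ?; rewrite !ltW.
    exact: (solution_caputo al0 be_itv q0 e1_itv e2_itv cphic cpsic cM cS cf1c crho SE rhoE DE cD xp').
  apply: continuous_in_subspaceT => -[t x]; rewrite inE => -[/= tq xp].
  exact: solution_derivative_continuous.
- split; first by case=> t x [_ /= xp]; have [] := du t x xp.
  apply: (@subspace_eq_continuous _ (Omega p q) _ u_x (partial_x u)).
    by move=> z; rewrite inE => /pu ->.
  apply: continuous_in_subspaceT => -[t x]; rewrite inE => -[/= tq xp].
  by apply: (solution_x_continuous (p := p)) => // y yp; exact: psi_derive_continuous.
- case=> t x Oz; have [_ /= xp] := Oz; split; first by have [] := dv t x xp.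
  rewrite pv// pu// f_def// solution_pde/=.
  by have [h1 h2] := Omega_closure Oz; rewrite clamp2_id.
- move=> t tq; rewrite /u solution_boundary ?clamp_id//.
  rewrite -compat; congr (_ - _); apply/esym/weighted_mean_closed => // s sq.
  by rewrite clamp_id.
- move=> x xp; have cux := continuous_sectionl (y := x) cu.
  rewrite (weighted_mean_closed cux) ?clamp_id//.
  have -> : u (0, x) = initial_value b q e2 phic psic Mc S rho x.
    exact: (solution_initial al0 be_itv q0 e2_itv cphic cpsic cM cS crho SE rhoE xp).
  by rewrite solution_nonlocal// clamp_id.
Qed.

Lemma x_derivable_is_derive (u : R * R -> R) (t x : R) : x_derivable u (t, x) ->
  is_derive x 1 (fun y => u (t, y)) (partial_x u (t, x)).
Proof. by move=> h; rewrite /partial_x derive1E; exact: (DeriveDef h (erefl _)). Qed.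

Lemma eq_is_caputo_prabhakar (y z v : R -> R) : (forall t, 0 <= t <= q -> y t = z t) ->
  is_caputo_prabhakar q al be ga de y v -> is_caputo_prabhakar q al be ga de z v.
Proof.
move=> yz yv c d e c0 dq e0; have [w [w1 w2 w3]] := yv c d e c0 dq e0.
by exists w; split => // t tq; rewrite -yz// w2.
Qed.

Lemma caputo_integralB (y z : R -> R) t : continuous y -> continuous z ->
  G (fun s => y s - z s) t = G y t - G z t.
Proof.
move=> cy cz; have Lk := fun t => @L1_caputo_kernel R al be ga de al0 be_itv t.
have cy' : continuous (fun s => y s - y 0) by apply: continuous_sub => //; exact: continuous_cst_fun.
have cz' : continuous (fun s => z s - z 0) by apply: continuous_sub => //; exact: continuous_cst_fun.
rewrite /caputo_integral /convolution.
rewrite -(RintegralB _ (L1_kernel_mul Lk t cy') (L1_kernel_mul Lk t cz')); last exact: measurable_itv.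
apply: eq_Rintegral => s _; rewrite -mulrBr; congr (_ * _).
by rewrite !opprB [in RHS]addrACA [in RHS](addrC (y s)) addrACA addrC; ring.
Qed.

(** The solutions are extended by clamping to the closed rectangle; their difference
    then satisfies the assumptions of [difference_zero], those on its
    Caputo-Prabhakar derivative by [caputo_increment]. *)
Lemma regular_solution_unique u1 u2 : regular u1 -> regular u2 ->
  forall z, closure (Omega p q) z -> u1 z = u2 z.
Proof.
move=> [v1 [[cu1 cap1 cv1] [xd1 cpx1] eq1 bd1 nl1]] [v2 [[cu2 cap2 cv2] [xd2 cpx2] eq2 bd2 nl2]].
have cM := continuous_clamped_weight.
pose w1 z := u1 (clamp2 q p z); pose w2 z := u2 (clamp2 q p z).
have cw1 : continuous w1 by exact: continuous_clamp2_within.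
have cw2 : continuous w2 by exact: continuous_clamp2_within.
pose d z := w1 z - w2 z; pose om z := v1 z - v2 z - a * d z.
have cd : continuous d by exact: continuous_sub.
have clampK z : clamp2 q p (clamp2 q p z) = clamp2 q p z.
  by have [h1 h2] := clamp2_itv p0 q0 z; rewrite clamp2_id.
have vcont (v : R * R -> R) : {within Omega p q, continuous v} -> forall t x, 0 < t < q -> 0 < x < p ->
    {for t, continuous (fun s => v (s, x))}.
  rewrite continuous_open_subspace; last exact: open_Omega.
  move=> cv t x tq xp; have ct : continuous (fun s : R => (s, x)).
    by apply: continuous_pair; [exact: continuous_id_fun|exact: continuous_cst_fun].
  apply: (continuous_comp (f := fun s => (s, x)) (g := v)); first exact: ct.
  by apply: cv; rewrite inE.
have cv1' := vcont _ cv1; have cv2' := vcont _ cv2.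
have Z : forall z, d z = 0; last first.
  move=> z; rewrite closure_Omega// => -[h1 h2].
  have := Z z; rewrite /d /w1 /w2 clamp2_id// => /eqP; rewrite subr_eq0 => /eqP; exact.
apply: (@difference_zero _ al be ga de a b p q Mc S d om) => //.
- by move=> z; rewrite /d /w1 /w2 clampK.
- move=> t x tq xp; apply: cvgB; last first.
    by apply: cvgM; [exact: cvg_cst|exact: (continuous_sectionl cd (y := x))].
  by apply: cvgB; [exact: cv1'|exact: cv2'].
- move=> x c t xp ct tq; have /andP[c0 ct'] := ct.
  have xp' : 0 <= x <= p by case/andP: xp => ? ?; rewrite !ltW.
  have cw1x := continuous_sectionl (y := x) cw1.
  have cw2x := continuous_sectionl (y := x) cw2.
  have k1 : is_caputo_prabhakar q al be ga de (fun s => w1 (s, x)) (fun s => v1 (s, x)).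
    by apply: eq_is_caputo_prabhakar (cap1 x xp) => s sq; rewrite /w1 clamp2_id.
  have k2 : is_caputo_prabhakar q al be ga de (fun s => w2 (s, x)) (fun s => v2 (s, x)).
    by apply: eq_is_caputo_prabhakar (cap2 x xp) => s sq; rewrite /w2 clamp2_id.
  have i1 := caputo_increment al0 be_itv q0 k1 cw1x (fun s sq => cv1' s x sq xp) ct tq.
  have i2 := caputo_increment al0 be_itv q0 k2 cw2x (fun s sq => cv2' s x sq xp) ct tq.
  have inside s : c <= s <= t -> 0 < s < q.
    by move=> /andP[cs st]; rewrite (lt_le_trans c0)//= (le_lt_trans st).
  have L1' : L1 `]c, t[ (fun s => v1 (s, x)) by apply: L1_pointwise => s /inside sq; exact: cv1'.
  have L2' : L1 `]c, t[ (fun s => v2 (s, x)) by apply: L1_pointwise => s /inside sq; exact: cv2'.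
  transitivity (\int[mu]_(s in `]c, t[) (v1 (s, x) - v2 (s, x))); last first.
    by apply: eq_Rintegral => s _; rewrite /om subrK.
  rewrite (RintegralB _ L1' L2'); last exact: measurable_itv.
  rewrite -i1 -i2 !(caputo_integralB _ cw1x cw2x).
  have alg (x1 x2 x3 x4 : R) : x1 - x2 - (x3 - x4) = x1 - x3 - (x2 - x4) by ring.
  exact: alg.
- move=> t x tq xp.
  have Oz : Omega p q (t, x) by split.
  have [dv1 E1] := eq1 _ Oz; have [dv2 E2] := eq2 _ Oz.
  have D1 := x_derivable_is_derive dv1; have D2 := x_derivable_is_derive dv2.
  have D3 := x_derivable_is_derive (xd1 _ Oz); have D4 := x_derivable_is_derive (xd2 _ Oz).
  have Dd := is_derive_sub (is_derive_sub D1 D2) (is_derive_mull a (is_derive_sub D3 D4)).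
  have dE y : 0 < y < p -> d (t, y) = u1 (t, y) - u2 (t, y).
    move=> /andP[y0 yp]; rewrite /d /w1 /w2 clamp2_id//=; first by case/andP: tq => ? ?; rewrite !ltW.
    by rewrite !ltW.
  have -> : b * om (t, x) + a * b * d (t, x) = partial_x v1 (t, x) - partial_x v2 (t, x) -
      a * (partial_x u1 (t, x) - partial_x u2 (t, x)).
    rewrite /om; move: E1 E2.
    move: (partial_x v1 _) (partial_x v2 _) (partial_x u1 _) (partial_x u2 _) (v1 _) (v2 _) (f _) (d _).
    move=> A1 A2 B1 B2 V1 V2 ff dd h1 h2.
    have -> : A1 = ff + a * B1 + b * V1 by rewrite -h1; ring.
    have -> : A2 = ff + a * B2 + b * V2 by rewrite -h2; ring.
    by ring.
  have /andP[x0 xp'] := xp.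
  apply: (near_eq_is_derive _ Dd); near=> y.
  have y0 : 0 < y by near: y; exact: lt_nbhsr.
  have yp : y < p by near: y; exact: lt_nbhsl.
  by rewrite /om dE// y0 yp.
- move=> t tq; rewrite /d /w1 /w2 clamp2_id//=; last by rewrite lexx ltW.
  by rewrite bd1// bd2// subrr.
move=> x xp; have z0 : 0 <= (0 : R) <= q by rewrite lexx ltW.
have cw1x := continuous_sectionl (y := x) cw1.
have cw2x := continuous_sectionl (y := x) cw2.
rewrite (weighted_meanB q cM cw1x cw2x).
have -> : weighted_mean q Mc (fun s => w1 (s, x)) = u1 (0, x) - psi x.
  rewrite -(weighted_mean_closed (g := fun t => u1 (t, x)) cw1x).
    by rewrite -nl1// opprB addrC subrK.
  by move=> s sq; rewrite /w1 clamp2_id.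
have -> : weighted_mean q Mc (fun s => w2 (s, x)) = u2 (0, x) - psi x.
  rewrite -(weighted_mean_closed (g := fun t => u2 (t, x)) cw2x).
    by rewrite -nl2// opprB addrC subrK.
  by move=> s sq; rewrite /w2 clamp2_id.
by rewrite /d /w1 /w2 clamp2_id// opprB addrA subrK.
Unshelve. all: by end_near. Qed.

End regular_solutions.

(** * Existence and uniqueness *)

Theorem theorem2 (R : realType)
    (p q alpha beta gamma delta a b eps1 eps2 : R)
    (phi psi M : R -> R) (f f1 : R * R -> R)
    (p_gt0 : 0 < p) (q_gt0 : 0 < q)
    (alpha_gt0 : 0 < alpha) (beta_itv : 0 < beta < 1) (gamma_gt0 : 0 < gamma)
    (a_lt0 : a < 0) (b_lt0 : b < 0) (delta_lt0 : delta < 0)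
    (phi_reg : C0_C1 q phi) (psi_reg : C0_C1 p psi)
    (M_cont : {within `[0, q], continuous M})
    (M_neq0 : exists2 t, 0 <= t <= q & M t != 0)
    (phi_psi :
      phi 0 - \int[lebesgue_measure]_(t in `[0, q]) (M t * phi t) = psi 0)
    (f1_cont : {within closure (Omega p q), continuous f1})
    (eps1_itv : 0 <= eps1 < beta) (eps2_itv : 0 <= eps2 < 1)
    (f_def : forall z : R * R, Omega p q z ->
      f z = z.1 `^ (- eps1) * z.2 `^ (- eps2) * f1 z) :
  let E (t : R) : R :=
    E2 gamma 1 gamma 0 1 beta alpha (beta + 1) gamma gamma 1 1
       (a * t `^ beta) (delta * t `^ alpha) in
  let A : R := 1 - \int[lebesgue_measure]_(t in `[0, q])
    (M t * (1 + a * Gamma gamma * t `^ beta * E t)) in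
  let g0 : R :=
    phi 0 - phi 0 * \int[lebesgue_measure]_(t in `[0, q]) M t
    - a * Gamma gamma * phi 0
      * \int[lebesgue_measure]_(t in `[0, q]) (M t * t `^ beta * E t) in
  let G0 : R := g0 / A in
  A != 0 -> phi 0 = G0 ->
  exists u : R * R -> R,
    regular_solution p q alpha beta gamma delta a b f phi psi M u /\
    forall u' : R * R -> R,
      regular_solution p q alpha beta gamma delta a b f phi psi M u' ->
      forall z : R * R, closure (Omega p q) z -> u' z = u z.
Proof.
move=> E A g0 G0 A0 _.
have a0 : a != 0 by rewrite lt_eqF.
have be0 : 0 < beta by case/andP: beta_itv.
have [S [cS SE SE2]] := resolvent_function delta alpha_gt0 be0 gamma_gt0 (ltW q_gt0) a0.
have AE : A = nonlocal_det q (fun t => M (clamp 0 q t)) S.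
  rewrite /A /nonlocal_det; congr (1 - _).
  by apply: (weighted_mean_closed q_gt0 M_cont cS) => t tq; rewrite SE2.
have detA : nonlocal_det q (fun t => M (clamp 0 q t)) S != 0 by rewrite -AE.
have [u ureg] := regular_solution_exists b p_gt0 q_gt0 alpha_gt0 beta_itv a0 eps1_itv eps2_itv
  phi_reg psi_reg M_cont f1_cont f_def cS SE detA phi_psi.
exists u; split => // u' u'reg.
exact: (regular_solution_unique p_gt0 q_gt0 alpha_gt0 beta_itv a0 M_cont cS SE detA u'reg ureg).
Qed.
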